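(* A bounded set $K\subseteq L^2(\mathbb{R}^+)$ is relatively compact in $L^2(\mathbb{R}^+)$ if and only if $$\lim_{\xi\to+\infty}\ \sup_{f\in K}\int_{(\mathbb{R}\times\mathbb{R}^+)\setminus\left([-\xi,\xi]\times\left[\frac1\xi,\xi\right]\right)}|R_{\mathcal{M}}f(\omega,r)|^2\,d\omega\,\frac{dr}{r}=0.$$
   Context: Functions are complex-valued. $\mathbb{R}^+=(0,+\infty)$ and $L^2(\mathbb{R}^+)=L^2(\mathbb{R}^+,r^{-1}dr)$ is the space of measurable functions on $\mathbb{R}^+$ that are square integrable with respect to the Haar measure $r^{-1}dr$. The Mellin transform is $$\mathcal{M}f(\omega)=\int_0^{+\infty}f(r)r^{-2\pi i\omega}\,\frac{dr}{r},\qquad\omega\in\mathbb{R},$$ understood on $L^2(\mathbb{R}^+)$ in the Plancherel sense, i.e. $\mathcal{M}f$ is the ($L^2$, unitary) Fourier transform, with kernel $e^{-2\pi i\omega x}$, of the function $x\mapsto f(e^x)\in L^2(\mathbb{R})$. The Mellin-Rihaczek distribution of $f\in L^2(\mathbb{R}^+)$ is $$R_{\mathcal{M}}f(\omega,r)=r^{-2\pi i\omega}f(r)\,\overline{\mathcal{M}f(\omega)},\qquad(\omega,r)\in\mathbb{R}\times\mathbb{R}^+.$$ *)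

(* Defs.v *)
From HB Require Import structures.
From mathcomp Require Import all_boot all_order all_algebra.
From mathcomp Require Import ring_quotient.
From mathcomp Require Import complex.
From mathcomp Require Import all_classical all_reals all_analysis.
From mathcomp Require Import measurable_realfun.

Set Implicit Arguments.
Unset Strict Implicit.
Unset Printing Implicit Defensive.
Import Order.TTheory GRing.Theory Num.Theory.
Import numFieldNormedType.Exports.
Import ComplexField.Normc.

Local Open Scope classical_set_scope.
Local Open Scope complex_scope.
Local Open Scope ring_scope.

Section ComplexL2Functions.
Context d (T : measurableType d) (R : realType).
Variable mu : {measure set T -> \bar R}.
Implicit Types f g : T -> R[i].

(* Borel measurability for R[i] = R^2. *)
Definition cmeasurable_fun f : Prop :=
  measurable_fun setT (fun x => complex.Re (f x)) /\
  measurable_fun setT (fun x => complex.Im (f x)).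

Definition cL2norm f : \bar R := Lnorm mu 2%:E (fun x => (normc (f x))%:E).

Definition cL2 : {pred T -> R[i]} :=
  fun f => `[< cmeasurable_fun f /\ (cL2norm f < +oo)%E >].

Lemma cL2P f : reflect (cmeasurable_fun f /\ (cL2norm f < +oo)%E) (f \in cL2).
Proof. exact: asboolP. Qed.

Lemma cmeasurable_normc f : cmeasurable_fun f ->
  measurable_fun setT (fun x => normc (f x)).
Proof.
move=> [mr mi].
have -> : (fun x => normc (f x)) = (fun x => Num.sqrt
    (complex.Re (f x) ^+ 2 + complex.Im (f x) ^+ 2)).
  by apply/funext => x; case: (f x).
apply: measurableT_comp.
  by apply: continuous_measurable_fun; exact: sqrt_continuous.
by apply: measurable_funD; exact: measurable_funX.
Qed.

Lemma ReD (z w : R[i]) : complex.Re (z + w) = complex.Re z + complex.Re w.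
Proof. by case: z w => a b [a' b']. Qed.

Lemma ImD (z w : R[i]) : complex.Im (z + w) = complex.Im z + complex.Im w.
Proof. by case: z w => a b [a' b']. Qed.

Lemma cmeasurable_funD f g : cmeasurable_fun f -> cmeasurable_fun g ->
  cmeasurable_fun (fun x => f x + g x).
Proof.
move=> [fr fi] [gr gi]; split.
  by under eq_fun do rewrite ReD; exact: measurable_funD.
by under eq_fun do rewrite ImD; exact: measurable_funD.
Qed.

Lemma cmeasurable_funZ (a : R[i]) f : cmeasurable_fun f ->
  cmeasurable_fun (fun x => a * f x).
Proof.
move=> [fr fi]; case: a => a b; split.
  have -> : (fun x => complex.Re (a +i* b * f x)) =
      (fun x => a * complex.Re (f x) - b * complex.Im (f x)).
    by apply/funext => x; case: (f x).
  by apply: measurable_funB; apply: measurable_funM.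
have -> : (fun x => complex.Im (a +i* b * f x)) =
    (fun x => a * complex.Im (f x) + b * complex.Re (f x)).
  by apply/funext => x; case: (f x).
by apply: measurable_funD; apply: measurable_funM.
Qed.


Lemma cL2norm_ge0 f : (0 <= cL2norm f)%E.
Proof. exact: Lnorm_ge0. Qed.

Lemma normc_ge0 (z : R[i]) : 0 <= normc z.
Proof. by case: z => a b; exact: sqrtr_ge0. Qed.

Lemma measurable_norm_powR2 (g : T -> R) : measurable_fun setT g ->
  measurable_fun setT (fun x => (`|g x| `^ 2)%:E).
Proof.
move=> mg; apply/measurable_EFinP.
apply/(@measurableT_comp _ _ _ _ _ _ (fun x : R => x `^ 2)%R) => //.
exact/measurableT_comp.
Qed.

Lemma le_cL2norm (g h : T -> R) : measurable_fun setT g -> measurable_fun setT h ->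
  (forall x, 0 <= g x <= h x) ->
  (Lnorm mu 2%:E (EFin \o g) <= Lnorm mu 2%:E (EFin \o h))%E.
Proof.
move=> mg mh gh; rewrite unlock; apply: gt0_ler_poweR.
- by rewrite invr_ge0.
- by rewrite in_itv /= leey integral_ge0// => x _; rewrite poweR_ge0.
- by rewrite in_itv /= leey integral_ge0// => x _; rewrite poweR_ge0.
apply: ge0_le_integral => //.
- by move=> x _; rewrite poweR_ge0.
- exact: measurable_norm_powR2.
- exact: measurable_norm_powR2.
move=> x _ /=; rewrite lee_fin; have /andP[g0 gle] := gh x.
by rewrite !ger0_norm ?(le_trans g0 gle)// ge0_ler_powR// nnegrE ?(le_trans g0 gle).
Qed.

Lemma cL2normD f g : cmeasurable_fun f -> cmeasurable_fun g ->
  (cL2norm (fun x => f x + g x)%R <= cL2norm f + cL2norm g)%E.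
Proof.
move=> mf mg; have mnf := cmeasurable_normc mf; have mng := cmeasurable_normc mg.
have h1 : (1 <= 2%:E :> \bar R)%E by rewrite lee_fin ler1n.
apply: (le_trans _ (eminkowski mu mnf mng h1)).
apply: le_cL2norm.
- exact/cmeasurable_normc/cmeasurable_funD.
- exact: measurable_funD.
- by move=> x /=; rewrite normc_ge0 /= le_normcD.
Qed.

Lemma cL2normZ (a : R[i]) f : cmeasurable_fun f ->
  (cL2norm (fun x => a * f x)%R = (normc a)%:E * cL2norm f)%E.
Proof.
move=> mf; have mnf := cmeasurable_normc mf.
rewrite /cL2norm unlock.
under eq_integral do rewrite normcM /= normrM powRM ?EFinM//.
rewrite ge0_integralZl//; first last.
- exact: measurable_norm_powR2.
rewrite poweRM ?lee_fin ?powR_ge0 ?integral_ge0//.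
by rewrite poweR_EFin -powRrM mulfV// powRr1// ger0_norm// normc_ge0.
Qed.

Lemma cL2norm_cst0 : cL2norm (cst 0) = 0%E.
Proof.
rewrite /cL2norm /= [X in Lnorm _ _ X](_ : _ = cst 0%E); last first.
  by apply/funext => x /=; rewrite /normc expr0n addr0 sqrtr0.
by rewrite Lnorm0// eqe pnatr_eq0.
Qed.

Lemma cL2_submod_closed : submod_closed cL2.
Proof.
split.
  apply/cL2P; split; last by rewrite cL2norm_cst0.
  by split; exact: measurable_cst.
move=> a f g /cL2P[mf lf] /cL2P[mg lg]; apply/cL2P.
have maf := cmeasurable_funZ a mf; split; first exact: cmeasurable_funD.
apply: (le_lt_trans (cL2normD maf mg)); apply: lte_add_pinfty => //.
by rewrite cL2normZ// lte_mul_pinfty// lee_fin normc_ge0.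
Qed.

HB.instance Definition _ := GRing.isSubmodClosed.Build _ _ cL2 cL2_submod_closed.

(* Square-integrable functions, before identification of functions that are
   equal almost everywhere; the quotient is L2 below. *)
Record cL2fun := CL2fun { cL2fun_val :> T -> R[i]; _ : cL2fun_val \in cL2 }.

HB.instance Definition _ := [isSub for cL2fun_val].
HB.instance Definition _ := [Choice of cL2fun by <:].
HB.instance Definition _ := [SubChoice_isSubLmodule of cL2fun by <:].

Definition cL2null : {pred cL2fun} :=
  fun h => `[< {ae mu, forall x, h x = 0} >].

Lemma cL2null_submod_closed : submod_closed cL2null.
Proof.
split; first by apply/asboolP; apply/aeW.
move=> a f g /asboolP f0 /asboolP g0; apply/asboolP.
apply: filterS2 f0 g0 => x /= fx gx.
by rewrite /GRing.scale /GRing.add /= fx gx scaler0 addr0.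
Qed.

HB.instance Definition _ :=
  GRing.isSubmodClosed.Build _ _ cL2null cL2null_submod_closed.

End ComplexL2Functions.

Section ComplexL2Space.
Context d (T : measurableType d) (R : realType).
Variable mu : {measure set T -> \bar R}.
Local Open Scope quotient_scope.

Definition L2 : Type := Quotient.quot (@cL2null _ T R mu).

HB.instance Definition _ := GRing.Zmodule.on L2.
HB.instance Definition _ :=
  EqQuotient.copy L2 (Quotient.quot (@cL2null _ T R mu)).

Definition L2_repr (x : L2) : T -> R[i] := (repr x : cL2fun mu).
Coercion L2_repr : L2 >-> Funclass.

Lemma eqL2 (f g : cL2fun mu) :
  (\pi_L2 f = \pi_L2 g) <-> {ae mu, forall t, f t = g t}.
Proof.
have E : (\pi_L2 f == \pi_L2 g) = (f - g \in @cL2null _ T R mu).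
  by rewrite -[RHS]/(Quotient.equiv _ f g) -Quotient.idealrBE.
split.
  move=> /eqP; rewrite E => /asboolP; apply: filterS => t /= h.
  by apply/eqP; rewrite -subr_eq0; apply/eqP.
move=> h; apply/eqP; rewrite E; apply/asboolP; move: h; apply: filterS => t /= h.
by apply/eqP; move/eqP: h; rewrite -subr_eq0.
Qed.

Lemma L2_reprP (f : cL2fun mu) : {ae mu, forall t, (\pi_L2 f : L2) t = f t}.
Proof. by apply/eqL2; rewrite reprK. Qed.

Lemma piL2D (f g : cL2fun mu) : \pi_L2 (f + g) = \pi_L2 f + \pi_L2 g.
Proof. exact: (@pi_addr _ _ _ _ _ (Quotient.quot (@cL2null _ T R mu))). Qed.

Lemma piL20 : \pi_L2 (0 : cL2fun mu) = 0.
Proof. by apply: (@addrI _ (\pi_L2 0)); rewrite -piL2D !addr0. Qed.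

Definition L2_scale (a : R[i]) (x : L2) : L2 := \pi_L2 (a *: (repr x : cL2fun mu)).

Lemma piL2Z a (f : cL2fun mu) : L2_scale a (\pi_L2 f) = \pi_L2 (a *: f).
Proof.
apply/eqL2; have := L2_reprP f; apply: filterS => t /= ft.
by rewrite /GRing.scale /= -/(L2_repr _ t) ft.
Qed.

Lemma L2_scaleA a b x : L2_scale a (L2_scale b x) = L2_scale (a * b) x.
Proof. by rewrite -[x]reprK (piL2Z b) !piL2Z scalerA. Qed.

Lemma L2_scale1 : left_id 1 L2_scale.
Proof. by move=> x; rewrite -[x]reprK piL2Z scale1r. Qed.

Lemma L2_scaleDr : right_distributive L2_scale +%R.
Proof.
by move=> a x y; rewrite -[x]reprK -[y]reprK -piL2D !piL2Z -piL2D scalerDr.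
Qed.

Lemma L2_scaleDl x : {morph L2_scale^~ x : a b / a + b}.
Proof. by move=> a b; rewrite -[x]reprK !piL2Z -piL2D scalerDl. Qed.

HB.instance Definition _ := GRing.Zmodule_isLmodule.Build R[i] L2
  L2_scaleA L2_scale1 L2_scaleDr L2_scaleDl.

Definition L2norm (x : L2) : R := fine (cL2norm mu x).

Lemma cL2_cmeasurable (f : cL2fun mu) : cmeasurable_fun f.
Proof. by case: f => f /= /cL2P[]. Qed.

Lemma cL2norm_lty (f : cL2fun mu) : (cL2norm mu f < +oo)%E.
Proof. by case: f => f /= /cL2P[]. Qed.

Lemma cL2norm_fin (f : cL2fun mu) : cL2norm mu f \is a fin_num.
Proof. by rewrite ge0_fin_numE ?cL2norm_ge0// cL2norm_lty. Qed.

Lemma ae_eq_cL2norm (f g : cL2fun mu) :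
  {ae mu, forall t, f t = g t} -> cL2norm mu f = cL2norm mu g.
Proof.
move=> fg; rewrite /cL2norm unlock; congr (_ `^ _)%E.
apply: ae_eq_integral => //.
- exact: measurable_norm_powR2 (cmeasurable_normc (cL2_cmeasurable f)).
- exact: measurable_norm_powR2 (cmeasurable_normc (cL2_cmeasurable g)).
- by move: fg; apply: filterS => t /= -> _.
Qed.

Lemma L2norm_pi (f : cL2fun mu) : L2norm (\pi_L2 f) = fine (cL2norm mu f).
Proof. by congr fine; apply: ae_eq_cL2norm; exact: L2_reprP. Qed.

Lemma ler_L2normD x y : (L2norm (x + y))%:C <= (L2norm x)%:C + (L2norm y)%:C.
Proof.
rewrite -rmorphD /= lecR -[x]reprK -[y]reprK -piL2D !L2norm_pi.
rewrite -lee_fin EFinD !fineK ?cL2norm_fin//.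
by apply: cL2normD; exact: cL2_cmeasurable.
Qed.

Lemma L2normZ (a : R[i]) x : (L2norm (a *: x))%:C = `|a| * (L2norm x)%:C.
Proof.
rewrite [`|a|](_ : _ = (normc a)%:C)//.
rewrite -rmorphM /=; congr (_ %:C).
rewrite -[x]reprK [_ *: _](piL2Z a) !L2norm_pi; apply: EFin_inj.
rewrite EFinM !fineK ?cL2norm_fin// -cL2normZ//.
exact: cL2_cmeasurable.
Qed.

Lemma L2norm_eq0 x : (L2norm x)%:C = 0 -> x = 0.
Proof.
move=> x0; have {x0} : (L2norm x)%:E = 0%E.
  by rewrite -[L2norm x]/(complex.Re (L2norm x)%:C) x0.
rewrite -[x]reprK L2norm_pi fineK ?cL2norm_fin// => h.
rewrite -piL20; apply/eqL2.
have mf := cmeasurable_normc (cL2_cmeasurable (repr x)).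
have mEf : measurable_fun setT (EFin \o (fun t => normc ((repr x : cL2fun mu) t))).
  exact/measurable_EFinP.
have p0 : (0 < 2%:E :> \bar R)%E by rewrite lte_fin.
have := Lnorm_eq0_eq0 mEf p0 h.
by apply: filterS => t /= /(_ I) [] /eq0_normc ->.
Qed.

HB.instance Definition _ := Lmodule_isNormed.Build R[i] L2
  ler_L2normD L2normZ L2norm_eq0.

Lemma L2_normE (x : L2) : `|x| = (L2norm x)%:C.
Proof. by []. Qed.

(* The class of f, by convention 0 when f is not in cL2. *)
Definition toL2 (f : T -> R[i]) : L2 := \pi_L2 (insubd (0 : cL2fun mu) f).

Lemma toL2_ae (f : T -> R[i]) : f \in cL2 mu ->
  {ae mu, forall t, toL2 f t = f t}.
Proof.
move=> fL2; have := L2_reprP (insubd (0 : cL2fun mu) f).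
by apply: filterS => t; rewrite -/(toL2 f) => ->; rewrite -[_ t]/(val _ t) val_insubd fL2.
Qed.

Definition cintegral (D : set T) (f : T -> R[i]) : R[i] :=
  (\int[mu]_(x in D) complex.Re (f x)) +i* (\int[mu]_(x in D) complex.Im (f x)).

End ComplexL2Space.

Section HaarMeasure.
Context (R : realType).
Local Open Scope ereal_scope.

(* The Haar measure r^-1 dr of R^+ = ]0, +oo[, as a measure on the whole of R
   that does not charge ]-oo, 0]: a class in L2 (haar R) is thus a class of
   functions on ]0, +oo[, the values at r <= 0 being irrelevant. *)
Definition haar (A : set (measurableTypeR R)) : \bar R :=
  \int[lebesgue_measure]_(r in A `&` `]0%R, +oo[) (r^-1)%:E.

Lemma measurable_haar_density :
  measurable_fun (`]0%R, +oo[ : set (measurableTypeR R)) (fun r => (r^-1)%:E).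
Proof.
apply/measurable_EFinP; apply: open_continuous_measurable_fun => //.
move=> x; rewrite inE /= in_itv /= andbT => x0.
by apply: inv_continuous; rewrite gt_eqF.
Qed.

Let haar0 : haar set0 = 0.
Proof. by rewrite /haar set0I integral_set0. Qed.

Let haar_ge0 A : 0 <= haar A.
Proof.
apply: integral_ge0 => r [_ /=]; rewrite in_itv /= andbT => r0.
by rewrite lee_fin invr_ge0 ltW.
Qed.

Let haar_sigma_additive : semi_sigma_additive haar.
Proof.
move=> F mF tF mUF; rewrite /haar setI_bigcupl ge0_integral_bigcup//=.
- apply: is_cvg_ereal_nneg_natsum_cond => // n _ _; exact: haar_ge0.
- by move=> i; apply: measurableI.
- apply: measurable_funS measurable_haar_density => //.
  by apply: bigcup_sub => i _; exact: subIsetr.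
- move=> r [i _ [_ /=]]; rewrite in_itv /= andbT => r0.
  by rewrite lee_fin invr_ge0 ltW.
- by move=> i j _ _ [r [[Fir _] [Fjr _]]]; apply: tF => //; exists r.
Qed.

HB.instance Definition _ := isMeasure.Build _ _ _ haar
  haar0 haar_ge0 haar_sigma_additive.

Local Close Scope ereal_scope.

Let haar_sigma_finite : sigma_finite setT haar.
Proof.
exists (fun n => `]-oo, 0%R] `|` `[n.+1%:R^-1, n.+1%:R]).
  apply/esym; rewrite -subTset => x _.
  have [x0|x0] := leP x 0%R; first by exists 0%N => //; left; rewrite /= in_itv.
  pose n := Num.bound (x + x^-1)%R.
  have xV0 : 0 < x^-1 by rewrite invr_gt0.
  have nb : x + x^-1 < n.+1%:R.
    apply: (lt_le_trans (archi_boundP (addr_ge0 (ltW x0) (ltW xV0)))).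
    by rewrite ler_nat.
  exists n => //; right; rewrite /= in_itv /=; apply/andP; split.
    rewrite -[leRHS]invrK lef_pV2 ?posrE//.
    by apply: ltW; apply: lt_trans nb; rewrite ltrDr.
  by apply: ltW; apply: lt_trans nb; rewrite ltrDl.
move=> n; split; first exact: measurableU.
rewrite /haar; have -> : (`]-oo, 0%R] `|` `[n.+1%:R^-1, n.+1%:R]) `&`
    `]0%R, +oo[ = `[n.+1%:R^-1, n.+1%:R]%classic :> set R.
  apply/seteqP; split => r /=; rewrite !in_itv /= andbT.
    by move=> [[r0|//]]; rewrite ltNge r0.
  by move=> /andP[nr rn]; split; [right; rewrite nr|apply: lt_le_trans nr].
pose J : set (measurableTypeR R) := `[n.+1%:R^-1, n.+1%:R]%classic.
apply: (@le_lt_trans _ _ (\int[lebesgue_measure]_(r in J) (n.+1%:R : R)%:E)%E).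
  apply: ge0_le_integral => //=.
  - move=> r; rewrite /= in_itv /= => /andP[nr _].
    by rewrite lee_fin invr_ge0 (le_trans _ nr).
  - apply: measurable_funS measurable_haar_density => //.
    move=> r /=; rewrite !in_itv /= andbT => /andP[nr _].
    exact: lt_le_trans nr.
  - move=> r; rewrite /= in_itv /= => /andP[nr _].
    rewrite lee_fin -[leRHS]invrK lef_pV2 ?posrE//.
    exact: lt_le_trans nr.
have mJ : measurable J by exact: measurable_itv.
rewrite integral_cst// lte_mul_pinfty ?lee_fin//.
rewrite [X in (X < _)%E](lebesgue_measure_itv `[n.+1%:R^-1, n.+1%:R]).
by case: ifPn => // _; rewrite -EFinD ltry.
Qed.

HB.instance Definition _ := Measure_isSigmaFinite.Build _ _ _ haar
  haar_sigma_finite.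

End HaarMeasure.
Arguments haar R A : clear implicits.

Section MellinTransform.
Context (R : realType).
Notation leb := (@lebesgue_measure R).

(* e^(i t) *)
Definition expi (t : R) : R[i] := cos t +i* sin t.

(* The Fourier transform on L2(R) in the Plancherel sense: the limit in L2(R) of
   the (absolutely convergent) Fourier integrals of the truncations of h to
   [-n, n]. By Plancherel's theorem these Fourier integrals are in L2(R) and the
   limit exists, so that the default values of toL2 and lim are never used. *)
Definition fourierL2 (h : L2 leb) : L2 leb :=
  lim ((fun n : nat => toL2 leb (fun w =>
    cintegral leb `[- n%:R, n%:R]
      (fun x => expi (- (2 * pi * w * x)) * h x))) @ \oo).

Definition mellin (f : L2 (haar R)) : L2 leb :=
  fourierL2 (toL2 leb (fun x => f (expR x))).

(* For r > 0, the first factor is r^(-2 i pi w). *)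
Definition mellin_rihaczek (f : L2 (haar R)) (w r : R) : R[i] :=
  expi (- (2 * pi * w * ln r)) * f r * (mellin f w)^*.

(* Integral of |R_M f|^2 over D with respect to dw dr/r. *)
Definition rihaczek_energy (f : L2 (haar R)) (D : set (R * R)) : \bar R :=
  (\int[leb \x haar R]_(p in D) (normc (mellin_rihaczek f p.1 p.2) ^+ 2)%:E)%E.

End MellinTransform.

(* Supremum in [0, +oo]: ereal_sup set0 would be -oo, which matters for the
   empty (bounded, relatively compact) set K. *)
Definition nnsup {R : realType} (A : set (\bar R)) : \bar R :=
  ereal_sup (0%E |` A).

(* Main.v *)
Require Import Defs.
From mathcomp Require Import all_boot all_order all_algebra.
From mathcomp Require Import ring lra.
From mathcomp Require Import complex.
From mathcomp Require Import all_classical all_reals all_analysis.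
From mathcomp Require Import measurable_realfun.
Import Order.TTheory GRing.Theory Num.Theory.
Import numFieldNormedType.Exports.
Import ComplexField.Normc.
Local Open Scope classical_set_scope.
Local Open Scope ring_scope.
Set Implicit Arguments.
Unset Strict Implicit.
Unset Printing Implicit Defensive.

(** Since the factor [r ^ (- 2 i pi w)] has modulus 1, the squared modulus of the
    Mellin-Rihaczek distribution of [f] is the product of [|M f (w)| ^ 2] and
    [|f (r)| ^ 2]. Let [N] be the squared norm of [f], and call tail of [h] at [t]
    the integral of [|h| ^ 2] over [|x| > t]. The Mellin transform is unitary and
    the logarithmic change of variable [f (e ^ x)] is an isometry; hence the energy
    outside [[- xi, xi] x [1 / xi, xi]] is at most
      [N * (tail of M f at xi) + N * (tail of f (e ^ x) at ln xi)]
    and at least each of the two summands ([rihaczek_energy_le],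
    [rihaczek_energy_ge_freq], [rihaczek_energy_ge_time]). A tail is at most [N],
    so its square is at most [N] times the tail: small energies give small tails,
    even when [N] itself is small. Thus, for bounded [K], the energies tend to 0
    uniformly on [K] exactly when the tails of [M f] and of [f (e ^ x)] tend to 0
    uniformly on [K], and what remains is a compactness criterion in L2(R): a
    bounded set is relatively compact if and only if its elements and their
    Fourier transforms have uniformly small tails.

    Necessity ([compact_uniform_tails]): a tail that is small at [f] is small near
    [f], and a compact set is covered by finitely many neighbourhoods. Sufficiency
    ([uniform_tails_precompact]): every ultrafilter on the closure of [K] is
    Cauchy. By the tails in time, [M f] is uniformly close to the Fourier integral
    of [f (e ^ x)] truncated to a fixed interval. These integrals are bounded and
    Lipschitz with constants common to [K], so that along an ultrafilter they
    converge at each frequency, then uniformly on each bounded interval, hence in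
    L2 of that interval; the tails in frequency take care of its complement. The
    limit exists by completeness of L2 ([L2_complete]).

    The isometry of the Mellin transform rests on Plancherel's theorem
    ([complex_Plancherel]) and on the fact that [ln] carries the Haar measure to
    Lebesgue measure ([pushforward_haar_ln]). For a real function [a] of bounded
    support, damping the frequency integral of the squared modulus of the
    transform by [exp (- e |w|)] turns it into the quadratic form of [a] for the
    Poisson kernel, an approximate identity ([damped_energy]). The form is at most
    the integral of [a ^ 2], which gives one inequality as [e] tends to 0; it
    converges to this integral when [a] is bounded, and continuous except at the
    end points of an interval that supports it, which gives the other, first for
    such [a] and then by density ([real_Plancherel]). *)

(** * Affine changes of variable *)

Section AffineChange.
Context {R : realType}.
Local Notation mu := (@lebesgue_measure R).
Local Open Scope ereal_scope.

Lemma measurable_affine (b c : R) :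
  measurable_fun setT (fun s : measurableTypeR R => (b + c * s)%R : measurableTypeR R).
Proof. by apply: measurable_funD => //; apply: measurable_funM. Qed.

(** The two measures agree on the half-open intervals, and this determines
    Lebesgue measure. *)
Lemma lebesgue_measure_affine (b c : R) (c0 : (0 < c)%R) A : measurable A ->
  pushforward (mscale (NngNum (ltW c0)) mu)
    (fun s : measurableTypeR R => (b + c * s)%R : measurableTypeR R) A = mu A.
Proof.
move=> mA; apply/esym/lebesgue_measure_unique => //=.
  exact: measurable_affine.
move=> mphi _ [[x y]] _ <-; rewrite /mscale/= /pushforward /mscale.
rewrite (_ : _ @^-1` _ = `](c^-1 * (x - b))%R, (c^-1 * (y - b))%R]%classic); last first.
  apply/seteqP; split => s /=; rewrite !in_itv /= ltr_pdivrMl// ler_pdivlMl//.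
    by rewrite ltrBlDl lerBrDl.
  by rewrite ltrBlDl lerBrDl.
rewrite !lebesgue_measure_itv /= !lte_fin ltr_pM2l ?invr_gt0// ltrD2r.
case: ifPn => _; last by rewrite mule0.
rewrite -!EFinB -EFinM -mulrBr mulrA mulfV ?gt_eqF// mul1r.
by rewrite opprB addrA subrK.
Qed.

Lemma ge0_integral_affine (b c : R) (f : R -> \bar R) : (0 < c)%R ->
  measurable_fun setT f -> (forall x, 0 <= f x) ->
  \int[mu]_y f y = c%:E * \int[mu]_s f (b + c * s)%R.
Proof.
move=> c0 mf f0.
rewrite -(@ge0_integral_mscale _ _ _ mu setT measurableT (NngNum (ltW c0))
  (fun s => f (b + c * s)%R)) //; last exact: (measurableT_comp mf (measurable_affine b c)).
have := @ge0_integral_pushforward _ _ (measurableTypeR R) (measurableTypeR R) R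
  _ (measurable_affine b c) (mscale (NngNum (ltW c0)) mu) setT f measurableT mf
  (fun y _ => f0 y).
rewrite preimage_setT => <-.
by apply: eq_measure_integral => [|mT A mA _];
  [exact: measurable_affine|exact/esym/lebesgue_measure_affine].
Qed.

Lemma integral_affine (b c : R) (f : R -> R) : (0 < c)%R ->
  mu.-integrable setT (EFin \o f) ->
  (\int[mu]_y f y = c * \int[mu]_s f (b + c * s))%R.
Proof.
move=> c0 intf; have [/measurable_EFinP mf _] := integrableP _ _ _ intf.
rewrite /Rintegral integralE [X in (_ = _ * fine X)%R]integralE.
have mp := measurable_funepos (measurable_int _ intf).
have mn := measurable_funeneg (measurable_int _ intf).
have fp := integrable_pos_fin_num measurableT intf.
have fn := integrable_neg_fin_num measurableT intf.
have ep := ge0_integral_affine b c0 mp (fun x => funepos_ge0 _ _).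
have en := ge0_integral_affine b c0 mn (fun x => funeneg_ge0 _ _).
have cV : c%:E * c^-1%:E = 1 by rewrite -EFinM mulfV ?gt_eqF.
have cK z : z = c^-1%:E * (c%:E * z) by rewrite muleA [_ * c%:E]muleC cV mul1e.
have epV : \int[mu]_s (EFin \o (fun s => f (b + c * s)))%R^\+ s =
    c^-1%:E * \int[mu]_y (EFin \o f)^\+ y.
  by rewrite ep -cK !unlock.
have enV : \int[mu]_s (EFin \o (fun s => f (b + c * s)))%R^\- s =
    c^-1%:E * \int[mu]_y (EFin \o f)^\- y.
  by rewrite en -cK !unlock.
rewrite epV enV.
rewrite -(fineK fp) -(fineK fn) -!EFinM -!EFinB /=.
by rewrite -mulrBr mulrA mulfV ?gt_eqF// mul1r.
Qed.

Lemma integrable_affine (b c : R) (f : R -> R) : (0 < c)%R ->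
  mu.-integrable setT (EFin \o f) ->
  mu.-integrable setT (EFin \o (fun s => f (b + c * s)%R)).
Proof.
move=> c0 /integrableP[/measurable_EFinP mf foo]; apply/integrableP; split.
  by apply/measurable_EFinP; apply: (measurableT_comp mf); exact: measurable_affine.
move: foo; rewrite (@ge0_integral_affine b c)//; last first.
  by apply: measurableT_comp => //; exact/measurable_EFinP.
move=> h; rewrite ltNge; apply/negP; rewrite leye_eq => /eqP e.
by move: h; rewrite [X in c%:E * X]e gt0_muley ?lte_fin// ltxx.
Qed.

Lemma ge0_integral_oppr (f : R -> \bar R) :
  measurable_fun setT f -> (forall x, 0 <= f x) ->
  \int[mu]_y f y = \int[mu]_s f (- s)%R.
Proof.
move=> mf f0.
rewrite -[in RHS](preimage_setT (-%R : measurableTypeR R -> measurableTypeR R)).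
rewrite -ge0_integral_pushforward//=.
by apply: eq_measure_integral => //= A mA _; exact/esym/lebesgue_measureN.
Qed.

Lemma integrable_mul_bounded d (T : measurableType d)
    (nu : {measure set T -> \bar R}) (f g : T -> R) (M : R) :
  measurable_fun setT g -> (forall x, `|g x| <= M)%R ->
  nu.-integrable setT (EFin \o f) ->
  nu.-integrable setT (EFin \o (fun x => g x * f x)%R).
Proof.
move=> mg gM intf; have [/measurable_EFinP mf _] := integrableP _ _ _ intf.
apply: le_integrable (integrableZl measurableT M intf) => //.
  by apply/measurable_EFinP; exact: measurable_funM.
move=> x _ /=; rewrite lee_fin !normrM ler_wpM2r//.
by rewrite (le_trans (gM x))// ler_norm.
Qed.

End AffineChange.

(** * The Poisson kernel *)

Section PoissonKernel.
Context {R : realType}.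
Local Notation mu := (@lebesgue_measure R).

(** The damping factor that makes frequency integrals converge absolutely. *)
Definition abs_exp (e w : R) : R := expR (- (e * `|w|)).

Definition poisson (e t : R) : R := 2 * e / (e ^+ 2 + t ^+ 2).

Lemma abs_exp_ge0 e w : 0 <= abs_exp e w. Proof. exact: expR_ge0. Qed.

Lemma abs_exp_le1 e w : 0 <= e -> abs_exp e w <= 1.
Proof. by move=> e0; rewrite /abs_exp -expR0 ler_expR oppr_le0 mulr_ge0. Qed.

Lemma continuous_abs_exp e : continuous (abs_exp e).
Proof.
move=> w; apply: continuous_comp; last exact: continuous_expR.
apply: cvgN; apply: cvgM; first exact: cvg_cst.
exact: norm_continuous.
Qed.

Lemma measurable_abs_exp e : measurable_fun setT (abs_exp e).
Proof. by apply: continuous_measurable_fun; exact: continuous_abs_exp. Qed.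

Lemma sqrD_gt0 (e t : R) : 0 < e -> 0 < e ^+ 2 + t ^+ 2.
Proof. by move=> e0; rewrite ltr_pwDl ?exprn_gt0// sqr_ge0. Qed.

Lemma poisson_ge0 e t : 0 < e -> 0 <= poisson e t.
Proof.
by move=> e0; rewrite divr_ge0 ?mulr_ge0 // ltW// sqrD_gt0.
Qed.

Lemma continuous_cos_lin (t : R) : continuous (fun w : R => cos (t * w)).
Proof.
move=> w; apply: (@continuous_comp _ _ _ ( *%R t) cos); last exact: continuous_cos.
exact: mulrl_continuous.
Qed.

(** An antiderivative of [expR (- (e * w)) * (1 + cos (t * w))]. The summand 1
    makes the integrand nonnegative, so that the fundamental theorem of
    calculus on a half-line applies; it is subtracted afterwards. *)
Let prim (e t w : R) : R :=
  - (e^-1 * expR (- (e * w))) +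
  expR (- (e * w)) * (t * sin (t * w) - e * cos (t * w)) * (e ^+ 2 + t ^+ 2)^-1.

Let is_derive_prim e t w : 0 < e ->
  is_derive w (1:R) (prim e t) (expR (- (e * w)) * (1 + cos (t * w))).
Proof.
move=> e0; rewrite /prim; apply: is_derive_eq.
rewrite /GRing.scale /= !mulr0 !mulr1 ?addr0 ?add0r.
have := sqrD_gt0 t e0; move=> /lt0r_neq0 k0; have e1 := lt0r_neq0 e0.
by field; rewrite k0 e1.
Qed.

Let cvg_prim e t : 0 < e -> prim e t w @[w --> +oo] --> 0.
Proof.
move=> e0.
have cE : expR (- (e * w)) @[w --> +oo] --> (0 : R).
  apply: (@cvg_comp _ _ _ (fun w => e * w) (fun w : R => expR (- w)) _ (+oo%R)).
    exact: gt0_cvgMry.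
  exact: cvgr_expR.
have -> : 0 = - (e^-1 * 0) + 0 :> R by rewrite mulr0 oppr0 addr0.
apply: cvgD; first by apply: cvgN; apply: cvgMr.
(* a bound for the bounded trigonometric factor of the second summand *)
pose M := (`|t| + e) / (e ^+ 2 + t ^+ 2).
apply: (@squeeze_cvgr _ _ _ _ (fun w => - (M * expR (- (e * w)))) (fun w => M * expR (- (e * w)))).
- near=> w; have k0 : 0 <= (e ^+ 2 + t ^+ 2)^-1 by rewrite invr_ge0 ltW ?sqrD_gt0.
  rewrite -ler_norml !normrM (ger0_norm (expR_ge0 _)) (ger0_norm k0).
  rewrite [X in X * _]mulrC mulrAC; apply: ler_wpM2r; first exact: expR_ge0.
  apply: ler_wpM2r => //; rewrite (le_trans (ler_normB _ _))// !normrM lerD//.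
    by rewrite ler_piMr// ler_norml sin_geN1 sin_le1.
  by rewrite (gtr0_norm e0) ler_piMr// ?(ltW e0)// ler_norml cos_geN1 cos_le1.
- by rewrite -[X in _ --> X]oppr0; apply: cvgN; rewrite -[X in _ --> X](mulr0 M); apply: cvgMr.
- by rewrite -[X in _ --> X](mulr0 M); apply: cvgMr.
Unshelve. all: end_near. Qed.

Lemma integral_abs_exp_1Dcos e t : 0 < e ->
  (\int[mu]_w (abs_exp e w * (1 + cos (t * w)))%:E =
   (2 * (e^-1 + e / (e ^+ 2 + t ^+ 2)))%:E)%E.
Proof.
move=> e0.
have c1 : continuous (fun w : R => abs_exp e w * (1 + cos (t * w))).
  move=> w; apply: cvgM; first exact: continuous_abs_exp.
  by apply: cvgD; [exact: cvg_cst|exact: continuous_cos_lin].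
have f0 w : 0 <= abs_exp e w * (1 + cos (t * w)).
  by rewrite mulr_ge0 ?abs_exp_ge0// -lerBlDl sub0r cos_geN1.
rewrite ge0_symfun_integralT//; last first.
  by move=> w /=; rewrite /abs_exp normrN mulrN cosN.
have -> : [set x : R | 0 <= x] = `[0, +oo[%classic by rewrite set_itvcy.
rewrite (@ge0_continuous_FTC2y _ _ (prim e t) 0 0)//.
- rewrite /prim !mulr0 oppr0 expR0 sin0 cos0 mulr0 sub0r !mulr1 mul1r.
  by rewrite -EFinB -EFinM; congr EFin; rewrite sub0r opprD opprK mulNr opprK.
- by apply: continuous_subspaceT.
- exact: cvg_prim.
- apply: cvg_at_right_filter; apply: differentiable_continuous.
  by apply/derivable1_diffP; case: (@is_derive_prim e t 0 e0).
- move=> w; rewrite in_itv /= andbT => w0.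
  rewrite derive1E; rewrite (@derive_val _ _ _ _ _ _ _ (is_derive_prim t w e0)).
  by rewrite /abs_exp gtr0_norm.
Qed.

Lemma integral_abs_exp e : 0 < e -> (\int[mu]_w (abs_exp e w)%:E = (2 / e)%:E)%E.
Proof.
move=> e0; have := integral_abs_exp_1Dcos 0 e0.
under eq_integral do rewrite mul0r cos0 mulrC EFinM.
rewrite ge0_integralZl//=; last 2 first.
- by apply/measurable_EFinP; exact: measurable_abs_exp.
- by move=> w _; rewrite lee_fin abs_exp_ge0.
move=> h; have : ((2^-1 : R)%:E * ((1 + 1)%:E * \int[mu]_w (abs_exp e w)%:E) =
    (2^-1)%:E * (2 * (e^-1 + e / (e ^+ 2 + 0 ^+ 2)))%:E)%E by rewrite h.
rewrite muleA -!EFinM => hh; have := hh.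
rewrite (_ : 2^-1 * (1 + 1) = 1 :> R) ?mul1e; last by field.
move=> ->; congr EFin; field; exact: lt0r_neq0.
Qed.

Lemma integrable_abs_exp e : 0 < e -> mu.-integrable setT (EFin \o abs_exp e).
Proof.
move=> e0; apply/integrableP; split.
  apply/measurable_EFinP; exact: measurable_abs_exp.
under eq_integral do rewrite /= ger0_norm ?abs_exp_ge0//.
by rewrite integral_abs_exp// ltry.
Qed.

(** The Poisson kernel is the Fourier transform of the damping factor. *)
Lemma integral_abs_exp_cos e t : 0 < e ->
  \int[mu]_w (abs_exp e w * cos (t * w)) = poisson e t.
Proof.
move=> e0.
have ic : mu.-integrable setT (EFin \o (fun w => abs_exp e w * cos (t * w))).
  apply: le_integrable (integrable_abs_exp e0) => //.
    apply/measurable_EFinP/measurable_funM; first exact: measurable_abs_exp.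
    by apply: continuous_measurable_fun; exact: continuous_cos_lin.
  move=> w _ /=; rewrite lee_fin normrM ler_piMr// ler_norml.
  by rewrite cos_geN1 cos_le1.
have := integral_abs_exp_1Dcos t e0.
under eq_integral do rewrite mulrDr mulr1 EFinD.
rewrite integralD//; last exact: integrable_abs_exp.
rewrite integral_abs_exp// => h; rewrite /Rintegral /poisson.
move: h; rewrite -(fineK (integrable_fin_num measurableT ic)) -EFinD => -[] h.
apply: (@addrI _ (2 / e)); rewrite h; field.
by rewrite !lt0r_neq0 ?sqrD_gt0.
Qed.


(** The common profile of the rescaled Poisson kernels, a probability density. *)
Definition cauchy_density (s : R) : R := (pi * oneDsqr s)^-1.

Lemma cauchy_density_ge0 s : 0 <= cauchy_density s.
Proof. by rewrite invr_ge0 mulr_ge0 ?pi_ge0// (le_trans ler01)// oneDsqr_ge1. Qed.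

Lemma continuous_cauchy_density : continuous cauchy_density.
Proof.
have -> : cauchy_density = (fun s : R => pi^-1 * (oneDsqr s)^-1).
  by apply/funext => s; rewrite /cauchy_density invfM.
by move=> s; apply: cvgM; [exact: cvg_cst|exact: continuous_oneDsqrV].
Qed.

Lemma measurable_cauchy_density : measurable_fun setT cauchy_density.
Proof. by apply: continuous_measurable_fun; exact: continuous_cauchy_density. Qed.

Lemma integral_cauchy_density : (\int[mu]_s (cauchy_density s)%:E = 1)%E.
Proof.
rewrite ge0_symfun_integralT//; [|exact: cauchy_density_ge0
  |exact: continuous_cauchy_density|]; last first.
  by move=> s; rewrite /= /cauchy_density /oneDsqr sqrrN.
have -> : [set x : R | 0 <= x] = `[0, +oo[%classic by rewrite set_itvcy.
under eq_integral do rewrite /cauchy_density invfM EFinM.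
rewrite ge0_integralZl//=; last 2 first.
- apply/measurable_EFinP; apply: measurable_funTS.
  by apply: continuous_measurable_fun; exact: continuous_oneDsqrV.
- by rewrite lee_fin invr_ge0 pi_ge0.
rewrite integral0y_oneDsqr -!EFinM; congr EFin.
by move: (pi_gt0 R); move: (pi : R) => p p0; field; rewrite gt_eqF.
Qed.

(** The Poisson kernel for the frequency convention [2 * pi * w * x] of the
    Fourier transform. *)
Definition kernel (e x y : R) : R := poisson e (2 * pi * (x - y)).

(** All the kernels are rescalings of a single probability density: as [e]
    tends to 0 they form an approximate identity. *)
Lemma kernel_affine (e x s : R) : 0 < e ->
  e / (2 * pi) * kernel e x (x + e / (2 * pi) * s) = cauchy_density s.
Proof.
move=> e0; have p0 : (pi : R) != 0 by rewrite gt_eqF ?pi_gt0.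
have e1 := lt0r_neq0 e0; have s0 := lt0r_neq0 (@sqrD_gt0 1 s ltr01).
rewrite /kernel /poisson /cauchy_density /oneDsqr.
move: (pi : R) p0 => p p0.
rewrite (_ : 2 * p * (x - (x + e / (2 * p) * s)) = - (e * s)); last by field.
rewrite sqrrN; rewrite expr1n in s0; field; rewrite s0 p0 /=.
by rewrite gt_eqF// sqrD_gt0.
Qed.

Lemma kernel_ge0 e x y : 0 < e -> 0 <= kernel e x y.
Proof. exact: poisson_ge0. Qed.

Lemma kernelC e x y : kernel e x y = kernel e y x.
Proof. by rewrite /kernel -[y - x]opprB mulrN /poisson sqrrN. Qed.

Lemma continuous_poisson e : 0 < e -> continuous (poisson e).
Proof.
move=> e0 t; apply: cvgM; first exact: cvg_cst.
apply: cvgV; first by rewrite gt_eqF ?sqrD_gt0.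
by apply: cvgD; [exact: cvg_cst|exact: exprn_continuous].
Qed.

Lemma measurable_poisson e : 0 < e -> measurable_fun setT (poisson e).
Proof. by move=> e0; apply: continuous_measurable_fun; exact: continuous_poisson. Qed.

Lemma measurable_kernel_prod e : 0 < e ->
  measurable_fun setT (fun p : R * R => kernel e p.1 p.2).
Proof.
move=> e0; apply: (@measurableT_comp _ _ _ _ _ _ (poisson e)).
  exact: measurable_poisson.
by apply: measurable_funM => //; apply: measurable_funB.
Qed.

Lemma measurable_kernel e x : 0 < e -> measurable_fun setT (kernel e x).
Proof.
move=> e0; apply: (@measurableT_comp _ _ _ _ _ _ (poisson e)).
  exact: measurable_poisson.
by apply: measurable_funM => //; apply: measurable_funB.
Qed.

Lemma ge0_integral_kernel e x (g : R -> R) : 0 < e ->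
  measurable_fun setT g -> (forall y, 0 <= g y) ->
  (\int[mu]_y (g y * kernel e x y)%:E =
   \int[mu]_s (g (x + e / (2 * pi) * s) * cauchy_density s)%:E)%E.
Proof.
move=> e0 mg g0; have d0 : 0 < e / (2 * pi) by rewrite divr_gt0// mulr_gt0// pi_gt0.
rewrite (@ge0_integral_affine _ x (e / (2 * pi)))//; first last.
- by move=> y; rewrite lee_fin mulr_ge0// kernel_ge0.
- by apply/measurable_EFinP/measurable_funM => //; exact: measurable_kernel.
rewrite -ge0_integralZl//=.
- apply: eq_integral => s _; rewrite -EFinM; congr EFin.
  by rewrite mulrCA kernel_affine.
- apply/measurable_EFinP/measurable_funM.
    by apply: (measurableT_comp mg); exact: measurable_affine.
  by apply: (measurableT_comp (measurable_kernel x e0)); exact: measurable_affine.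
- by move=> s _; rewrite lee_fin mulr_ge0// kernel_ge0.
- by rewrite lee_fin ltW.
Qed.

Lemma integral_kernel1 e x : 0 < e -> (\int[mu]_y (kernel e x y)%:E = 1)%E.
Proof.
move=> e0; have := @ge0_integral_kernel e x (cst 1) e0 (measurable_cst _) (fun=> ler01).
under eq_integral do rewrite /= mul1r.
by under [in RHS]eq_integral do rewrite /= mul1r; rewrite integral_cauchy_density.
Qed.

Lemma integral_kernel e x (g : R -> R) : 0 < e ->
  mu.-integrable setT (EFin \o (fun y => g y * kernel e x y)) ->
  \int[mu]_y (g y * kernel e x y) =
  \int[mu]_s (g (x + e / (2 * pi) * s) * cauchy_density s).
Proof.
move=> e0 ig; have d0 : 0 < e / (2 * pi) by rewrite divr_gt0// mulr_gt0// pi_gt0.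
rewrite (@integral_affine _ x (e / (2 * pi)))// -RintegralZl//.
  by apply: eq_Rintegral => s _; rewrite mulrCA kernel_affine.
exact: (@integrable_affine _ x (e / (2 * pi)) _ d0 ig).
Qed.

End PoissonKernel.

(** * Limits and linear combinations of integrals *)

Section LimitTools.
Context d (T : measurableType d) {R : realType}.
Variable nu : {measure set T -> \bar R}.
Local Open Scope ereal_scope.

(** Fatou's lemma for an almost everywhere limit, in the form that transfers
    an upper bound to the limit. *)
Lemma ge0_integral_limit_le (f_ : nat -> T -> \bar R) (f : T -> \bar R) c :
  (forall n, measurable_fun setT (f_ n)) -> measurable_fun setT f ->
  (forall n x, 0 <= f_ n x) -> (forall x, 0 <= f x) ->
  {ae nu, forall x, f_ n x @[n --> \oo] --> f x} ->
  (\forall n \near \oo, \int[nu]_x f_ n x <= c) ->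
  \int[nu]_x f x <= c.
Proof.
move=> mf_ mf f_0 f0 f_f fc.
have mli : measurable_fun setT (fun x => limn_einf (f_ ^~ x)).
  under eq_fun do rewrite -[f_ ^~ _]/(fun n => f_ n _).
  apply/(eq_measurable_fun (fun x => - limn_esup (fun n => - f_ n x))).
    by move=> x _; rewrite -limn_einfN; congr limn_einf; apply/funext => n; rewrite /= oppeK.
  apply: measurableT_comp => //; apply: measurable_fun_limn_esup => n.
  exact: measurableT_comp.
rewrite (@ge0_ae_eq_integral _ _ _ nu setT f (fun x => limn_einf (f_ ^~ x)))//; first last.
- by apply: filterS f_f => x fx _; apply/esym; rewrite -(cvg_limn_einf_sup fx).1.
- move=> x _; rewrite limn_einf_lim; apply: lime_ge; first exact: is_cvg_einfs.
  by apply: nearW => n; apply: le_ereal_inf_tmp => _ [m _ <-].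
apply: (le_trans (@fatou _ _ _ nu setT measurableT f_ mf_ (fun n x _ => f_0 n x))).
rewrite limn_einf_lim; apply: lime_le; first exact: is_cvg_einfs.
near=> n; apply: (@le_trans _ _ (\int[nu]_x f_ n x)).
  by apply: ereal_inf_lbound; exists n => /=.
by near: n.
Unshelve. all: end_near. Qed.

Lemma Rdominated_cvg (f_ : nat -> T -> R) (f g : T -> R) :
  (forall n, measurable_fun setT (f_ n)) -> measurable_fun setT f ->
  nu.-integrable setT (EFin \o g) -> (forall n x, `|f_ n x| <= g x)%R ->
  {ae nu, forall x, (f_ n x @[n --> \oo] --> f x)%R} ->
  (\int[nu]_x f_ n x @[n --> \oo] --> \int[nu]_x f x)%R.
Proof.
move=> mf_ mf ig fg ff.
have [] := @dominated_convergence _ _ _ nu setT measurableT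
  (fun n x => (f_ n x)%:E) (EFin \o f) (EFin \o g) _ _ _ ig _.
- by move=> n; apply/measurable_EFinP.
- exact/measurable_EFinP.
- by apply: filterS ff => x fx _; apply: cvg_EFin => //; exact: nearW.
- by apply: aeW => x n _; rewrite /= lee_fin.
move=> intf _ cf; apply: fine_cvg; rewrite fineK; first exact: cf.
exact: integrable_fin_num intf.
Qed.

Lemma integrable_oppr (f : T -> R) : nu.-integrable setT (EFin \o f) ->
  nu.-integrable setT (EFin \o (fun x => - f x)%R).
Proof.
move=> intf; have -> : (fun x => - f x)%R = (fun x => -1 * f x)%R.
  by apply/funext => x; rewrite mulN1r.
by apply: (@integrable_mul_bounded R _ _ nu _ _ 1) => // x; rewrite normrN normr1.
Qed.

Lemma ge0_integral_lincomb (f g : T -> R) (c1 c2 : R) :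
  measurable_fun setT f -> measurable_fun setT g ->
  (forall x, 0 <= f x)%R -> (forall x, 0 <= g x)%R -> (0 <= c1)%R -> (0 <= c2)%R ->
  \int[nu]_x (c1 * f x + c2 * g x)%:E =
  c1%:E * \int[nu]_x (f x)%:E + c2%:E * \int[nu]_x (g x)%:E.
Proof.
move=> mf mg f0 g0 c10 c20.
under eq_integral do rewrite EFinD !EFinM.
rewrite ge0_integralD//; last 4 first.
- by move=> x _; rewrite mule_ge0// lee_fin.
- by apply: emeasurable_funM => //; exact/measurable_EFinP.
- by move=> x _; rewrite mule_ge0// lee_fin.
- by apply: emeasurable_funM => //; exact/measurable_EFinP.
by rewrite !ge0_integralZl//; try by [exact/measurable_EFinP|move=> x _; rewrite lee_fin].
Qed.

Lemma ge0_integral_le_lincomb (D : set T) (f g h : T -> R) (c1 c2 : R) :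
  measurable D -> measurable_fun setT f -> measurable_fun setT g ->
  measurable_fun setT h -> (forall x, 0 <= f x)%R -> (forall x, 0 <= g x)%R ->
  (forall x, 0 <= h x)%R -> (0 <= c1)%R -> (0 <= c2)%R ->
  (forall x, f x <= c1 * g x + c2 * h x)%R ->
  \int[nu]_(x in D) (f x)%:E <=
  c1%:E * \int[nu]_(x in D) (g x)%:E + c2%:E * \int[nu]_(x in D) (h x)%:E.
Proof.
move=> mD mf mg mh f0 g0 h0 c10 c20 fgh.
have {}mf := measurable_funTS mf : measurable_fun D f.
have {}mg := measurable_funTS mg : measurable_fun D g.
have {}mh := measurable_funTS mh : measurable_fun D h.
rewrite -!ge0_integralZl//; try by [exact/measurable_EFinP|move=> x _; rewrite lee_fin].
rewrite -ge0_integralD//; last 4 first.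
- by move=> x _; rewrite mule_ge0// lee_fin.
- by apply: emeasurable_funM => //; exact/measurable_EFinP.
- by move=> x _; rewrite mule_ge0// lee_fin.
- by apply: emeasurable_funM => //; exact/measurable_EFinP.
apply: ge0_le_integral => //.
- by move=> x _; rewrite lee_fin.
- exact/measurable_EFinP.
- by apply: emeasurable_funD; apply: emeasurable_funM => //; exact/measurable_EFinP.
- by move=> x _; rewrite -!EFinM -EFinD lee_fin.
Qed.

End LimitTools.

(** * Cosine and sine transforms *)

Section TrigLipschitz.
Context {R : realType}.

Lemma lipschitz_deriv_le1 (f df : R -> R) : (forall x, is_derive x (1:R) f (df x)) ->
  (forall x, `|df x| <= 1) -> forall x y, `|f x - f y| <= `|x - y|.
Proof.
move=> fdf df1; suff le x y : x <= y -> `|f y - f x| <= `|y - x|.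
  move=> x y; case: (leP x y) => [/le|/ltW/le//].
  by rewrite distrC [`|y - x|]distrC.
move=> xy; have cf : {within `[x, y], continuous f}.
  apply: continuous_subspaceT => z; apply: differentiable_continuous.
  by apply/derivable1_diffP; case: (fdf z).
have [c _ ->] := MVT_segment xy (fun z _ => fdf z) cf.
by rewrite normrM ler_piMl.
Qed.

Lemma cos_lipschitz (x y : R) : `|cos x - cos y| <= `|x - y|.
Proof.
apply: lipschitz_deriv_le1 => z; rewrite normrN ler_norml.
by rewrite sin_geN1 sin_le1.
Qed.

Lemma sin_lipschitz (x y : R) : `|sin x - sin y| <= `|x - y|.
Proof. by apply: lipschitz_deriv_le1 => z; rewrite ler_norml cos_geN1 cos_le1. Qed.

Lemma norm_cos_le1 (x : R) : `|cos x| <= 1.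
Proof. by rewrite ler_norml cos_geN1 cos_le1. Qed.

Lemma norm_sin_le1 (x : R) : `|sin x| <= 1.
Proof. by rewrite ler_norml sin_geN1 sin_le1. Qed.

End TrigLipschitz.

Section RealFourier.
Context {R : realType}.
Local Notation mu := (@lebesgue_measure R).

Definition cosT (a : R -> R) (w : R) : R := \int[mu]_x (cos (2 * pi * w * x) * a x).
Definition sinT (a : R -> R) (w : R) : R := \int[mu]_x (sin (2 * pi * w * x) * a x).

Lemma measurable_cos_freq (w : R) : measurable_fun setT (fun x : R => cos (2 * pi * w * x)).
Proof. by apply: continuous_measurable_fun; exact: continuous_cos_lin. Qed.

Lemma measurable_sin_freq (w : R) : measurable_fun setT (fun x : R => sin (2 * pi * w * x)).
Proof.
apply: continuous_measurable_fun => x.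
apply: (@continuous_comp _ _ _ ( *%R (2 * pi * w)) sin); last exact: continuous_sin.
exact: mulrl_continuous.
Qed.

Lemma integrable_cosT a w : mu.-integrable setT (EFin \o a) ->
  mu.-integrable setT (EFin \o (fun x => cos (2 * pi * w * x) * a x)).
Proof.
apply: integrable_mul_bounded; first exact: measurable_cos_freq.
by move=> x; exact: norm_cos_le1.
Qed.

Lemma integrable_sinT a w : mu.-integrable setT (EFin \o a) ->
  mu.-integrable setT (EFin \o (fun x => sin (2 * pi * w * x) * a x)).
Proof.
apply: integrable_mul_bounded; first exact: measurable_sin_freq.
by move=> x; exact: norm_sin_le1.
Qed.

Lemma cosTD a b w : mu.-integrable setT (EFin \o a) -> mu.-integrable setT (EFin \o b) ->
  cosT (fun x => a x + b x) w = cosT a w + cosT b w.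
Proof.
move=> ia ib; rewrite /cosT -RintegralD//; try exact: integrable_cosT.
by apply: eq_Rintegral => x _; rewrite mulrDr.
Qed.

Lemma sinTD a b w : mu.-integrable setT (EFin \o a) -> mu.-integrable setT (EFin \o b) ->
  sinT (fun x => a x + b x) w = sinT a w + sinT b w.
Proof.
move=> ia ib; rewrite /sinT -RintegralD//; try exact: integrable_sinT.
by apply: eq_Rintegral => x _; rewrite mulrDr.
Qed.

Lemma cosTN a w : mu.-integrable setT (EFin \o a) ->
  cosT (fun x => - a x) w = - cosT a w.
Proof.
move=> ia; rewrite -mulN1r /cosT -RintegralZl//; last exact: integrable_cosT.
by apply: eq_Rintegral => x _; rewrite mulN1r mulrN.
Qed.

Lemma sinTN a w : mu.-integrable setT (EFin \o a) ->
  sinT (fun x => - a x) w = - sinT a w.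
Proof.
move=> ia; rewrite -mulN1r /sinT -RintegralZl//; last exact: integrable_sinT.
by apply: eq_Rintegral => x _; rewrite mulN1r mulrN.
Qed.

Lemma cosT_opp a w : cosT a (- w) = cosT a w.
Proof. by apply: eq_Rintegral => x _; rewrite mulrN mulNr cosN. Qed.

Lemma sinT_opp a w : mu.-integrable setT (EFin \o a) -> sinT a (- w) = - sinT a w.
Proof.
move=> ia; rewrite -[RHS]mulN1r /sinT -RintegralZl//; last exact: integrable_sinT.
by apply: eq_Rintegral => x _; rewrite mulrN mulNr sinN mulN1r mulNr.
Qed.

Lemma norm_cosT_le a w : mu.-integrable setT (EFin \o a) ->
  `|cosT a w| <= \int[mu]_x `|a x|.
Proof.
move=> ia; apply: (le_trans (le_normr_Rintegral _ (integrable_cosT w ia))) => //.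
apply: le_Rintegral => //; first exact: integrable_norm (integrable_cosT w ia).
  exact: integrable_norm ia.
by move=> x _; rewrite normrM ler_piMl// norm_cos_le1.
Qed.

Lemma norm_sinT_le a w : mu.-integrable setT (EFin \o a) ->
  `|sinT a w| <= \int[mu]_x `|a x|.
Proof.
move=> ia; apply: (le_trans (le_normr_Rintegral _ (integrable_sinT w ia))) => //.
apply: le_Rintegral => //; first exact: integrable_norm (integrable_sinT w ia).
  exact: integrable_norm ia.
by move=> x _; rewrite normrM ler_piMl// norm_sin_le1.
Qed.

Let freq_dist (S w v x y : R) : (S < `|x| -> y = 0) -> 0 <= S ->
  `|2 * pi * w * x - 2 * pi * v * x| * `|y| <= 2 * pi * S * `|w - v| * `|y|.
Proof.
move=> a0 S0; case: (leP `|x| S) => [xS|/a0 ->]; last by rewrite normr0 !mulr0.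
apply: ler_wpM2r => //; rewrite -mulrBl -mulrBr !normrM.
rewrite ger0_norm// (ger0_norm (pi_ge0 _)) -[leRHS]mulrA [S * _]mulrC mulrA.
by apply: ler_wpM2l => //; rewrite !mulr_ge0// pi_ge0.
Qed.

(** On the support the phases at the frequencies [w] and [v] differ by at most
    [2 * pi * S * `|w - v|]. The Lipschitz constant depends on [a] only
    through its L1 norm and its support; this is what makes the Fourier
    transforms of a bounded family equicontinuous. *)
Lemma cosT_lipschitz a S : 0 <= S -> mu.-integrable setT (EFin \o a) ->
  (forall x, S < `|x| -> a x = 0) ->
  forall w v, `|cosT a w - cosT a v| <= 2 * pi * S * (\int[mu]_x `|a x|) * `|w - v|.
Proof.
move=> S0 ia a0 w v; have iw := integrable_cosT w ia; have iv := integrable_cosT v ia.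
have iB : mu.-integrable setT (EFin \o (fun x =>
    cos (2 * pi * w * x) * a x - cos (2 * pi * v * x) * a x)).
  exact: (integrableB measurableT iw iv).
rewrite /cosT -RintegralB// (le_trans (le_normr_Rintegral _ iB))//.
rewrite -[leRHS]mulrA [_ * `|w - v|]mulrC mulrA -RintegralZl//; last exact: integrable_norm ia.
apply: le_Rintegral => //; first exact: integrable_norm iB.
  exact: (integrableZl _ _ (integrable_norm ia)).
move=> x _; rewrite -mulrBl normrM; apply: le_trans (freq_dist w v (a0 x) S0).
by apply: ler_wpM2r => //; exact: cos_lipschitz.
Qed.

Lemma sinT_lipschitz a S : 0 <= S -> mu.-integrable setT (EFin \o a) ->
  (forall x, S < `|x| -> a x = 0) ->
  forall w v, `|sinT a w - sinT a v| <= 2 * pi * S * (\int[mu]_x `|a x|) * `|w - v|.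
Proof.
move=> S0 ia a0 w v; have iw := integrable_sinT w ia; have iv := integrable_sinT v ia.
have iB : mu.-integrable setT (EFin \o (fun x =>
    sin (2 * pi * w * x) * a x - sin (2 * pi * v * x) * a x)).
  exact: (integrableB measurableT iw iv).
rewrite /sinT -RintegralB// (le_trans (le_normr_Rintegral _ iB))//.
rewrite -[leRHS]mulrA [_ * `|w - v|]mulrC mulrA -RintegralZl//; last exact: integrable_norm ia.
apply: le_Rintegral => //; first exact: integrable_norm iB.
  exact: (integrableZl _ _ (integrable_norm ia)).
move=> x _; rewrite -mulrBl normrM; apply: le_trans (freq_dist w v (a0 x) S0).
by apply: ler_wpM2r => //; exact: sin_lipschitz.
Qed.

Lemma lipschitz_continuous (f : R -> R) (k : R) :
  (forall w v, `|f w - f v| <= k * `|w - v|) -> continuous f.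
Proof.
move=> fk w; apply/cvgrPdist_le => e e0.
have k0 : 0 < `|k| + 1 by rewrite ltr_pwDr.
near=> v; rewrite (le_trans (fk _ _))// (@le_trans _ _ ((`|k| + 1) * `|w - v|))//.
  by rewrite ler_wpM2r// (le_trans (ler_norm _))// lerDl.
rewrite -ler_pdivlMl//; near: v; apply: cvgr_dist_le; first exact: cvg_id.
by rewrite mulr_gt0// invr_gt0.
Unshelve. all: end_near. Qed.

Lemma continuous_cosT a S : 0 <= S -> mu.-integrable setT (EFin \o a) ->
  (forall x, S < `|x| -> a x = 0) -> continuous (cosT a).
Proof. by move=> S0 ia a0; apply: lipschitz_continuous (cosT_lipschitz S0 ia a0). Qed.

Lemma continuous_sinT a S : 0 <= S -> mu.-integrable setT (EFin \o a) ->
  (forall x, S < `|x| -> a x = 0) -> continuous (sinT a).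
Proof. by move=> S0 ia a0; apply: lipschitz_continuous (sinT_lipschitz S0 ia a0). Qed.

End RealFourier.

(** * Plancherel for real functions of bounded support *)

Section BoundedFubini.
Context {R : realType}.
Local Notation mu := (@lebesgue_measure R).

Lemma Rintegral_abs_ge0 (f : R -> R) : 0 <= \int[mu]_x `|f x|.
Proof. by apply: Rintegral_ge0. Qed.

Lemma integrable_prod_bounded (f g : R -> R) (k : R * R -> R) (M : R) :
  mu.-integrable setT (EFin \o f) -> mu.-integrable setT (EFin \o g) ->
  measurable_fun setT k -> (forall p, `|k p| <= M) ->
  (mu \x mu)%E.-integrable setT (EFin \o (fun p => f p.1 * (k p * g p.2))).
Proof.
move=> intf intg mk kM.
have [/measurable_EFinP mf _] := integrableP _ _ _ intf.
have [/measurable_EFinP mg _] := integrableP _ _ _ intg.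
have M0 : 0 <= M by exact: le_trans (kM (0, 0)).
apply/integrable12ltyP.
  apply/measurable_EFinP/measurable_funM.
    exact: (measurableT_comp mf measurable_fst).
  by apply: measurable_funM => //; exact: (measurableT_comp mg measurable_snd).
pose G := (\int[mu]_y `|g y|%:E)%E.
have Gfin : G \is a fin_num.
  rewrite ge0_fin_numE ?integral_ge0//.
  by have [_] := integrableP _ _ _ intg.
apply: (@le_lt_trans _ _ (\int[mu]_x (`|f x|%:E * (M%:E * G)))%E).
  apply: ge0_le_integral => //.
  - move=> x _; apply: integral_ge0 => y _; exact: abse_ge0.
  - apply: (@measurable_fun_fubini_tonelli_F _ _ _ _ _ mu
      (fun p => `|(f p.1 * (k p * g p.2))%:E|%E)) => //.
    apply: measurableT_comp => //; apply/measurable_EFinP/measurable_funM.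
      exact: (measurableT_comp mf measurable_fst).
    by apply: measurable_funM => //; exact: (measurableT_comp mg measurable_snd).
  - apply: emeasurable_funM => //.
    by apply/measurable_EFinP; exact: measurableT_comp.
  move=> x _; rewrite -ge0_integralZl//=; last exact/measurable_EFinP/measurableT_comp.
  rewrite -ge0_integralZl//=; last first.
  - by move=> y _; rewrite mule_ge0 ?lee_fin.
  - by apply: emeasurable_funM => //; exact/measurable_EFinP/measurableT_comp.
  apply: ge0_le_integral => //.
  - apply/measurable_EFinP; apply: measurableT_comp => //.
    apply: measurable_funM => //; apply: measurable_funM => //.
    exact: (measurableT_comp mk (measurable_pair1 x)).
  - apply: emeasurable_funM => //; apply: emeasurable_funM => //.
    exact/measurable_EFinP/measurableT_comp.
  by move=> y _; rewrite -!EFinM lee_fin !normrM ler_wpM2l// ler_wpM2r.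
rewrite -(fineK Gfin) -EFinM ge0_integralZr//=.
- rewrite lte_mul_pinfty ?integral_ge0// ?lee_fin ?mulr_ge0 ?fine_ge0 ?integral_ge0//.
    rewrite ge0_fin_numE ?integral_ge0//.
    by have [_] := integrableP _ _ _ intf.
  by rewrite ltry.
- by apply/measurable_EFinP; exact: measurableT_comp.
- by rewrite lee_fin mulr_ge0 ?fine_ge0 ?integral_ge0.
Qed.

Lemma iterated_bounded_integral (f g : R -> R) (k : R * R -> R) (M : R) :
  mu.-integrable setT (EFin \o f) -> mu.-integrable setT (EFin \o g) ->
  measurable_fun setT k -> (forall p, `|k p| <= M) ->
  ((\int[mu]_x (f x * \int[mu]_y (k (x, y) * g y)))%:E =
   \int[(mu \x mu)%E]_p (f p.1 * (k p * g p.2))%:E)%E.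
Proof.
move=> intf intg mk kM.
have iP := integrable_prod_bounded intf intg mk kM.
have ik x : mu.-integrable setT (EFin \o (fun y => k (x, y) * g y)).
  apply: (integrable_mul_bounded _ _ intg) => //.
  exact: (measurableT_comp mk (measurable_pair1 x)).
have E := integral12_prod_meas1 iP.
have := integrable_fin_num measurableT iP; rewrite -E => /fineK; rewrite E => <-.
congr EFin; rewrite /Rintegral; congr fine; rewrite -E.
apply: eq_integral => x _; rewrite EFinM fineK; last exact: integrable_fin_num (ik x).
rewrite -integralZl//; exact: ik.
Qed.

Lemma bounded_Fubini (f g : R -> R) (k : R * R -> R) (M : R) :
  mu.-integrable setT (EFin \o f) -> mu.-integrable setT (EFin \o g) ->
  measurable_fun setT k -> (forall p, `|k p| <= M) ->
  \int[mu]_x (f x * \int[mu]_y (k (x, y) * g y)) =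
  \int[mu]_y (g y * \int[mu]_x (k (x, y) * f x)).
Proof.
move=> intf intg mk kM.
have iP := integrable_prod_bounded intf intg mk kM.
have ik y : mu.-integrable setT (EFin \o (fun x => k (x, y) * f x)).
  apply: (integrable_mul_bounded _ _ intf) => //.
  exact: (measurableT_comp mk (measurable_pair2 y)).
apply: EFin_inj; rewrite (iterated_bounded_integral intf intg mk kM).
have E := integral21_prod_meas1 iP.
have := integrable_fin_num measurableT iP; rewrite -E => /fineK <-.
congr EFin; rewrite /Rintegral; congr fine.
apply: eq_integral => y _; rewrite EFinM fineK; last exact: integrable_fin_num (ik y).
rewrite -integralZl//; last exact: ik.
by apply: eq_integral => x _; rewrite -EFinM; congr EFin; rewrite /=; ring.
Qed.

End BoundedFubini.

Section PoissonEnergy.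
Context {R : realType}.
Local Notation mu := (@lebesgue_measure R).
Variables (a : R -> R) (S : R).
Hypothesis S0 : 0 <= S.
Hypothesis ia : mu.-integrable setT (EFin \o a).
Hypothesis a0 : forall x, S < `|x| -> a x = 0.

Let ma : measurable_fun setT a.
Proof. by apply/measurable_EFinP; exact: measurable_int ia. Qed.

Let A := \int[mu]_x `|a x|.

Let mcosT : measurable_fun setT (cosT a).
Proof. by apply: continuous_measurable_fun; exact: continuous_cosT a0. Qed.

Let msinT : measurable_fun setT (sinT a).
Proof. by apply: continuous_measurable_fun; exact: continuous_sinT a0. Qed.

(** The squared modulus of the Fourier transform of the real function [a]. *)
Definition freq_density (w : R) : R := cosT a w ^+ 2 + sinT a w ^+ 2.

Lemma measurable_freq_density : measurable_fun setT freq_density.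
Proof. by apply: measurable_funD; exact: measurable_funX. Qed.

Lemma freq_density_ge0 w : 0 <= freq_density w.
Proof. by rewrite addr_ge0 ?sqr_ge0. Qed.

(** At frequency [p.1], the integral of [cos (2 * pi * p.1 * (p.2 - y)) * a y]
    over [y]; expanding the cosine separates it into the two transforms of
    [a]. *)
Let D (p : R * R) := cos (2 * pi * p.1 * p.2) * cosT a p.1 + sin (2 * pi * p.1 * p.2) * sinT a p.1.

Let mprod : measurable_fun setT (fun p : R * R => 2 * pi * p.1 * p.2).
Proof.
by apply: measurable_funM; [apply: measurable_funM|].
Qed.

Let mcosp : measurable_fun setT (fun p : R * R => cos (2 * pi * p.1 * p.2)).
Proof.
by apply: (measurableT_comp _ mprod); apply: continuous_measurable_fun; exact: continuous_cos.
Qed.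

Let msinp : measurable_fun setT (fun p : R * R => sin (2 * pi * p.1 * p.2)).
Proof.
by apply: (measurableT_comp _ mprod); apply: continuous_measurable_fun; exact: continuous_sin.
Qed.

Let mD : measurable_fun setT D.
Proof.
apply: measurable_funD; apply: measurable_funM => //.
  exact: (measurableT_comp mcosT measurable_fst).
exact: (measurableT_comp msinT measurable_fst).
Qed.

Let D_le p : `|D p| <= A + A.
Proof.
rewrite (le_trans (ler_normD _ _))// lerD// normrM.
  rewrite (le_trans _ (norm_cosT_le p.1 ia))// ler_piMl// norm_cos_le1.
  by [].
by rewrite (le_trans _ (norm_sinT_le p.1 ia))// ler_piMl// norm_sin_le1.
Qed.

Let D_E w x : D (w, x) = \int[mu]_y (cos (2 * pi * w * (x - y)) * a y).
Proof.
rewrite /D /= /cosT /sinT -!RintegralZl//; [|exact: integrable_sinT|exact: integrable_cosT].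
rewrite -RintegralD//; last 2 first.
- exact: integrableZl (integrable_cosT w ia).
- exact: integrableZl (integrable_sinT w ia).
apply: eq_Rintegral => y _.
by rewrite !mulrA -mulrDl mulrBr cosB.
Qed.

Let density_E w : freq_density w = \int[mu]_x (D (w, x) * a x).
Proof.
rewrite /freq_density !expr2 {1}/cosT {1}/sinT.
rewrite -!RintegralZr//; [|exact: integrable_sinT|exact: integrable_cosT].
rewrite -RintegralD//; last 2 first.
- exact: integrableZr (integrable_cosT w ia).
- exact: integrableZr (integrable_sinT w ia).
by apply: eq_Rintegral => x _; rewrite /D /=; ring.
Qed.

(** Written as a double integral, the squared modulus of the transform at [w]
    has the kernel [cos (2 * pi * w * (x - y))]. The damping factor makes the
    triple integral absolutely convergent; integrating in [w] first produces
    the Poisson kernel. *)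
Lemma damped_energy e : 0 < e ->
  \int[mu]_w (abs_exp e w * freq_density w) =
  \int[mu]_x (a x * \int[mu]_y (a y * kernel e x y)).
Proof.
move=> e0; have ie := integrable_abs_exp e0.
under eq_Rintegral do rewrite density_E.
rewrite (bounded_Fubini ie ia mD D_le); apply: eq_Rintegral => x _; congr (_ * _).
under eq_Rintegral do rewrite D_E mulrC.
have mk : measurable_fun setT (fun p : R * R => cos (2 * pi * p.1 * (x - p.2))).
  apply: (measurableT_comp (f := cos)); first by apply: continuous_measurable_fun; exact: continuous_cos.
  by apply: measurable_funM; [apply: measurable_funM|apply: measurable_funB].
rewrite (bounded_Fubini ie ia mk (fun p => norm_cos_le1 _)).
apply: eq_Rintegral => y _; congr (_ * _); rewrite /kernel -integral_abs_exp_cos//.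
apply: eq_Rintegral => w _ /=; rewrite mulrC; congr (_ * cos _); ring.
Qed.

End PoissonEnergy.

Section DampedEnergyBound.
Context {R : realType}.
Local Notation mu := (@lebesgue_measure R).

Lemma poisson_le (e t : R) : 0 < e -> poisson e t <= 2 / e.
Proof.
move=> e0; rewrite /poisson ler_pdivrMr ?sqrD_gt0// mulrDr.
have -> : 2 / e * e ^+ 2 = 2 * e by field; exact: lt0r_neq0.
by rewrite lerDl mulr_ge0 ?sqr_ge0// divr_ge0// ltW.
Qed.

Let integral_kernel_fst (a : R -> R) (e : R) : 0 < e -> measurable_fun setT a ->
  (\int[(mu \x mu)%E]_p (a p.1 ^+ 2 * kernel e p.1 p.2)%:E =
   \int[mu]_x (a x ^+ 2)%:E)%E.
Proof.
move=> e0 ma; rewrite (@fubini_tonelli1 _ _ _ _ _ mu mu); last 2 first.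
- apply/measurable_EFinP/measurable_funM; last exact: measurable_kernel_prod.
  by apply: measurable_funX; exact: (measurableT_comp ma measurable_fst).
- by move=> p; rewrite lee_fin mulr_ge0 ?sqr_ge0// kernel_ge0.
apply: eq_integral => x _; rewrite /fubini_F /=.
under eq_integral do rewrite EFinM.
rewrite ge0_integralZl//=; first by rewrite integral_kernel1// mule1.
- by apply/measurable_EFinP; exact: measurable_kernel.
- by move=> y _; rewrite lee_fin kernel_ge0.
- by rewrite lee_fin sqr_ge0.
Qed.

Let integral_kernel_snd (a : R -> R) (e : R) : 0 < e -> measurable_fun setT a ->
  (\int[(mu \x mu)%E]_p (a p.2 ^+ 2 * kernel e p.1 p.2)%:E =
   \int[mu]_x (a x ^+ 2)%:E)%E.
Proof.
move=> e0 ma.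
have mF : measurable_fun setT (fun p : R * R => (a p.2 ^+ 2 * kernel e p.1 p.2)%:E).
  apply/measurable_EFinP/measurable_funM; last exact: measurable_kernel_prod.
  by apply: measurable_funX; exact: (measurableT_comp ma measurable_snd).
have F0 (p : R * R) : (0 <= (a p.2 ^+ 2 * kernel e p.1 p.2)%:E)%E.
  by rewrite lee_fin mulr_ge0 ?sqr_ge0// kernel_ge0.
rewrite (@fubini_tonelli1 _ _ _ _ _ mu mu)// (@fubini_tonelli _ _ _ _ _ mu mu)//.
apply: eq_integral => x _; rewrite /fubini_G /=.
under eq_integral do rewrite EFinM kernelC.
rewrite ge0_integralZl//=; first by rewrite integral_kernel1// mule1.
- by apply/measurable_EFinP; exact: measurable_kernel.
- by move=> y _; rewrite lee_fin kernel_ge0.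
- by rewrite lee_fin sqr_ge0.
Qed.

Variables (a : R -> R) (S : R).
Hypothesis S0 : 0 <= S.
Hypothesis ia : mu.-integrable setT (EFin \o a).
Hypothesis a0 : forall x, S < `|x| -> a x = 0.

Let ma : measurable_fun setT a.
Proof. by apply/measurable_EFinP; exact: measurable_int ia. Qed.

Let A := \int[mu]_x `|a x|.

Let md := measurable_freq_density S0 ia a0.

Lemma freq_density_le w : freq_density a w <= A ^+ 2 + A ^+ 2.
Proof.
have sqr_le z : `|z| <= A -> z ^+ 2 <= A ^+ 2.
  move=> zA; rewrite -[z ^+ 2]real_normK ?num_real// lerXn2r ?nnegrE//.
  exact: Rintegral_abs_ge0.
by rewrite /freq_density lerD// sqr_le// ?norm_cosT_le ?norm_sinT_le.
Qed.

Let integrable_damped e : 0 < e ->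
  mu.-integrable setT (EFin \o (fun w => abs_exp e w * freq_density a w)).
Proof.
move=> e0.
have := @integrable_mul_bounded R _ _ mu _ _ (A ^+ 2 + A ^+ 2) md _ (integrable_abs_exp e0).
under [in X in _ -> X]eq_fun do rewrite mulrC.
apply => w; rewrite ger0_norm ?freq_density_ge0//; exact: freq_density_le.
Qed.

(** By [a x * a y <= (a x ^+ 2 + a y ^+ 2) / 2], because the kernel has
    integral 1 in each variable. *)
Lemma damped_energy_le e : 0 < e ->
  (\int[mu]_w (abs_exp e w * freq_density a w)%:E <= \int[mu]_x (a x ^+ 2)%:E)%E.
Proof.
move=> e0; rewrite -(fineK (integrable_fin_num measurableT (integrable_damped e0))).
rewrite -[fine _]/(\int[mu]_w (abs_exp e w * freq_density a w)) (damped_energy S0 ia a0 e0).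
under eq_Rintegral do under eq_Rintegral do rewrite mulrC.
have mk := measurable_kernel_prod e0.
have kM (p : R * R) : `|kernel e p.1 p.2| <= 2 / e.
  by rewrite ger0_norm ?kernel_ge0// poisson_le.
rewrite (@iterated_bounded_integral _ _ _ _ _ ia ia mk kM).
have mF := measurable_int _ (integrable_prod_bounded ia ia mk kM).
have m1 : measurable_fun setT (fun p : R * R => (a p.1 ^+ 2 * kernel e p.1 p.2)%:E).
  apply/measurable_EFinP/measurable_funM => //.
  by apply: measurable_funX; exact: (measurableT_comp ma measurable_fst).
have m2 : measurable_fun setT (fun p : R * R => (a p.2 ^+ 2 * kernel e p.1 p.2)%:E).
  apply/measurable_EFinP/measurable_funM => //.
  by apply: measurable_funX; exact: (measurableT_comp ma measurable_snd).
apply: (le_trans (lee_abs _)); apply: (le_trans (le_abse_integral _ measurableT mF)).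
apply: (@le_trans _ _ (\int[(mu \x mu)%E]_p (2^-1%:E * ((a p.1 ^+ 2 * kernel e p.1 p.2)%:E + (a p.2 ^+ 2 * kernel e p.1 p.2)%:E)))%E).
  apply: ge0_le_integral => //.
  - exact: measurableT_comp.
  - by apply: emeasurable_funM => //; exact: emeasurable_funD.
  move=> p _; rewrite /= -EFinD -EFinM lee_fin -mulrDl.
  rewrite mulrCA normrM (ger0_norm (kernel_ge0 _ _ e0)) mulrCA [leRHS]mulrCA.
  rewrite [leRHS]mulrA [leRHS]mulrC ler_wpM2l ?kernel_ge0// normrM.
  rewrite -[a p.1 ^+ 2]real_normK ?num_real// -[a p.2 ^+ 2]real_normK ?num_real//.
  have := sqr_ge0 (`|a p.1| - `|a p.2|); rewrite sqrrB; lra.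
have p1 (p : R * R) : (0 <= (a p.1 ^+ 2 * kernel e p.1 p.2)%:E)%E.
  by rewrite lee_fin mulr_ge0 ?sqr_ge0// kernel_ge0.
have p2 (p : R * R) : (0 <= (a p.2 ^+ 2 * kernel e p.1 p.2)%:E)%E.
  by rewrite lee_fin mulr_ge0 ?sqr_ge0// kernel_ge0.
rewrite ge0_integralZl//=.
- rewrite ge0_integralD// integral_kernel_fst// integral_kernel_snd//.
  have := @integral_ge0 _ _ _ mu setT (fun x => (a x ^+ 2)%:E) (fun x _ => ltac:(by rewrite lee_fin sqr_ge0)).
  case: (\int[mu]_x _)%E => [r| |] //= r0; last by rewrite addye// gt0_muley// lte_fin.
  by rewrite -EFinD -EFinM lee_fin; lra.
- exact: emeasurable_funD.
- by move=> p _; rewrite adde_ge0.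
Qed.

Lemma cvg_abs_exp (w : R) : abs_exp n.+1%:R^-1 w @[n --> \oo] --> (1 : R).
Proof.
rewrite /abs_exp -[X in _ --> X]expR0.
apply: (@cvg_comp _ _ _ (fun n => - (n.+1%:R^-1 * `|w|)) expR); last exact: continuous_expR.
rewrite -oppr0; apply: cvgN; rewrite -[X in _ --> X](mul0r `|w|).
by apply: cvgM; [exact: cvg_harmonic|exact: cvg_cst].
Qed.

(** One half of Plancherel: the bound on the damped energies does not depend
    on the damping, and Fatou removes it. *)
Lemma integral_freq_density_le :
  (\int[mu]_w (freq_density a w)%:E <= \int[mu]_x (a x ^+ 2)%:E)%E.
Proof.
apply: (@ge0_integral_limit_le _ _ _ mu
  (fun n w => (abs_exp n.+1%:R^-1 w * freq_density a w)%:E)) => //.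
- move=> n; apply/measurable_EFinP/measurable_funM; last exact: md.
  exact: measurable_abs_exp.
- by apply/measurable_EFinP; exact: md.
- by move=> n w; rewrite lee_fin mulr_ge0 ?freq_density_ge0// abs_exp_ge0.
- by move=> w; rewrite lee_fin freq_density_ge0.
- apply: aeW => w; apply: cvg_EFin; first exact: nearW.
  rewrite -[X in _ --> X]mul1r /comp /=; apply: cvgM; first exact: cvg_abs_exp.
  exact: cvg_cst.
- by apply: nearW => n; apply: damped_energy_le; rewrite invr_gt0.
Qed.

Lemma damped_le_freq_density e : 0 < e ->
  ((\int[mu]_x (a x * \int[mu]_y (a y * kernel e x y)))%:E <=
   \int[mu]_w (freq_density a w)%:E)%E.
Proof.
move=> e0; rewrite -(damped_energy S0 ia a0 e0).
rewrite fineK; last exact: integrable_fin_num (integrable_damped e0).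
apply: ge0_le_integral => //.
- by move=> w _; rewrite lee_fin mulr_ge0 ?freq_density_ge0// abs_exp_ge0.
- by apply/measurable_EFinP/measurable_funM; [exact: measurable_abs_exp|exact: md].
- by apply/measurable_EFinP; exact: md.
- move=> w _; rewrite lee_fin ler_piMl ?freq_density_ge0//.
  by rewrite abs_exp_le1 ?ltW.
Qed.

End DampedEnergyBound.

Section ContinuousPlancherel.
Context {R : realType}.
Local Notation mu := (@lebesgue_measure R).

(** A square integrable function of bounded support is integrable, as [`|y| <=
    1 + y ^+ 2]. *)
Lemma integrable_itv_supp (a : R -> R) (S : R) :
  measurable_fun setT a -> (forall x, S < `|x| -> a x = 0) ->
  (\int[mu]_x (a x ^+ 2)%:E < +oo)%E -> mu.-integrable setT (EFin \o a).
Proof.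
move=> ma a0 a2.
have i1 : mu.-integrable setT (EFin \o \1_(`[- S, S] : set R)).
  exact: integrable_indic_itv.
have i2 : mu.-integrable setT (EFin \o (fun x => a x ^+ 2)).
  apply/integrableP; split; first by apply/measurable_EFinP; exact: measurable_funX.
  by under eq_integral do rewrite /= ger0_norm ?sqr_ge0//.
apply: le_integrable (integrableD measurableT i1 i2) => //; first exact/measurable_EFinP.
move=> x _ /=; rewrite lee_fin [leRHS]ger0_norm ?addr_ge0 ?sqr_ge0 ?indicE//.
case: (leP `|x| S) => [xS|/a0 ->]; last first.
  by rewrite normr0 addr_ge0 ?sqr_ge0.
rewrite mem_set; last by rewrite /= in_itv /= -ler_norml.
rewrite -[a x ^+ 2]real_normK ?num_real//.
rewrite /=; have := sqr_ge0 (`|a x| - 1); have := sqr_ge0 (`|a x|); rewrite sqrrB mulr1n; lra.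
Qed.

Lemma integral_sqr_bounded_lty (a : R -> R) (S M : R) :
  measurable_fun setT a -> (forall x, S < `|x| -> a x = 0) ->
  (forall x, `|a x| <= M) -> (\int[mu]_x (a x ^+ 2)%:E < +oo)%E.
Proof.
move=> ma a0 aM.
have := integrable_indic_itv (- S) S true false.
move=> /(integrableZl measurableT (M ^+ 2)) /integrableP[_].
apply: le_lt_trans; apply: ge0_le_integral => //.
- by move=> x _; rewrite lee_fin sqr_ge0.
- by apply/measurable_EFinP; exact: measurable_funX.
- apply: measurableT_comp => //; apply: emeasurable_funM => //.
  exact/measurable_EFinP.
move=> x _ /=; rewrite lee_fin.
case: (leP `|x| S) => [xS|/a0 ->]; last by rewrite expr0n /= normr_ge0.
rewrite indicE mem_set; last by rewrite /= in_itv /= -ler_norml.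
rewrite mulr1 ger0_norm ?sqr_ge0// -[leLHS]real_normK ?num_real//.
by rewrite lerXn2r ?nnegrE// (le_trans _ (aM x)).
Qed.

Variables (a : R -> R) (S M : R).
Hypothesis S0 : 0 <= S.
Hypothesis ma : measurable_fun setT a.
Hypothesis a0 : forall x, S < `|x| -> a x = 0.
Hypothesis aM : forall x, `|a x| <= M.
Hypothesis ca : forall x, `|x| != S -> {for x, continuous a}.

Let ia : mu.-integrable setT (EFin \o a).
Proof. exact: (integrable_itv_supp ma a0 (integral_sqr_bounded_lty ma a0 aM)). Qed.

Let del n : R := n.+1%:R^-1 / (2 * pi).

Let cvg_del : del n @[n --> \oo] --> (0 : R).
Proof.
rewrite -[X in _ --> X](mul0r (2 * pi)^-1); apply: cvgM; last exact: cvg_cst.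
exact: cvg_harmonic.
Qed.

Let integrable_cauchy : mu.-integrable setT (EFin \o (@cauchy_density R)).
Proof.
apply/integrableP; split; first by apply/measurable_EFinP; exact: measurable_cauchy_density.
under eq_integral do rewrite /= ger0_norm ?cauchy_density_ge0//.
by rewrite integral_cauchy_density ltry.
Qed.

Let smooth n x := \int[mu]_s (a (x + del n * s) * cauchy_density s).

Let smoothE n x : \int[mu]_y (a y * kernel n.+1%:R^-1 x y) = smooth n x.
Proof.
rewrite integral_kernel ?invr_gt0//.
apply: (@integrable_mul_bounded R _ _ mu _ _ M) => //.
have e0 : 0 < n.+1%:R^-1 :> R by rewrite invr_gt0.
apply/integrableP; split; first by apply/measurable_EFinP; exact: measurable_kernel.
under eq_integral do rewrite /= ger0_norm ?kernel_ge0//.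
by rewrite integral_kernel1// ltry.
Qed.

Let cvg_smooth x : `|x| != S -> smooth n x @[n --> \oo] --> a x.
Proof.
move=> xS; have -> : a x = \int[mu]_s (a x * cauchy_density s).
  rewrite RintegralZl// [X in _ * X](_ : _ = 1) ?mulr1//.
  by rewrite /Rintegral integral_cauchy_density.
apply: (@Rdominated_cvg _ _ _ mu _ _ (fun s => M * cauchy_density s)).
- move=> n; apply: measurable_funM; last exact: measurable_cauchy_density.
  by apply: (measurableT_comp ma); exact: measurable_affine.
- by apply: measurable_funM => //; exact: measurable_cauchy_density.
- exact: integrableZl integrable_cauchy.
- move=> n s; rewrite normrM [X in _ * X]ger0_norm ?cauchy_density_ge0//.
  by rewrite ler_wpM2r ?cauchy_density_ge0.
apply: aeW => s; apply: cvgM; last exact: cvg_cst.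
have cx : x + del n * s @[n --> \oo] --> x; last first.
  by apply: (@cvg_comp _ _ _ (fun n => x + del n * s) a _ _ _ cx); exact: ca.
rewrite -[X in _ --> X]addr0; apply: cvgD; first exact: cvg_cst.
by rewrite -[X in _ --> X](mul0r s); apply: cvgM; [exact: cvg_del|exact: cvg_cst].
Qed.

Let smooth_le n x : `|smooth n x| <= M.
Proof.
have i1 : mu.-integrable setT (EFin \o (fun s => a (x + del n * s) * cauchy_density s)).
  apply: (@integrable_mul_bounded R _ _ mu _ _ M) => //.
  by apply: (measurableT_comp ma); exact: measurable_affine.
rewrite /smooth (le_trans (le_normr_Rintegral _ i1))//.
have -> : M = \int[mu]_s (M * cauchy_density s).
  rewrite RintegralZl// [X in _ * X](_ : _ = 1) ?mulr1//.
  by rewrite /Rintegral integral_cauchy_density.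
apply: le_Rintegral => //; first exact: integrable_norm i1.
  exact: integrableZl integrable_cauchy.
move=> s _; rewrite normrM [X in _ * X]ger0_norm ?cauchy_density_ge0//.
by rewrite ler_wpM2r ?cauchy_density_ge0.
Qed.

Let measurable_smooth n : measurable_fun setT (fun x => a x * smooth n x).
Proof.
have e0 : 0 < n.+1%:R^-1 :> R by rewrite invr_gt0.
have kM (p : R * R) : `|kernel n.+1%:R^-1 p.1 p.2| <= 2 / n.+1%:R^-1.
  by rewrite ger0_norm ?kernel_ge0// poisson_le.
have iP := integrable_prod_bounded ia ia (measurable_kernel_prod e0) kM.
have ik x : mu.-integrable setT (EFin \o (fun y => kernel n.+1%:R^-1 x y * a y)).
  apply: (@integrable_mul_bounded R _ _ mu _ _ (2 / n.+1%:R^-1)) => //.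
  - exact: measurable_kernel.
  - by move=> y; exact: (kM (x, y)).
apply/measurable_EFinP; apply: eq_measurable_fun (measurable_fubini_F iP) => x _.
rewrite /fubini_F /= -smoothE EFinM fineK; last first.
  apply: (integrable_fin_num measurableT).
  by under eq_fun do rewrite mulrC; exact: ik.
rewrite -integralZl//; last by under eq_fun do rewrite mulrC; exact: ik.
by apply: eq_integral => y _; rewrite -EFinM; congr EFin; rewrite /=; ring.
Qed.

Let cvg_poisson_energy :
  \int[mu]_x (a x * \int[mu]_y (a y * kernel n.+1%:R^-1 x y)) @[n --> \oo] -->
  \int[mu]_x (a x * a x).
Proof.
under eq_fun do under eq_Rintegral do rewrite smoothE.
apply: (@Rdominated_cvg _ _ _ mu _ _ (fun x => M * `|a x|)).
- by move=> n; exact: measurable_smooth.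
- exact: measurable_funM.
- exact: integrableZl (integrable_norm ia).
- by move=> n x; rewrite normrM mulrC ler_wpM2r.
have cvgx x : `|x| != S -> a x * smooth n x @[n --> \oo] --> a x * a x.
  by move=> xS; apply: cvgM; [exact: cvg_cst|exact: cvg_smooth].
exists [set S; - S]; split.
- by apply: measurableU; exact: measurable_set1.
- have m1 (r : R) : measurable ([set r] : set (measurableTypeR R)) by exact: measurable_set1.
  apply/eqP; rewrite eq_le measure_ge0 andbT.
  rewrite (le_trans (measureU2 mu (m1 S) (m1 (- S))))//.
  have mu0 (r : R) : mu [set r] = 0%E by exact: lebesgue_measure_set1.
  by rewrite [X in (X + _ <= _)%E](mu0 S) [X in (_ + X <= _)%E](mu0 (- S)) adde0.
move=> x /= nx; apply: contrapT => /not_orP[xS xNS]; apply: nx; apply: cvgx.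
by apply/negP => /eqP xE; move: xS xNS; rewrite -xE; case: (ler0P x) => _; rewrite ?opprK.
Qed.

(** The other half of Plancherel, for a bounded function whose only
    discontinuities are at the end points of its support: the damped energies
    are at most the undamped one, and they converge to the integral of [a ^+
    2] because the Poisson kernels form an approximate identity at each point
    of continuity. *)
Lemma freq_density_ge_continuous :
  (\int[mu]_x (a x ^+ 2)%:E <= \int[mu]_w (freq_density a w)%:E)%E.
Proof.
have a2 := integral_sqr_bounded_lty ma a0 aM.
have F0 : (0 <= \int[mu]_w (freq_density a w)%:E)%E.
  by apply: integral_ge0 => w _; rewrite lee_fin freq_density_ge0.
have Ffin : (\int[mu]_w (freq_density a w)%:E)%E \is a fin_num.
  rewrite ge0_fin_numE//; apply: le_lt_trans a2.
  exact: (integral_freq_density_le S0 ia a0).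
have Ifin : (\int[mu]_x (a x ^+ 2)%:E)%E \is a fin_num.
  by rewrite ge0_fin_numE// integral_ge0// => x _; rewrite lee_fin sqr_ge0.
rewrite -(fineK Ifin) -(fineK Ffin) lee_fin.
rewrite [leLHS](_ : _ = \int[mu]_x (a x * a x)); last by rewrite /Rintegral.
(* each damped energy is at most the undamped one, hence so is their limit *)
rewrite -(cvg_lim _ cvg_poisson_energy)//; apply: limr_le.
  by apply/cvg_ex; eexists; exact: cvg_poisson_energy.
apply: nearW => n; rewrite -lee_fin (fineK Ffin).
by apply: (damped_le_freq_density S0 ia a0); rewrite invr_gt0.
Qed.

End ContinuousPlancherel.

Section RealPlancherel.
Context {R : realType}.
Local Notation mu := (@lebesgue_measure R).

Definition clip (M x : R) : R := if M < x then M else if x < - M then - M else x.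

Lemma clip_le M x : 0 <= M -> `|clip M x| <= M.
Proof.
move=> M0; rewrite ler_norml /clip.
by case: (ltP M x) => ?; [|case: (ltP x (- M)) => ?]; lra.
Qed.

Lemma clip_id M x : `|x| <= M -> clip M x = x.
Proof. by rewrite ler_norml /clip => /andP[Mx xM]; rewrite !ltNge xM Mx. Qed.

Lemma clip0 M : 0 <= M -> clip M 0 = 0.
Proof. by move=> M0; rewrite clip_id// normr0. Qed.

Lemma clip_lipschitz M x y : 0 <= M -> `|clip M x - clip M y| <= `|x - y|.
Proof.
move=> M0; rewrite ler_norml /clip.
by case: (ler0P (x - y)) => ?; case: (ltP M x) => ?;
  [|case: (ltP x (- M)) => ?| |case: (ltP x (- M)) => ?];
  (case: (ltP M y) => ?; [|case: (ltP y (- M)) => ?]); lra.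
Qed.

Lemma continuous_clip M : 0 <= M -> continuous (clip M).
Proof.
move=> M0; apply: (@lipschitz_continuous _ _ 1) => w v.
by rewrite mul1r clip_lipschitz.
Qed.

Lemma measurable_clip M : 0 <= M -> measurable_fun setT (clip M).
Proof. by move=> M0; apply: continuous_measurable_fun; exact: continuous_clip. Qed.

(** A triangle inequality for squares, with a constant as close to 1 as
    desired in front of the main term. *)
Lemma sqrD_le_young (x y eta : R) : 0 < eta ->
  (x + y) ^+ 2 <= (1 + eta) * x ^+ 2 + (1 + eta^-1) * y ^+ 2.
Proof.
move=> e0; rewrite -subr_ge0.
have -> : (1 + eta) * x ^+ 2 + (1 + eta^-1) * y ^+ 2 - (x + y) ^+ 2 =
    (eta * x - y) ^+ 2 / eta by field; rewrite gt_eqF.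
by rewrite divr_ge0 ?sqr_ge0// ltW.
Qed.

(** [d], then [eta], tend to 0; the choice [d := eta ^+ 3] makes this
    quantitative. *)
Lemma le_of_young (I F : R) : 0 <= F -> (forall eta d, 0 < eta -> 0 < d ->
  I <= (1 + eta) * ((1 + eta) * F + (1 + eta^-1) * d) + (1 + eta^-1) * d) -> I <= F.
Proof.
move=> FR0 step; rewrite leNgt; apply/negP => FI.
(* With d = eta ^+ 3 and eta <= 1 the bound is at most F + eta * (3 * F + 6);
   this eta makes it smaller than I. *)
pose eta := Num.min 1 ((I - F) / (3 * F + 7)).
have h7 : 0 < 3 * F + 7 by rewrite ltr_wpDl// mulr_ge0.
have e0 : 0 < eta by rewrite lt_min ltr01 divr_gt0// subr_gt0.
have e1 : eta <= 1 by rewrite ge_min lexx.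
have e2 : eta * (3 * F + 7) <= I - F by rewrite -ler_pdivlMr// ge_min lexx orbT.
have := step eta (eta ^+ 3) e0 (exprn_gt0 _ e0).
have -> : (1 + eta^-1) * eta ^+ 3 = eta ^+ 3 + eta ^+ 2 by field; rewrite gt_eqF.
have h3 : eta ^+ 3 <= eta ^+ 2 by rewrite exprS ler_piMl ?sqr_ge0.
have h2 : eta ^+ 2 <= eta by rewrite expr2 ler_piMl// ltW.
have h2F : eta ^+ 2 * F <= eta * F by rewrite ler_wpM2r.
have h4 : eta * (eta ^+ 3 + eta ^+ 2) <= eta ^+ 3 + eta ^+ 2.
  by rewrite ler_piMl// addr_ge0// exprn_ge0// ltW.
move=> h; have {}h : I <= F + 2 * (eta * F) + eta ^+ 2 * F +
    (eta ^+ 3 + eta ^+ 2) + eta * (eta ^+ 3 + eta ^+ 2) + (eta ^+ 3 + eta ^+ 2).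
  by apply: le_trans h _; rewrite le_eqVlt; apply/orP; left; apply/eqP; ring.
have e3 : eta * (3 * F + 7) = 3 * (eta * F) + 7 * eta by ring.
lra.
Qed.

Variables (S : R).
Hypothesis S0 : 0 <= S.

Let truncate_close (a : R -> R) (d : R) : 0 < d -> measurable_fun setT a ->
  (forall x, S < `|x| -> a x = 0) -> (\int[mu]_x (a x ^+ 2)%:E < +oo)%E ->
  exists n : nat, (\int[mu]_x ((a x - clip n%:R (a x)) ^+ 2)%:E <= d%:E)%E.
Proof.
move=> d0 ma a0 a2.
have i2 : mu.-integrable setT (EFin \o (fun x => a x ^+ 2)).
  apply/integrableP; split; first by apply/measurable_EFinP; exact: measurable_funX.
  by under eq_integral do rewrite /= ger0_norm ?sqr_ge0//.
have mn n : measurable_fun setT (fun x => (a x - clip n%:R (a x)) ^+ 2).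
  apply: measurable_funX; apply: measurable_funB => //.
  by apply: (measurableT_comp _ ma); exact: measurable_clip.
have dom n x : `|(a x - clip n%:R (a x)) ^+ 2| <= a x ^+ 2.
  rewrite ger0_norm ?sqr_ge0// -real_normK ?num_real// -[leRHS]real_normK ?num_real//.
  rewrite lerXn2r ?nnegrE//; move: (ler0n R n); move: (n%:R) => M M0.
  by rewrite ler_norml /clip; case: (ler0P (a x)) => ?; case: (ltP M (a x)) => ?;
    [|case: (ltP (a x) (- M)) => ?| |case: (ltP (a x) (- M)) => ?]; lra.
have in2 n : mu.-integrable setT (EFin \o (fun x => (a x - clip n%:R (a x)) ^+ 2)).
  apply: le_integrable i2 => //; first by apply/measurable_EFinP; exact: (mn n).
  by move=> x _ /=; rewrite lee_fin (le_trans (dom n x)) ?ler_norm.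
have : \int[mu]_x ((a x - clip n%:R (a x)) ^+ 2) @[n --> \oo] --> \int[mu]_x (0 : R).
  apply: (@Rdominated_cvg _ _ _ mu _ _ (fun x => a x ^+ 2)) => //.
  apply: aeW => x; apply: cvg_near_cst.
  exists (Num.bound `|a x|) => //= n /= xn.
  rewrite clip_id ?subrr ?expr0n//.
  by rewrite (le_trans (ltW (archi_boundP (normr_ge0 _))))// ler_nat.
have -> : \int[mu]_x (0 : R) = 0 by rewrite /Rintegral integral0.
move=> /cvgrPdist_le /(_ d d0)[n _ /(_ n (leqnn n))] /= h.
exists n; rewrite -(fineK (integrable_fin_num measurableT (in2 n))) lee_fin.
by apply: le_trans h; rewrite sub0r normrN ler_norm.
Qed.

(** Clip [a] to a bounded function, approximate the clipped function in L1 by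
    a continuous one, and clip the latter as well: for functions bounded by
    [M], an L1 error [c] gives a squared L2 error at most [2 * M * c]. Cutting off
    outside [[- S, S]] creates discontinuities at the end points only, which
    [freq_density_ge_continuous] permits. *)
Lemma approx_continuous_L2 (a : R -> R) (d : R) : 0 < d -> measurable_fun setT a ->
  (forall x, S < `|x| -> a x = 0) -> (\int[mu]_x (a x ^+ 2)%:E < +oo)%E ->
  exists k : R -> R, exists M : R,
    [/\ measurable_fun setT k, forall x, S < `|x| -> k x = 0,
        forall x, `|k x| <= M, forall x, `|x| != S -> {for x, continuous k} &
        (\int[mu]_x ((a x - k x) ^+ 2)%:E <= d%:E)%E].
Proof.
move=> d0 ma a0 a2.
have d4 : 0 < d / 4 by rewrite divr_gt0.
have [n an] := truncate_close d4 ma a0 a2.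
pose M : R := n%:R; have M0 : 0 <= M by rewrite ler0n.
pose b x := clip M (a x).
have mb : measurable_fun setT b.
  by apply: (measurableT_comp _ ma); exact: measurable_clip.
have b0 x : S < `|x| -> b x = 0 by move=> /a0; rewrite /b => ->; exact: clip0.
have bM x : `|b x| <= M by exact: clip_le.
have ib := integrable_itv_supp mb b0 (integral_sqr_bounded_lty mb b0 bM).
pose E : set (measurableTypeR R) := `[- S, S]%classic.
have mE : measurable E by exact: measurable_itv.
have Efin : (mu E < +oo)%E.
  by rewrite lebesgue_measure_itv /=; case: ifP => _; rewrite ?ltry.
have iE : mu.-integrable E (EFin \o b) by exact: integrableS ib.
have [g [cg ig /fine_cvgP[gfin gcvg]]] := approximation_continuous_integrable mE Efin iE.
have c0 : 0 < d / (8 * (M + 1)) by rewrite divr_gt0// mulr_gt0// ltr_pwDr.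
have [m [mfin mle]] : exists m, (\int[mu]_(z in E) `|(b z - g m z)%:E|)%E \is a fin_num /\
    fine (\int[mu]_(z in E) `|(b z - g m z)%:E|)%E <= d / (8 * (M + 1)).
  move/cvgrPdist_le : gcvg => /(_ _ c0) gcvg.
  have [m _ /(_ m (leqnn m))[h1 h2]] := filterI gfin gcvg.
  exists m; split => //; apply: le_trans h2.
  by rewrite sub0r normrN ler_norm.
pose k x := clip M (g m x) * \1_E x.
have cgm : continuous (fun x => clip M (g m x)).
  move=> x; apply: (@continuous_comp _ _ _ (g m) (clip M)); first exact: cg.
  exact: continuous_clip.
have mk : measurable_fun setT k.
  by apply: measurable_funM; [exact: continuous_measurable_fun|exact: measurable_indic].
have kin x : `|x| <= S -> k x = clip M (g m x).
  move=> xS; rewrite /k indicE mem_set ?mulr1//.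
  by rewrite /E /= in_itv /= -ler_norml.
have kout x : S < `|x| -> k x = 0.
  move=> Sx; rewrite /k indicE memNset ?mulr0//.
  by rewrite /E /= in_itv /= -ler_norml => xS; move: Sx; rewrite ltNge xS.
exists k, M; split => //.
- move=> x; case: (leP `|x| S) => [/kin ->|/kout ->]; first exact: clip_le.
  by rewrite normr0.
- move=> x; rewrite neq_lt => /orP[xS|Sx].
    rewrite /prop_for/continuous_at (kin x (ltW xS)); apply: cvg_trans (cgm x).
    apply: near_eq_cvg; near=> y; apply/esym/kin; apply: ltW; near: y.
    exact: (@cvgr_lt _ _ _ _ _ _ (@norm_continuous _ _ x)).
  rewrite /prop_for/continuous_at (kout x Sx).
  apply: cvg_near_cst; near=> y; apply: kout; near: y.
  exact: (@cvgr_gt _ _ _ _ _ _ (@norm_continuous _ _ x)).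
have bk : (\int[mu]_x ((b x - k x) ^+ 2)%:E <= (d / 4)%:E)%E.
  apply: (@le_trans _ _ (\int[mu]_(x in E) ((2 * M) * `|b x - g m x|)%:E)%E).
    rewrite [leRHS]integral_mkcond; apply: ge0_le_integral => //.
    + by move=> x _; rewrite lee_fin sqr_ge0.
    + by apply/measurable_EFinP; apply: measurable_funX; exact: measurable_funB.
    + apply/(measurable_restrictT _ _).1 => //.
      apply/measurable_EFinP; apply: measurable_funM => //; apply: measurableT_comp => //.
      by apply: measurable_funB; apply: measurable_funTS => //; exact: continuous_measurable_fun.
    move=> x _; rewrite /patch; case: ifPn => [xE|xE].
      have xS : `|x| <= S by move: xE; rewrite inE /E /= in_itv /= -ler_norml.
      rewrite (kin x xS) lee_fin -real_normK ?num_real// expr2.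
      apply: ler_pM => //.
        rewrite (le_trans (ler_normB _ _))// mulr_natl mulr2n lerD// ?clip_le//.
      rewrite -{1}[b x](clip_id (bM x)); exact: clip_lipschitz.
    have xS : S < `|x|.
      rewrite ltNge; apply/negP => xS; move: xE; rewrite notin_setE; apply.
      by rewrite /E /= in_itv /= -ler_norml.
    by rewrite b0// kout// subrr expr0n.
  under eq_integral do rewrite EFinM.
  rewrite ge0_integralZl//=; last 2 first.
  + apply/measurable_EFinP; apply: measurableT_comp => //.
    by apply: measurable_funB; apply: measurable_funTS => //; exact: continuous_measurable_fun.
  + by rewrite lee_fin mulr_ge0.
  rewrite -(fineK mfin) -EFinM lee_fin.
  apply: (@le_trans _ _ (2 * M * (d / (8 * (M + 1))))).
    by rewrite ler_wpM2l// mulr_ge0.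
  have -> : 2 * M * (d / (8 * (M + 1))) = (d / 4) * (M / (M + 1)).
    by field; rewrite gt_eqF// ltr_pwDr.
  rewrite ler_piMr ?(ltW d4)// ler_pdivrMr ?ltr_pwDr// mul1r lerDl//.
apply: (@le_trans _ _ (2%:E * \int[mu]_x ((a x - b x) ^+ 2)%:E + 2%:E * \int[mu]_x ((b x - k x) ^+ 2)%:E)%E).
  apply: ge0_integral_le_lincomb => //; try by move=> x; exact: sqr_ge0.
  - by apply: measurable_funX; exact: measurable_funB.
  - by apply: measurable_funX; exact: measurable_funB.
  - by apply: measurable_funX; exact: measurable_funB.
  move=> x; have := sqr_ge0 ((a x - b x) - (b x - k x)); nra.
apply: (@le_trans _ _ (2%:E * (d / 4)%:E + 2%:E * (d / 4)%:E)%E).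
  by apply: leeD; apply: lee_wpmul2l.
by rewrite -!EFinM -EFinD lee_fin; lra.
Unshelve. all: end_near. Qed.

(** Only the lower bound on the frequency side remains, and it is known for a
    class of functions that is dense in L2. The error of the approximation is
    controlled on the frequency side by the inequality already proved. *)
Lemma real_Plancherel (a : R -> R) : measurable_fun setT a ->
  (forall x, S < `|x| -> a x = 0) -> (\int[mu]_x (a x ^+ 2)%:E < +oo)%E ->
  (\int[mu]_w (freq_density a w)%:E = \int[mu]_x (a x ^+ 2)%:E)%E.
Proof.
move=> ma a0 a2; have ia := integrable_itv_supp ma a0 a2.
have md := measurable_freq_density S0 ia a0.
apply/eqP; rewrite eq_le (integral_freq_density_le S0 ia a0) /=.
have F0 : (0 <= \int[mu]_w (freq_density a w)%:E)%E.
  by apply: integral_ge0 => w _; rewrite lee_fin freq_density_ge0.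
have Ffin : (\int[mu]_w (freq_density a w)%:E)%E \is a fin_num.
  rewrite ge0_fin_numE//; apply: le_lt_trans a2.
  exact: (integral_freq_density_le S0 ia a0).
have Ifin : (\int[mu]_x (a x ^+ 2)%:E)%E \is a fin_num.
  by rewrite ge0_fin_numE// integral_ge0// => x _; rewrite lee_fin sqr_ge0.
(* on both sides a is replaced by a continuous k, at squared L2 distance at
   most d *)
have step eta d : 0 < eta -> 0 < d ->
  fine (\int[mu]_x (a x ^+ 2)%:E)%E <=
  (1 + eta) * ((1 + eta) * fine (\int[mu]_w (freq_density a w)%:E)%E + (1 + eta^-1) * d)
  + (1 + eta^-1) * d.
  move=> e0 d0; have [k [M [mk k0 kM ck kd]]] := approx_continuous_L2 d0 ma a0 a2.
  have k2 := integral_sqr_bounded_lty mk k0 kM.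
  have ik := integrable_itv_supp mk k0 k2.
  have e1 : 0 <= 1 + eta by rewrite addr_ge0// ltW.
  have e2 : 0 <= 1 + eta^-1 by rewrite addr_ge0// invr_ge0 ltW.
  have mk2 : measurable_fun setT (fun x => (a x - k x) ^+ 2).
    by apply: measurable_funX; exact: measurable_funB.
  have I1 : (\int[mu]_x (a x ^+ 2)%:E <= (1 + eta)%:E * \int[mu]_x (k x ^+ 2)%:E
       + (1 + eta^-1)%:E * \int[mu]_x ((a x - k x) ^+ 2)%:E)%E.
    apply: ge0_integral_le_lincomb => //; try by move=> x; exact: sqr_ge0.
    - exact: measurable_funX.
    - exact: measurable_funX.
    by move=> x; rewrite -[X in X ^+ 2](subrK (k x)) addrC sqrD_le_young.
  have K1 := freq_density_ge_continuous S0 mk k0 kM ck.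
  pose r x := - (a x - k x).
  have mr : measurable_fun setT r by apply: measurableT_comp => //; exact: measurable_funB.
  have r0 x : S < `|x| -> r x = 0.
    by move=> Sx; rewrite /r a0// k0// subrr oppr0.
  have r2E : (\int[mu]_x (r x ^+ 2)%:E = \int[mu]_x ((a x - k x) ^+ 2)%:E)%E.
    by apply: eq_integral => x _; rewrite sqrrN.
  have r2 : (\int[mu]_x (r x ^+ 2)%:E < +oo)%E by rewrite r2E (le_lt_trans kd)// ltry.
  have ir := integrable_itv_supp mr r0 r2.
  have mdr := measurable_freq_density S0 ir r0.
  have kE : k = (fun x => a x + r x) by apply/funext => x; rewrite /r; ring.
  have K2 : (\int[mu]_w (freq_density k w)%:E <=
      (1 + eta)%:E * \int[mu]_w (freq_density a w)%:E
       + (1 + eta^-1)%:E * \int[mu]_w (freq_density r w)%:E)%E.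
    apply: ge0_integral_le_lincomb => //; try by move=> x; exact: freq_density_ge0.
    - exact: (measurable_freq_density S0 ik k0).
    move=> w; rewrite {1}kE /freq_density cosTD// sinTD//.
    have := sqrD_le_young (cosT a w) (cosT r w) e0.
    have := sqrD_le_young (sinT a w) (sinT r w) e0.
    rewrite !mulrDr; lra.
  have K3 : (\int[mu]_w (freq_density r w)%:E <= d%:E)%E.
    by apply: (le_trans (integral_freq_density_le S0 ir r0)); rewrite r2E.
  rewrite -lee_fin (fineK Ifin); apply: (le_trans I1).
  rewrite [leRHS]EFinD; apply: leeD; last first.
    by rewrite [leRHS]EFinM; apply: lee_wpmul2l; rewrite ?lee_fin.
  rewrite [leRHS]EFinM; apply: lee_wpmul2l; rewrite ?lee_fin//.
  apply: (le_trans K1); apply: (le_trans K2).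
  rewrite [leRHS]EFinD; apply: leeD; rewrite [leRHS]EFinM ?(fineK Ffin)//.
  by apply: lee_wpmul2l; rewrite ?lee_fin.
rewrite -(fineK Ifin) -(fineK Ffin) lee_fin.
exact: (le_of_young (fine_ge0 F0) step).
Qed.

End RealPlancherel.

(** * Squared norms in L2 *)

Section L2Basics.
Context d (T : measurableType d) {R : realType}.
Variable mu : {measure set T -> \bar R}.

Definition sqnormc (z : R[i]) : R := complex.Re z ^+ 2 + complex.Im z ^+ 2.

Lemma normc_sqr (z : R[i]) : normc z ^+ 2 = sqnormc z.
Proof. by case: z => a b; rewrite /= sqr_sqrtr// addr_ge0 ?sqr_ge0. Qed.

Lemma sqnormc_ge0 (z : R[i]) : 0 <= sqnormc z.
Proof. by rewrite -normc_sqr sqr_ge0. Qed.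

Lemma sqnormc0 : sqnormc 0 = 0.
Proof. by rewrite /sqnormc /= expr0n addr0. Qed.

Lemma sqnormcN z : sqnormc (- z) = sqnormc z.
Proof. by case: z => a b; rewrite /sqnormc /= !sqrrN. Qed.

Lemma sqnormcB (z w : R[i]) : sqnormc (z - w) =
  (complex.Re z - complex.Re w) ^+ 2 + (complex.Im z - complex.Im w) ^+ 2.
Proof. by case: z w => a b []. Qed.

Lemma sqnormc_le2 (z w : R[i]) : sqnormc (z + w) <= 2 * sqnormc z + 2 * sqnormc w.
Proof.
case: z w => a b [a' b']; rewrite /sqnormc /=.
have := sqr_ge0 (a - a'); have := sqr_ge0 (b - b'); nra.
Qed.

Lemma sqnormcB_le2 (z w : R[i]) : sqnormc z <= 2 * sqnormc w + 2 * sqnormc (z - w).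
Proof. by have := sqnormc_le2 w (z - w); rewrite addrC subrK. Qed.

Implicit Types f g : T -> R[i].

Lemma measurable_sqnormc f : cmeasurable_fun f -> measurable_fun setT (fun t => sqnormc (f t)).
Proof. by move=> [mr mi]; apply: measurable_funD; exact: measurable_funX. Qed.

(** Extended-real valued, unlike [L2norm], so that it makes sense before
    square integrability is known, and over any set. *)
Definition sqint (D : set T) f : \bar R := (\int[mu]_(t in D) (sqnormc (f t))%:E)%E.

Lemma sqint_ge0 D f : (0 <= sqint D f)%E.
Proof. by apply: integral_ge0 => t _; rewrite lee_fin sqnormc_ge0. Qed.

Lemma sqint_setT_ge D f : measurable D -> cmeasurable_fun f -> (sqint D f <= sqint setT f)%E.
Proof.
move=> mD mf; apply: ge0_subset_integral => //.
  by apply/measurable_EFinP; exact: measurable_sqnormc.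
by move=> t _; rewrite lee_fin sqnormc_ge0.
Qed.

Lemma sqint_subset A B f : measurable A -> measurable B -> A `<=` B ->
  cmeasurable_fun f -> (sqint A f <= sqint B f)%E.
Proof.
move=> mA mB AB mf; apply: ge0_subset_integral => //.
  by apply/measurable_EFinP; apply: measurable_funTS; exact: measurable_sqnormc.
by move=> t _; rewrite lee_fin sqnormc_ge0.
Qed.

Lemma ae_eq_sqint D f g : measurable D -> cmeasurable_fun f -> cmeasurable_fun g ->
  {ae mu, forall t, f t = g t} -> sqint D f = sqint D g.
Proof.
move=> mD mf mg fg; apply: ae_eq_integral => //.
- by apply/measurable_EFinP; apply: measurable_funTS; exact: measurable_sqnormc.
- by apply/measurable_EFinP; apply: measurable_funTS; exact: measurable_sqnormc.
- by apply: filterS fg => t -> _.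
Qed.

Lemma cmeasurable_funB f g : cmeasurable_fun f -> cmeasurable_fun g ->
  cmeasurable_fun (fun t => f t - g t).
Proof.
move=> [fr fi] [gr gi]; split.
  rewrite [X in measurable_fun _ X](_ : _ = (fun t => complex.Re (f t) - complex.Re (g t))).
    exact: measurable_funB.
  by apply/funext => t; case: (f t) (g t) => a b [a' b'].
rewrite [X in measurable_fun _ X](_ : _ = (fun t => complex.Im (f t) - complex.Im (g t))).
  exact: measurable_funB.
by apply/funext => t; case: (f t) (g t) => a b [a' b'].
Qed.

Lemma sqint_le2 D f g : measurable D -> cmeasurable_fun f -> cmeasurable_fun g ->
  (sqint D f <= 2%:E * sqint D g + 2%:E * sqint D (fun t => (f t - g t)%R))%E.
Proof.
move=> mD mf mg; apply: ge0_integral_le_lincomb => //; try exact: measurable_sqnormc.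
- by apply: measurable_sqnormc; exact: cmeasurable_funB.
- by move=> t; exact: sqnormc_ge0.
- by move=> t; exact: sqnormc_ge0.
- by move=> t; exact: sqnormc_ge0.
- by move=> t; exact: sqnormcB_le2.
Qed.

Lemma cL2norm_sqint f : (cL2norm mu f `^ 2 = sqint setT f)%E.
Proof.
rewrite /cL2norm powR_Lnorm ?pnatr_eq0//; apply: eq_integral => t _.
by rewrite abse_EFin poweR_EFin ger0_norm ?normc_ge0// powR_mulrn ?normc_ge0// normc_sqr.
Qed.

Lemma mem_cL2 f : cmeasurable_fun f -> (sqint setT f < +oo)%E -> f \in cL2 mu.
Proof.
move=> mf; rewrite -cL2norm_sqint => f2; apply/cL2P; split => //.
rewrite ltNge; apply/negP; rewrite leye_eq => /eqP E; move: f2.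
by rewrite E poweRyr ?gt_eqF// ltxx.
Qed.

Lemma cL2_sqint_lty f : f \in cL2 mu -> (sqint setT f < +oo)%E.
Proof.
move=> /cL2P[mf foo]; rewrite -cL2norm_sqint.
have : cL2norm mu f \is a fin_num by rewrite ge0_fin_numE ?cL2norm_ge0.
by move=> /fineK <-; rewrite poweR_EFin ltry.
Qed.

Lemma cL2B f g : f \in cL2 mu -> g \in cL2 mu -> (fun t => f t - g t) \in cL2 mu.
Proof. by move=> fL gL; exact: rpredB. Qed.

Lemma L2_mem (x : L2 mu) : (x : T -> R[i]) \in cL2 mu.
Proof. exact: valP (repr x : cL2fun mu). Qed.

Lemma L2_cmeasurable (x : L2 mu) : cmeasurable_fun x.
Proof. exact: cL2_cmeasurable. Qed.

Lemma L2norm_ge0 (x : L2 mu) : 0 <= L2norm x.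
Proof. by rewrite fine_ge0 ?cL2norm_ge0. Qed.

Lemma L2norm_sqint (x : L2 mu) : ((L2norm x ^+ 2)%:E = sqint setT x)%E.
Proof.
rewrite -cL2norm_sqint -[in RHS](fineK (cL2norm_fin (repr x : cL2fun mu))).
by rewrite poweR_EFin powR_mulrn ?L2norm_ge0.
Qed.

Lemma L2D_ae (x y : L2 mu) : {ae mu, forall t, (x + y : L2 mu) t = x t + y t}.
Proof.
rewrite -[x]reprK -[y]reprK -piL2D.
have h1 := L2_reprP (repr x : cL2fun mu); have h2 := L2_reprP (repr y : cL2fun mu).
have h3 := L2_reprP ((repr x : cL2fun mu) + repr y).
by apply: filterS3 h1 h2 h3 => t -> -> ->.
Qed.

Lemma L2N_ae (x : L2 mu) : {ae mu, forall t, (- x : L2 mu) t = - x t}.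
Proof.
have := L2D_ae x (- x); rewrite subrr.
have : {ae mu, forall t, (0 : L2 mu) t = 0}.
  by rewrite -piL20; exact: (L2_reprP (0 : cL2fun mu)).
apply: filterS2 => t -> h; apply/eqP; rewrite -subr_eq0 opprK addrC.
by apply/eqP; rewrite -h.
Qed.

Lemma L2B_ae (x y : L2 mu) : {ae mu, forall t, (x - y : L2 mu) t = x t - y t}.
Proof. by apply: filterS2 (L2D_ae x (- y)) (L2N_ae y) => t -> ->. Qed.

Lemma L2_ext (x y : L2 mu) : {ae mu, forall t, x t = y t} -> x = y.
Proof. by move=> xy; rewrite -[x]reprK -[y]reprK; apply/eqL2. Qed.

Lemma toL2B f g : f \in cL2 mu -> g \in cL2 mu ->
  toL2 mu (fun t => f t - g t) = toL2 mu f - toL2 mu g.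
Proof.
move=> fL gL; have hL : (fun t => f t - g t) \in cL2 mu by exact: cL2B.
apply: L2_ext; have h := L2B_ae (toL2 mu f) (toL2 mu g).
apply: filterS2 (filterI h (toL2_ae hL)) (filterI (toL2_ae fL) (toL2_ae gL)).
by move=> t [-> ->] [-> ->].
Qed.

Lemma toL2_sqint D f : measurable D -> f \in cL2 mu -> sqint D (toL2 mu f) = sqint D f.
Proof.
move=> mD fL; apply: ae_eq_sqint => //; [exact: L2_cmeasurable| |exact: toL2_ae].
by have /cL2P[] := fL.
Qed.

Lemma L2B_sqint D (x y : L2 mu) : measurable D ->
  sqint D (x - y : L2 mu) = sqint D (fun t => x t - y t).
Proof.
move=> mD; apply: ae_eq_sqint => //; [exact: L2_cmeasurable| |exact: L2B_ae].
by apply: cmeasurable_funB; exact: L2_cmeasurable.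
Qed.

Lemma sqint_L2_le2 D (x y : L2 mu) : measurable D ->
  (sqint D x <= 2%:E * sqint D y + 2%:E * (L2norm (x - y) ^+ 2)%:E)%E.
Proof.
move=> mD; apply: (le_trans (sqint_le2 mD (L2_cmeasurable x) (L2_cmeasurable y))).
rewrite leeD2l// lee_wpmul2l// L2norm_sqint L2B_sqint//.
by apply: sqint_setT_ge => //; apply: cmeasurable_funB; exact: L2_cmeasurable.
Qed.

End L2Basics.

(** * Plancherel for complex functions of bounded support *)

Section ComplexPlancherel.
Context {R : realType}.
Local Notation mu := (@lebesgue_measure R).
Implicit Types h k : R -> R[i].

(** A class of functions whose Fourier integrals converge absolutely, and for
    which Plancherel is proved directly. *)
Definition sq_supp (S : R) h :=
  [/\ cmeasurable_fun h, (sqint mu setT h < +oo)%E & forall x, S < `|x| -> h x = 0].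

(** The Fourier transform given by an absolutely convergent integral. *)
Definition fourierI h (w : R) : R[i] :=
  cintegral mu setT (fun x => expi (- (2 * pi * w * x)) * h x).

Let reP S h : sq_supp S h ->
  [/\ measurable_fun setT (fun x => complex.Re (h x)), forall x, S < `|x| -> complex.Re (h x) = 0 &
   (\int[mu]_x (complex.Re (h x) ^+ 2)%:E < +oo)%E].
Proof.
move=> [[mr mi] h2 h0]; split => //; first by move=> x /h0 ->.
apply: le_lt_trans h2; apply: ge0_le_integral => //.
- by move=> x _; rewrite lee_fin sqr_ge0.
- by apply/measurable_EFinP; exact: measurable_funX.
- by apply/measurable_EFinP; exact: measurable_sqnormc.
- by move=> x _; rewrite lee_fin /sqnormc lerDl sqr_ge0.
Qed.

Let imP S h : sq_supp S h ->
  [/\ measurable_fun setT (fun x => complex.Im (h x)), forall x, S < `|x| -> complex.Im (h x) = 0 &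
   (\int[mu]_x (complex.Im (h x) ^+ 2)%:E < +oo)%E].
Proof.
move=> [[mr mi] h2 h0]; split => //; first by move=> x /h0 ->.
apply: le_lt_trans h2; apply: ge0_le_integral => //.
- by move=> x _; rewrite lee_fin sqr_ge0.
- by apply/measurable_EFinP; exact: measurable_funX.
- by apply/measurable_EFinP; exact: measurable_sqnormc.
- by move=> x _; rewrite lee_fin /sqnormc lerDr sqr_ge0.
Qed.

Lemma sq_supp_integrable_Re S h : sq_supp S h ->
  mu.-integrable setT (EFin \o (fun x => complex.Re (h x))).
Proof. by move=> /reP[m z i]; exact: (integrable_itv_supp m z i). Qed.

Lemma sq_supp_integrable_Im S h : sq_supp S h ->
  mu.-integrable setT (EFin \o (fun x => complex.Im (h x))).
Proof. by move=> /imP[m z i]; exact: (integrable_itv_supp m z i). Qed.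

Local Notation hr h := (fun x => complex.Re (h x)).
Local Notation hi h := (fun x => complex.Im (h x)).

Lemma Re_fourierI S h w : sq_supp S h ->
  complex.Re (fourierI h w) = cosT (hr h) w + sinT (hi h) w.
Proof.
move=> hS; have ir := sq_supp_integrable_Re hS; have ii := sq_supp_integrable_Im hS.
rewrite /fourierI /cintegral /= /cosT /sinT -RintegralD//; last 2 first.
- exact: integrable_cosT.
- exact: integrable_sinT.
by apply: eq_Rintegral => x _; case: (h x) => a b /=; rewrite cosN sinN mulNr opprK.
Qed.

Lemma Im_fourierI S h w : sq_supp S h ->
  complex.Im (fourierI h w) = cosT (hi h) w - sinT (hr h) w.
Proof.
move=> hS; have ir := sq_supp_integrable_Re hS; have ii := sq_supp_integrable_Im hS.
rewrite /fourierI /cintegral /= /cosT /sinT -RintegralB//; last 2 first.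
- exact: integrable_cosT.
- exact: integrable_sinT.
by apply: eq_Rintegral => x _; case: (h x) => a b /=; rewrite cosN sinN mulNr.
Qed.

Lemma cmeasurable_fourierI S h : 0 <= S -> sq_supp S h -> cmeasurable_fun (fourierI h).
Proof.
move=> S0 hS; have ir := sq_supp_integrable_Re hS; have ii := sq_supp_integrable_Im hS.
have [_ r0 _] := reP hS; have [_ i0 _] := imP hS.
split.
  rewrite [X in measurable_fun _ X](_ : _ = (fun w => cosT (hr h) w + sinT (hi h) w)).
    apply: measurable_funD; apply: continuous_measurable_fun.
      exact: (continuous_cosT S0 ir r0).
    exact: (continuous_sinT S0 ii i0).
  by apply/funext => w; exact: Re_fourierI hS.
rewrite [X in measurable_fun _ X](_ : _ = (fun w => cosT (hi h) w - sinT (hr h) w)).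
  apply: measurable_funB; apply: continuous_measurable_fun.
    exact: (continuous_cosT S0 ii i0).
  exact: (continuous_sinT S0 ir r0).
by apply/funext => w; exact: Im_fourierI hS.
Qed.

(** For complex [h] the squared modulus contains a product of the transforms
    of the real and imaginary parts; it is odd in [w], hence cancels in the sum. *)
Lemma sqnormc_fourierI_sym S h w : sq_supp S h ->
  sqnormc (fourierI h w) + sqnormc (fourierI h (- w)) =
  2 * freq_density (hr h) w + 2 * freq_density (hi h) w.
Proof.
move=> hS; have ir := sq_supp_integrable_Re hS; have ii := sq_supp_integrable_Im hS.
rewrite /sqnormc !(Re_fourierI _ hS) !(Im_fourierI _ hS) /freq_density.
by rewrite !cosT_opp !sinT_opp//; ring.
Qed.

Let double_eq_half (X : \bar R) (a b : R) : (0 <= X ->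
  1%:E * X + 1%:E * X = 2%:E * a%:E + 2%:E * b%:E -> X = 1%:E * a%:E + 1%:E * b%:E)%E.
Proof.
rewrite -!EFinM -!EFinD; case: X => [x _|_|]; last by rewrite leeNy_eq.
  by rewrite -!EFinM -!EFinD => -[] e; congr EFin; lra.
by rewrite mul1e addye.
Qed.

(** Integrating [sqnormc_fourierI_sym] gives twice the identity, by Plancherel
    for the real and imaginary parts. *)
Lemma complex_Plancherel S h : 0 <= S -> sq_supp S h ->
  sqint mu setT (fourierI h) = sqint mu setT h.
Proof.
move=> S0 hS; have ir := sq_supp_integrable_Re hS; have ii := sq_supp_integrable_Im hS.
have [mr r0 r2] := reP hS; have [mi i0 i2] := imP hS.
have mF := measurable_sqnormc (cmeasurable_fourierI S0 hS).
have mFN : measurable_fun setT (fun w : R => sqnormc (fourierI h (- w))).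
  by apply: (measurableT_comp mF); exact: oppr_measurable.
have sym : (sqint mu setT (fourierI h) =
    \int[mu]_w (sqnormc (fourierI h (- w)))%:E)%E.
  rewrite /sqint (@ge0_integral_oppr R (fun w => (sqnormc (fourierI h w))%:E))//.
    exact/measurable_EFinP.
  by move=> w; rewrite lee_fin sqnormc_ge0.
have mdr := measurable_freq_density S0 ir r0.
have mdi := measurable_freq_density S0 ii i0.
have dbl : (1%:E * sqint mu setT (fourierI h) + 1%:E * sqint mu setT (fourierI h) =
    2%:E * \int[mu]_w (freq_density (hr h) w)%:E +
    2%:E * \int[mu]_w (freq_density (hi h) w)%:E)%E.
  rewrite {2}sym.
  rewrite -(ge0_integral_lincomb mu mF mFN (fun w => sqnormc_ge0 _) (fun w => sqnormc_ge0 _) ler01 ler01).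
  rewrite -(ge0_integral_lincomb mu mdr mdi (freq_density_ge0 _) (freq_density_ge0 _) (ler0n R 2) (ler0n R 2)).
  by apply: eq_integral => w _; rewrite !mul1r (sqnormc_fourierI_sym _ hS).
have hE : (1%:E * \int[mu]_x (complex.Re (h x) ^+ 2)%:E +
    1%:E * \int[mu]_x (complex.Im (h x) ^+ 2)%:E = sqint mu setT h)%E.
  rewrite -(ge0_integral_lincomb mu (measurable_funX 2 mr) (measurable_funX 2 mi)
    (fun x => sqr_ge0 _) (fun x => sqr_ge0 _) ler01 ler01).
  by apply: eq_integral => x _; rewrite !mul1r.
move: dbl; rewrite (real_Plancherel S0 mr r0 r2) (real_Plancherel S0 mi i0 i2).
have I1 : (0 <= \int[mu]_x (complex.Re (h x) ^+ 2)%:E)%E.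
  by apply: integral_ge0 => x _; rewrite lee_fin sqr_ge0.
have I2 : (0 <= \int[mu]_x (complex.Im (h x) ^+ 2)%:E)%E.
  by apply: integral_ge0 => x _; rewrite lee_fin sqr_ge0.
rewrite -hE; have J1 := ge0_fin_numE I1; have J2 := ge0_fin_numE I2.
rewrite r2 in J1; rewrite i2 in J2.
rewrite -(fineK J1) -(fineK J2); apply: double_eq_half; exact: sqint_ge0.
Qed.

Lemma fourierI_cL2 S h : 0 <= S -> sq_supp S h -> fourierI h \in cL2 mu.
Proof.
move=> S0 hS; apply: mem_cL2; first exact: cmeasurable_fourierI hS.
by rewrite (complex_Plancherel S0 hS); case: hS.
Qed.

Lemma sq_suppB S h k : sq_supp S h -> sq_supp S k -> sq_supp S (fun x => h x - k x).
Proof.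
move=> [mh h2 h0] [mk k2 k0]; split; first exact: cmeasurable_funB.
- apply: cL2_sqint_lty; apply: (@rpredB _ (cL2 mu) h k); exact: mem_cL2.
- by move=> x Sx; rewrite h0// k0// subr0.
Qed.

Lemma sq_suppW S S' h : S <= S' -> sq_supp S h -> sq_supp S' h.
Proof. by move=> SS' [mh h2 h0]; split => // x Sx; apply: h0; exact: le_lt_trans Sx. Qed.

Lemma fourierIB S h k w : sq_supp S h -> sq_supp S k ->
  fourierI (fun x => h x - k x) w = fourierI h w - fourierI k w.
Proof.
move=> hS kS; have hkS := sq_suppB hS kS.
have ihr := sq_supp_integrable_Re hS; have ihi := sq_supp_integrable_Im hS.
have ikr := sq_supp_integrable_Re kS; have iki := sq_supp_integrable_Im kS.
have nkr : mu.-integrable setT (EFin \o (fun x => - complex.Re (k x))).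
  exact: integrable_oppr.
have nki : mu.-integrable setT (EFin \o (fun x => - complex.Im (k x))).
  exact: integrable_oppr.
have rE : hr (fun x => h x - k x) = (fun x => complex.Re (h x) + - complex.Re (k x)).
  by apply/funext => x; case: (h x) (k x) => a b [].
have iE : hi (fun x => h x - k x) = (fun x => complex.Im (h x) + - complex.Im (k x)).
  by apply/funext => x; case: (h x) (k x) => a b [].
apply/eqP; rewrite eq_complex; apply/andP; split; apply/eqP.
  rewrite (Re_fourierI _ hkS) rE iE cosTD// sinTD// cosTN// sinTN//.
  transitivity (complex.Re (fourierI h w) - complex.Re (fourierI k w)); last first.
    by case: (fourierI h w) (fourierI k w) => a b [].
  by rewrite (Re_fourierI _ hS) (Re_fourierI _ kS); ring.
rewrite (Im_fourierI _ hkS) rE iE cosTD// sinTD// cosTN// sinTN//.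
transitivity (complex.Im (fourierI h w) - complex.Im (fourierI k w)); last first.
  by case: (fourierI h w) (fourierI k w) => a b [].
by rewrite (Im_fourierI _ hS) (Im_fourierI _ kS); ring.
Qed.

Definition trunc (n : nat) h (x : R) : R[i] := if x \in `[- n%:R, n%:R]%R then h x else 0.

Lemma trunc_in n h x : `|x| <= n%:R -> trunc n h x = h x.
Proof. by rewrite /trunc in_itv /= -ler_norml => ->. Qed.

Lemma trunc_out n h x : n%:R < `|x| -> trunc n h x = 0.
Proof. by rewrite /trunc in_itv /= -ler_norml leNgt => ->. Qed.

Lemma cmeasurable_trunc n h : cmeasurable_fun h -> cmeasurable_fun (trunc n h).
Proof.
move=> [mr mi]; have mI : measurable (`[- n%:R, n%:R]%classic : set (measurableTypeR R)).
  exact: measurable_itv.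
split.
  rewrite [X in measurable_fun _ X](_ : _ = (fun x => complex.Re (h x)) \_ `[- n%:R, n%:R]%classic).
    exact: ((measurable_restrictT _ mI).1 (measurable_funTS mr)).
  apply/funext => x; rewrite /trunc /patch mem_setE.
  by case: ifP.
rewrite [X in measurable_fun _ X](_ : _ = (fun x => complex.Im (h x)) \_ `[- n%:R, n%:R]%classic).
  exact: ((measurable_restrictT _ mI).1 (measurable_funTS mi)).
apply/funext => x; rewrite /trunc /patch mem_setE.
by case: ifP.
Qed.

Lemma sqnormc_trunc_le n h x : sqnormc (trunc n h x) <= sqnormc (h x).
Proof. by rewrite /trunc; case: ifP => // _; rewrite sqnormc0 sqnormc_ge0. Qed.

Lemma sq_supp_trunc n h : h \in cL2 mu -> sq_supp n%:R (trunc n h).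
Proof.
move=> hL; have /cL2P[mh _] := hL; split.
- exact: cmeasurable_trunc.
- apply: le_lt_trans (cL2_sqint_lty hL); apply: ge0_le_integral => //.
  + by move=> x _; rewrite lee_fin sqnormc_ge0.
  + by apply/measurable_EFinP; apply: measurable_sqnormc; exact: cmeasurable_trunc.
  + by apply/measurable_EFinP; exact: measurable_sqnormc.
  + by move=> x _; rewrite lee_fin sqnormc_trunc_le.
- by move=> x; exact: trunc_out.
Qed.

Lemma fourierI_trunc n h w : fourierI (trunc n h) w =
  cintegral mu `[- n%:R, n%:R] (fun x => expi (- (2 * pi * w * x)) * h x).
Proof.
rewrite /fourierI /cintegral; congr (_ +i* _)%C; rewrite [RHS]Rintegral_mkcond;
  apply: eq_Rintegral => x _; rewrite /trunc /patch mem_setE; case: ifP => //;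
  by rewrite mulr0.
Qed.

End ComplexPlancherel.

(** * Completeness of L2 *)

Section L2Complete.
Context d (T : measurableType d) {R : realType}.
Variable mu : {measure set T -> \bar R}.

Lemma L2norm_triangle (x y : L2 mu) : L2norm (x + y) <= L2norm x + L2norm y.
Proof. by rewrite -lecR rmorphD /=; exact: ler_L2normD. Qed.

Lemma L2normN (x : L2 mu) : L2norm (- x) = L2norm x.
Proof.
apply: (@complexI R); rewrite -!L2_normE; exact: normrN.
Qed.

Lemma L2norm_distC (x y : L2 mu) : L2norm (x - y) = L2norm (y - x).
Proof. by rewrite -opprB L2normN. Qed.

Lemma L2norm_dist_triangle (y x z : L2 mu) : L2norm (x - z) <= L2norm (x - y) + L2norm (y - z).
Proof. by rewrite -[x - z](subrKA y) ; exact: L2norm_triangle. Qed.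

Lemma L2_cvgP (F : set_system (L2 mu)) (z : L2 mu) : Filter F ->
  (F --> z) <-> (forall e : R, 0 < e -> F [set x | L2norm (z - x) <= e]).
Proof.
move=> FF; split => [/cvgrPdist_le Fz e e0|Fz].
  have e0C : (0 : R[i]) < e%:C%C by rewrite ltcR.
  by have := Fz _ e0C; apply: filterS => x; rewrite L2_normE lecR.
apply/cvgrPdist_le => eps eps0.
have [epsE re0] : eps = (complex.Re eps)%:C%C /\ 0 < complex.Re eps.
  by move: eps0; case: eps => a b; rewrite ltcE /= => /andP[/eqP -> a0].
have := Fz _ re0; apply: filterS => x /= h.
by rewrite L2_normE epsE lecR.
Qed.

Lemma geometric_increments_cvg (u : nat -> R) (C : R) :
  (forall n, `|u n.+1 - u n| <= C / (2 ^ n.+1)%:R) -> cvgn u.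
Proof.
move=> uC; have C0 : 0 <= C.
  have := le_trans (normr_ge0 _) (uC 0%N).
  by rewrite pmulr_lge0// invr_gt0 ltr0n expn_gt0.
have -> : u = (fun n => u 0%N + series (telescope u) n).
  by apply/funext => n; exact: eq_sum_telescope.
apply: is_cvgD; first exact: is_cvg_cst.
apply: normed_cvg; apply: (@series_le_cvg _ _ (fun k => C / (2 ^ (k + 1))%:R)).
- by move=> n; exact: normr_ge0.
- by move=> n; rewrite divr_ge0.
- by move=> n; rewrite addn1; exact: uC.
by apply/cvg_ex; eexists; exact: (@cvg_geometric_series_half _ C 0).
Qed.

Section FastSequence.
Variable x : nat -> L2 mu.
Let q (n : nat) : R := (2 ^ n.+1)%:R.
Let e (n : nat) : R := (q n ^+ 2)^-1.
Hypothesis xe : forall m n, (m <= n)%N -> L2norm (x n - x m) <= e m.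

Let q0 n : 0 < q n. Proof. by rewrite ltr0n expn_gt0. Qed.
Let q1 n : 1 <= q n. Proof. by rewrite ler1n expn_gt0. Qed.
Let e0 n : 0 < e n. Proof. by rewrite invr_gt0 exprn_gt0. Qed.

Let dist n t := sqnormc (x n.+1 t - x n t).

Let mdiff m n : cmeasurable_fun (fun t => x n t - x m t).
Proof. by apply: cmeasurable_funB; exact: L2_cmeasurable. Qed.

Let sqint_diff m n : (m <= n)%N -> (sqint mu setT (fun t => (x n t - x m t)%R) <= (e m ^+ 2)%:E)%E.
Proof.
move=> mn; rewrite -L2B_sqint// -L2norm_sqint lee_fin lerXn2r ?nnegrE ?L2norm_ge0//.
  exact: ltW.
exact: xe.
Qed.

(** Its integral is at most the sum of [q n ^+ 2 * e n ^+ 2 = e n], hence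
    finite. Where it is finite, the increments [x n.+1 t - x n t] are
    dominated by a geometric sequence. *)
Let S t : \bar R := (\sum_(n <oo) (q n ^+ 2 * dist n t)%:E)%E.

Let term_ge0 n t : (0 <= (q n ^+ 2 * dist n t)%:E)%E.
Proof. by rewrite lee_fin mulr_ge0 ?sqr_ge0// sqnormc_ge0. Qed.

Let mterm n : measurable_fun setT (fun t => (q n ^+ 2 * dist n t)%:E).
Proof.
by apply/measurable_EFinP; apply: measurable_funM => //; exact: measurable_sqnormc.
Qed.

Let S_fin : {ae mu, forall t, S t \is a fin_num}.
Proof.
have mS : measurable_fun setT S.
  exact: ge0_emeasurable_sum.
have iS : mu.-integrable setT S.
  apply/integrableP; split => //.
  under eq_integral do rewrite gee0_abs ?nneseries_ge0//.
  rewrite integral_nneseries//.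
  apply: (@le_lt_trans _ _ 1%:E); last by rewrite ltry.
  apply: le_trans (epsilon_trick0 xpredT ler01); apply: lee_nneseries.
    by move=> n _ _; apply: integral_ge0.
  move=> n _; under eq_integral do rewrite EFinM.
  rewrite ge0_integralZl//; last 3 first.
  - by apply/measurable_EFinP; exact: measurable_sqnormc.
  - by move=> t _; rewrite lee_fin sqnormc_ge0.
  - by rewrite lee_fin sqr_ge0.
  apply: (@le_trans _ _ ((q n ^+ 2)%:E * (e n ^+ 2)%:E)%E).
    by apply: lee_wpmul2l; [rewrite lee_fin sqr_ge0|exact: sqint_diff].
  rewrite -EFinM lee_fin /e div1r -/(q n).
  have -> : q n ^+ 2 * (q n ^+ 2)^-1 ^+ 2 = (q n ^+ 2)^-1 by field; rewrite gt_eqF.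
  by rewrite lef_pV2 ?posrE ?exprn_gt0// expr2 ler_peMl// ltW.
by have := integrable_ae measurableT iS; apply: filterS => t; apply.
Qed.

Let re n t := complex.Re (x n t).
Let im n t := complex.Im (x n t).

Let cvg_reim : {ae mu, forall t, cvgn (re ^~ t) /\ cvgn (im ^~ t)}.
Proof.
apply: filterS S_fin => t St; pose s := fine (S t).
have s0 : 0 <= s by rewrite fine_ge0 ?nneseries_ge0.
have dist_le n : q n ^+ 2 * dist n t <= s.
  rewrite -lee_fin /s fineK//.
  apply: le_trans (@nneseries_lim_ge _ _ xpredT 0 n.+1 (fun n _ _ => term_ge0 n t)).
  rewrite big_nat_recr//= leeDr// sume_ge0//.
have root (a : R) n : a ^+ 2 <= dist n t -> `|a| <= (1 + s) / q n.
  move=> ad; rewrite ler_pdivlMr//.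
  have : (`|a| * q n) ^+ 2 <= (1 + s) ^+ 2.
    rewrite exprMn real_normK ?num_real// mulrC.
    apply: (@le_trans _ _ (q n ^+ 2 * dist n t)); first by rewrite ler_wpM2l ?sqr_ge0.
    by apply: (le_trans (dist_le n)); nra.
  by rewrite ler_sqr ?nnegrE ?mulr_ge0 ?addr_ge0// ltW.
split; apply: (@geometric_increments_cvg _ (1 + s)) => n; apply: root; rewrite /dist /re /im.
  by case: (x n.+1 t) (x n t) => a b [a' b']; rewrite /sqnormc /= lerDl sqr_ge0.
by case: (x n.+1 t) (x n t) => a b [a' b']; rewrite /sqnormc /= lerDr sqr_ge0.
Qed.

(** A superior limit, to have a limit that is measurable and defined
    everywhere. *)
Let zr t := fine (limn_esup (fun n => (re n t)%:E)).
Let zi t := fine (limn_esup (fun n => (im n t)%:E)).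
Let z t : R[i] := (zr t +i* zi t)%C.

Let mz : cmeasurable_fun z.
Proof.
split.
  apply: (measurableT_comp (f := fine)) => //; apply: measurable_fun_limn_esup => n.
  by apply/measurable_EFinP; have [] := L2_cmeasurable (x n).
apply: (measurableT_comp (f := fine)) => //; apply: measurable_fun_limn_esup => n.
by apply/measurable_EFinP; have [] := L2_cmeasurable (x n).
Qed.

Let cvg_limsup (u : nat -> R) : cvgn u -> u n @[n --> \oo] --> fine (limn_esup (fun n => (u n)%:E)).
Proof.
move=> /cvg_ex[l ul]; have uE : (u n)%:E @[n --> \oo] --> l%:E.
  by apply: cvg_EFin => //; exact: nearW.
by rewrite (cvg_limn_einf_sup uE).2.
Qed.

Let sqint_limit m : (sqint mu setT (fun t => (z t - x m t)%R) <= (e m ^+ 2)%:E)%E.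
Proof.
apply: (@ge0_integral_limit_le _ _ _ mu (fun n t => (sqnormc (x n t - x m t))%:E)).
- by move=> n; apply/measurable_EFinP; exact: measurable_sqnormc.
- apply/measurable_EFinP; apply: measurable_sqnormc; apply: cmeasurable_funB => //.
  exact: L2_cmeasurable.
- by move=> n t; rewrite lee_fin sqnormc_ge0.
- by move=> t; rewrite lee_fin sqnormc_ge0.
- apply: filterS cvg_reim => t [/cvg_limsup cr /cvg_limsup ci].
  apply: cvg_EFin; first exact: nearW.
  rewrite /comp /= sqnormcB; under eq_fun do rewrite sqnormcB.
  apply: cvgD; apply: (@cvg_comp _ _ _ _ (fun y => y ^+ 2) _ _ _ _ (@exprn_continuous _ 2 _)).
    by apply: cvgB; [exact: cr|exact: cvg_cst].
  by apply: cvgB; [exact: ci|exact: cvg_cst].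
- by exists m => // n /= mn; exact: sqint_diff.
Qed.

Lemma fast_sequence_limit : exists y : L2 mu, forall m, L2norm (y - x m) <= e m.
Proof.
have zL : z \in cL2 mu.
  apply: mem_cL2 => //; apply: (le_lt_trans (sqint_le2 mu measurableT mz (L2_cmeasurable (x 0%N)))).
  apply: lte_add_pinfty; apply: lte_mul_pinfty => //.
    exact: cL2_sqint_lty (L2_mem _).
  by rewrite (le_lt_trans (sqint_limit 0))// ltry.
exists (toL2 mu z) => m.
rewrite -(@ler_pXn2r _ 2) ?nnegrE ?L2norm_ge0 ?(ltW (e0 m))//.
rewrite -lee_fin L2norm_sqint L2B_sqint//; apply: le_trans (sqint_limit m).
rewrite (@ae_eq_sqint _ _ _ _ _ _ (fun t => z t - x m t))//.
- by apply: cmeasurable_funB; exact: L2_cmeasurable.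
- by apply: cmeasurable_funB => //; exact: L2_cmeasurable.
- by apply: filterS (toL2_ae zL) => t ->.
Qed.

End FastSequence.

(** A Cauchy filter contains, for each [n], a set of diameter at most [e n];
    points taken in the successive finite intersections form a sequence whose
    increments are summable, and its limit is the limit of the filter. *)
Lemma L2_complete (F : set_system (L2 mu)) : ProperFilter F ->
  (forall e : R, 0 < e -> exists2 A, F A & forall x y, A x -> A y -> L2norm (x - y) <= e) ->
  exists z : L2 mu, F --> z.
Proof.
move=> FF cF; pose e (n : nat) : R := ((2 ^ n.+1)%:R ^+ 2)^-1.
have e0 n : 0 < e n by rewrite invr_gt0 exprn_gt0// ltr0n expn_gt0.
have /choice[A AP] n : exists A : set (L2 mu),
    F A /\ forall x y, A x -> A y -> L2norm (x - y) <= e n.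
  by have [A FA hA] := cF _ (e0 n); exists A.
(* the index k ranges over all k <= n: the point chosen next is then close to
   every earlier one *)
have FB n : F [set x | forall k, (k <= n)%N -> A k x].
  elim: n => [|n IH].
    by apply: filterS (AP 0%N).1 => x Ax k; rewrite leqn0 => /eqP ->.
  apply: filterS2 IH (AP n.+1).1 => x xn Ax k; rewrite leq_eqVlt => /orP[/eqP -> //|].
  by rewrite ltnS; exact: xn.
have /choice[x xP] n : exists x, forall k, (k <= n)%N -> A k x.
  exact: filter_ex (FB n).
have xe m n : (m <= n)%N -> L2norm (x n - x m) <= e m.
  by move=> mn; apply: (AP m).2; exact: xP.
have [z zP] := fast_sequence_limit xe.
exists z; apply/L2_cvgP => eps eps0.
have [m me] : exists m, e m + e m <= eps.
  pose m := Num.bound (2 / eps); exists m.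
  have q1 : (m%:R : R) <= (2 ^ m.+1)%:R by rewrite ler_nat ltnW// (ltn_trans _ (ltn_expl _ _)).
  have m2 : 2 / eps <= m%:R by rewrite ltW// archi_boundP// divr_ge0// ltW.
  have q2 : (2 ^ m.+1)%:R <= (2 ^ m.+1)%:R ^+ 2 :> R.
    by rewrite expr2 ler_peMl ?ler0n// ler1n expn_gt0.
  have -> : e m + e m = 2 * e m by ring.
  rewrite /e ler_pdivrMr ?exprn_gt0 ?ltr0n ?expn_gt0// mulrC -ler_pdivrMr//.
  exact: le_trans m2 (le_trans q1 q2).
apply: filterS (AP m).1 => y Ay /=.
apply: le_trans (L2norm_dist_triangle (x m) _ _) (le_trans _ me).
by apply: lerD => //; apply: (AP m).2 => //; exact: xP.
Qed.

End L2Complete.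

(** * Tails and the Fourier transform on L2 *)

Section Tails.
Context {R : realType}.
Local Notation mu := (@lebesgue_measure R).

Definition outside (t : R) : set R := [set x | t < `|x|].

Lemma measurable_outside t : measurable (outside t).
Proof.
have mn : measurable_fun setT (fun x : R => `|x|).
  by apply: continuous_measurable_fun; exact: norm_continuous.
rewrite (_ : outside t = setT `&` (fun x : R => `|x|) @^-1` `]t, +oo[%classic).
  exact: (mn measurableT).
by rewrite setTI; apply/seteqP; split => x; rewrite /= in_itv /= andbT.
Qed.

Lemma outside_subset s t : s <= t -> outside t `<=` outside s.
Proof. by move=> st x; rewrite /outside /=; exact: le_lt_trans. Qed.

Definition tail (h : R -> R[i]) (t : R) : \bar R := sqint mu (outside t) h.

Lemma tail_ge0 h t : (0 <= tail h t)%E. Proof. exact: sqint_ge0. Qed.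

Lemma tail_le h s t : cmeasurable_fun h -> s <= t -> (tail h t <= tail h s)%E.
Proof.
move=> mh st; apply: sqint_subset => //; try exact: measurable_outside.
exact: outside_subset.
Qed.

Lemma tail_cvg0 h e : h \in cL2 mu -> 0 < e ->
  exists2 t0 : R, 0 <= t0 & forall t, t0 <= t -> (tail h t <= e%:E)%E.
Proof.
move=> hL e0; have /cL2P[mh _] := hL; have h2 := cL2_sqint_lty hL.
have mS := measurable_sqnormc mh.
have iS : mu.-integrable setT (EFin \o (fun x => sqnormc (h x))).
  apply/integrableP; split; first exact/measurable_EFinP.
  by under eq_integral do rewrite /= ger0_norm ?sqnormc_ge0//.
pose f_ (n : nat) (x : R) := sqnormc (h x) * \1_(outside n%:R) x.
have mf n : measurable_fun setT (f_ n).
  by apply: measurable_funM => //; apply: measurable_indic; exact: measurable_outside.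
have : \int[mu]_x f_ n x @[n --> \oo] --> \int[mu]_x (0 : R).
  apply: (@Rdominated_cvg _ _ _ mu _ _ (fun x => sqnormc (h x))) => //.
    move=> n x; rewrite /f_ normrM (ger0_norm (sqnormc_ge0 _)) ler_piMr ?sqnormc_ge0//.
    by rewrite indicE; case: (_ \in _); rewrite ?normr1 ?normr0.
  apply: aeW => x; apply: cvg_near_cst; exists (Num.bound `|x|) => //= n /= xn.
  rewrite /f_ indicE memNset ?mulr0// /outside /= => /lt_geF/negP; apply.
  by rewrite (le_trans (ltW (archi_boundP (normr_ge0 _))))// ler_nat.
have -> : \int[mu]_x (0 : R) = 0 by rewrite /Rintegral integral0.
move=> /cvgrPdist_le /(_ e e0)[n _ /(_ n (leqnn n))] /= hn.
exists n%:R => // t nt; apply: le_trans (tail_le mh nt) _.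
have i_n : mu.-integrable setT (EFin \o f_ n).
  have -> : f_ n = (fun x => \1_(outside n%:R) x * sqnormc (h x)).
    by apply/funext => x; rewrite /f_ mulrC.
  apply: (@integrable_mul_bounded R _ _ mu _ _ 1) => //.
    by apply: measurable_indic; exact: measurable_outside.
  by move=> x; rewrite indicE; case: (_ \in _); rewrite ?normr1 ?normr0.
have -> : tail h n%:R = (\int[mu]_x (f_ n x)%:E)%E.
  rewrite /tail /sqint integral_mkcond; apply: eq_integral => x _.
  by rewrite /patch /f_ indicE; case: (_ \in _); rewrite ?mulr1 ?mulr0.
rewrite -(fineK (integrable_fin_num measurableT i_n)) lee_fin.
by apply: le_trans hn; rewrite sub0r normrN ler_norm.
Qed.

End Tails.

Section FourierL2.
Context {R : realType}.
Local Notation mu := (@lebesgue_measure R).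
Implicit Types x y : L2 mu.

Lemma fourierI_isometry (S : R) (h k : R -> R[i]) : 0 <= S -> sq_supp S h -> sq_supp S k ->
  ((L2norm (toL2 mu (fourierI h) - toL2 mu (fourierI k)) ^+ 2)%:E =
   sqint mu setT (fun t => (h t - k t)%R))%E.
Proof.
move=> S0 hS kS; have hL := fourierI_cL2 S0 hS; have kL := fourierI_cL2 S0 kS.
rewrite -toL2B// L2norm_sqint toL2_sqint//; last exact: cL2B.
rewrite -(complex_Plancherel S0 (sq_suppB hS kS)).
by congr sqint; apply/funext => w; rewrite (fourierIB w hS kS).
Qed.

Definition fourier_trunc (n : nat) x : L2 mu := toL2 mu (fourierI (trunc n x)).

Definition truncL2 (n : nat) x : L2 mu := toL2 mu (trunc n x).

Let sup n x : sq_supp n%:R (trunc n x).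
Proof. by apply: sq_supp_trunc; exact: L2_mem. Qed.

Let trunc_cL2 n x : trunc n x \in cL2 mu.
Proof. by have [m h2 _] := sup n x; exact: mem_cL2. Qed.

Lemma fourier_trunc_dist n x y :
  L2norm (fourier_trunc n x - fourier_trunc n y) = L2norm (truncL2 n x - truncL2 n y).
Proof.
have := fourierI_isometry (ler0n R n) (sup n x) (sup n y).
have -> : sqint mu setT (fun t => (trunc n x t - trunc n y t)%R) =
    ((L2norm (truncL2 n x - truncL2 n y)) ^+ 2)%:E.
  rewrite -toL2B// L2norm_sqint toL2_sqint//; exact: cL2B.
move=> [] /eqP; rewrite -/(fourier_trunc n x) -/(fourier_trunc n y).
by rewrite eqrXn2 ?L2norm_ge0// => /eqP.
Qed.

Lemma fourier_trunc_norm n x : L2norm (fourier_trunc n x) = L2norm (truncL2 n x).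
Proof.
have : (L2norm (fourier_trunc n x) ^+ 2)%:E = (L2norm (truncL2 n x) ^+ 2)%:E.
  rewrite !L2norm_sqint !toL2_sqint//; last exact: fourierI_cL2 (sup n x).
  exact: complex_Plancherel (sup n x).
by move=> [] /eqP; rewrite eqrXn2 ?L2norm_ge0// => /eqP.
Qed.

Lemma trunc_sub_le m (n : nat) (h : R -> R[i]) t : (m <= n)%N ->
  sqnormc (trunc n h t - trunc m h t) <= sqnormc (h t) * \1_(outside m%:R) t.
Proof.
move=> mn; rewrite indicE; case: (leP `|t| m%:R) => tm.
  by rewrite !trunc_in// ?(le_trans tm) ?ler_nat// subrr sqnormc0 mulr_ge0 ?sqnormc_ge0.
by rewrite mem_set// mulr1 (trunc_out h tm) subr0 sqnormc_trunc_le.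
Qed.

Let le_tail (f h : R -> R[i]) m : cmeasurable_fun f -> cmeasurable_fun h ->
  (forall t, sqnormc (f t) <= sqnormc (h t) * \1_(outside m) t) ->
  (sqint mu setT f <= tail h m)%E.
Proof.
move=> mf mh fh; rewrite /tail [leRHS]integral_mkcond; apply: ge0_le_integral => //.
- by move=> t _; rewrite lee_fin sqnormc_ge0.
- by apply/measurable_EFinP; exact: measurable_sqnormc.
- apply: ((measurable_restrictT _ (measurable_outside m)).1).
  by apply: measurable_funTS; apply/measurable_EFinP; exact: measurable_sqnormc.
move=> t _; have := fh t; rewrite /patch indicE.
by case: (_ \in _); rewrite ?mulr1 ?mulr0 lee_fin.
Qed.

(** By Plancherel, the tail bounds the distance between Fourier integrals over
    growing intervals; these therefore form a Cauchy sequence. *)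
Lemma fourier_trunc_tail m n x : (m <= n)%N ->
  ((L2norm (fourier_trunc n x - fourier_trunc m x) ^+ 2)%:E <= tail x m%:R)%E.
Proof.
move=> mn; have mnR : (m%:R : R) <= n%:R by rewrite ler_nat.
rewrite (fourierI_isometry (ler0n R n) (sup n x) (sq_suppW mnR (sup m x))).
apply: le_tail; last by move=> t; exact: trunc_sub_le.
- by apply: cmeasurable_funB; exact: (cmeasurable_trunc _ (L2_cmeasurable x)).
- exact: (L2_cmeasurable x).
Qed.

Lemma truncL2_tail m x : ((L2norm (x - truncL2 m x) ^+ 2)%:E <= tail x m%:R)%E.
Proof.
rewrite L2norm_sqint L2B_sqint//.
have mt := cmeasurable_trunc m (L2_cmeasurable x).
rewrite (@ae_eq_sqint _ _ _ _ _ _ (fun t => x t - trunc m x t))//.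
- apply: le_tail; [exact: (cmeasurable_funB (L2_cmeasurable x) mt)|exact: (L2_cmeasurable x)|].
  move=> t; rewrite indicE; case: (leP `|t| m%:R) => tm.
    by rewrite trunc_in// subrr sqnormc0 mulr_ge0 ?sqnormc_ge0.
  by rewrite mem_set// mulr1 (trunc_out _ tm) subr0.
- exact: (cmeasurable_funB (L2_cmeasurable x) (L2_cmeasurable (truncL2 m x))).
- exact: (cmeasurable_funB (L2_cmeasurable x) mt).
- by apply: filterS (toL2_ae (trunc_cL2 m x)) => t ->.
Qed.

Let L2norm_le_sqr x (b : R) : 0 <= b -> ((L2norm x ^+ 2)%:E <= (b ^+ 2)%:E)%E -> L2norm x <= b.
Proof. by move=> b0; rewrite lee_fin ler_sqr ?nnegrE ?L2norm_ge0. Qed.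

Lemma tail_small x (e : R) : 0 < e -> exists m : nat, forall n, (m <= n)%N ->
  (tail x n%:R <= (e ^+ 2)%:E)%E.
Proof.
move=> e0; have [t0 t00 tP] := tail_cvg0 (L2_mem x) (exprn_gt0 2 e0).
exists (Num.bound t0) => n nt; apply: tP.
by rewrite (le_trans (ltW (archi_boundP t00)))// ler_nat.
Qed.

(** The limit that defines [fourierL2] exists. *)
Lemma cvg_fourier_trunc x : fourier_trunc n x @[n --> \oo] --> fourierL2 x.
Proof.
have E : (fun n : nat => toL2 mu (fun w => cintegral mu `[- n%:R, n%:R]
      (fun t => expi (- (2 * pi * w * t)) * x t))) = (fun n => fourier_trunc n x).
  apply/funext => n; congr toL2; apply/funext => w; exact/esym/fourierI_trunc.
rewrite /fourierL2 E.
have [z cz] : exists z : L2 mu, fourier_trunc n x @[n --> \oo] --> z.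
  apply: L2_complete => e e0; have e20 : 0 < e / 2 by rewrite divr_gt0.
  have [m mP] := tail_small x e20.
  exists [set fourier_trunc n x | n in [set n | (m <= n)%N]].
    by exists m => // n /= mn; exists n.
  have key n : (m <= n)%N -> L2norm (fourier_trunc n x - fourier_trunc m x) <= e / 2.
    move=> mn; apply: L2norm_le_sqr; first exact: ltW.
    exact: le_trans (fourier_trunc_tail x mn) (mP m (leqnn m)).
  move=> _ _ [n mn <-] [k mk <-].
  apply: le_trans (L2norm_dist_triangle (fourier_trunc m x) _ _) _.
  rewrite [leRHS](splitr e); apply: lerD; first exact: (key n mn).
  by rewrite L2norm_distC; exact: (key k mk).
have hl : lim (fourier_trunc n x @[n --> \oo]) = z by apply: cvg_lim => //; exact: norm_hausdorff.
by rewrite hl.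
Qed.

(** A rate of convergence that depends on [x] through its tail only; it is
    uniform on a family with uniform tails. *)
Lemma fourierL2_dist_trunc x (m : nat) (s : R) : 0 <= s -> (tail x m%:R <= (s ^+ 2)%:E)%E ->
  L2norm (fourierL2 x - fourier_trunc m x) <= s.
Proof.
move=> s0 ts; apply/ler_addgt0Pr => e e0.
have /L2_cvgP/(_ e e0)[n0 _ nP] := @cvg_fourier_trunc x.
pose n := maxn m n0; have mn : (m <= n)%N by exact: leq_maxl.
apply: le_trans (L2norm_dist_triangle (fourier_trunc n x) _ _) _.
rewrite addrC lerD//; last by apply: nP; exact: leq_maxr.
apply: L2norm_le_sqr => //.
exact: le_trans (fourier_trunc_tail x mn) ts.
Qed.

Let near_trunc x (e : R) : 0 < e -> exists m : nat, forall n, (m <= n)%N ->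
  L2norm (fourierL2 x - fourier_trunc n x) <= e /\ L2norm (x - truncL2 n x) <= e.
Proof.
move=> e0; have [m mP] := tail_small x e0; exists m => n mn; split.
  by apply: fourierL2_dist_trunc; [exact: ltW|exact: mP].
apply: L2norm_le_sqr; first exact: ltW.
by apply: le_trans (truncL2_tail n x) _; exact: mP.
Qed.

Let dist_abs (u v : R) : (forall e, 0 < e -> `|u - v| <= e) -> u = v.
Proof.
move=> uv; apply/eqP; rewrite -subr_eq0 -normr_le0; apply/ler_addgt0Pr => e e0.
by rewrite add0r uv.
Qed.

Lemma L2norm_dist_le x y : `|L2norm x - L2norm y| <= L2norm (x - y).
Proof.
rewrite ler_norml; apply/andP; split.
  rewrite lerNl opprB lerBlDr.
  by have := L2norm_dist_triangle x y 0; rewrite !subr0 L2norm_distC.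
rewrite lerBlDr; have := L2norm_dist_triangle y x 0; rewrite !subr0; exact.
Qed.

Lemma fourierL2_norm x : L2norm (fourierL2 x) = L2norm x.
Proof.
apply: dist_abs => e e0; have e20 : 0 < e / 2 by rewrite divr_gt0.
have [m /(_ m (leqnn m))[h1 h2]] := near_trunc x e20.
have k1 := le_trans (L2norm_dist_le _ _) h1; have k2 := le_trans (L2norm_dist_le _ _) h2.
rewrite fourier_trunc_norm in k1.
rewrite [leRHS](splitr e) (le_trans (ler_distD (L2norm (truncL2 m x)) _ _))// lerD//.
by rewrite distrC.
Qed.

Lemma fourierL2_isometry x y : L2norm (fourierL2 x - fourierL2 y) = L2norm (x - y).
Proof.
apply: dist_abs => e e0; have e40 : 0 < e / 4 by rewrite divr_gt0.
have [m mP] := near_trunc x e40; have [n nP] := near_trunc y e40.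
pose k := maxn m n; have [h1 h2] := mP k (leq_maxl _ _); have [h3 h4] := nP k (leq_maxr _ _).
have quad (a b a' b' : L2 mu) : L2norm (a - a') <= e / 4 -> L2norm (b - b') <= e / 4 ->
    `|L2norm (a - b) - L2norm (a' - b')| <= e / 2.
  move=> aa bb; apply: (le_trans (L2norm_dist_le _ _)).
  have -> : a - b - (a' - b') = (a - a') - (b - b') by rewrite !opprB addrACA [RHS]addrACA; congr (_ + _); rewrite addrC.
  apply: (le_trans (L2norm_triangle _ _)); rewrite L2normN.
  have -> : e / 2 = e / 4 + e / 4 by field.
  exact: lerD.
have q1 := quad _ _ _ _ h1 h3; have q2 := quad _ _ _ _ h2 h4.
rewrite fourier_trunc_dist in q1.
rewrite [leRHS](splitr e) (le_trans (ler_distD (L2norm (truncL2 k x - truncL2 k y)) _ _))// lerD//.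
by rewrite distrC.
Qed.

End FourierL2.

(** * The Haar measure and the Mellin transform *)

Section HaarExp.
Context {R : realType}.
Local Notation mu := (@lebesgue_measure R).
Local Notation rpos := (`]0%R, +oo[%classic : set (measurableTypeR R)).

Lemma measurable_ln_fun : measurable_fun setT (@ln R : measurableTypeR R -> measurableTypeR R).
Proof. exact: measurable_ln. Qed.

Lemma haar_pos (A : set (measurableTypeR R)) : haar R (A `&` rpos) = haar R A.
Proof. by rewrite /haar -setIA setIid. Qed.

Lemma integral_inv (a b : R) : 0 < a -> a < b ->
  (\int[mu]_(r in `]a, b]) (r^-1)%:E = (ln b - ln a)%:E)%E.
Proof.
move=> a0 ab; have pos r : r \in `[a, b]%R -> 0 < r.
  by rewrite in_itv /= => /andP[ar _]; exact: lt_le_trans ar.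
have cinv r : 0 < r -> {for r, continuous (@GRing.inv R)}.
  by move=> r0; apply: inv_continuous; rewrite gt_eqF.
have mi : measurable_fun (`]a, b] : set (measurableTypeR R)) (fun r : R => (r^-1)%:E).
  apply: measurable_funS (@measurable_haar_density R) => //.
  move=> r /=; rewrite !in_itv /= andbT => /andP[ar _]; exact: lt_trans ar.
rewrite (integral_itv_obnd_cbnd mi) (@continuous_FTC2 _ _ (@ln R)) ?EFinB//.
- apply: continuous_in_subspaceT => r; rewrite inE /= => /pos; exact: cinv.
- split.
  + move=> r /[!in_itv] /= /andP[ar _]; have [] := @is_derive1_ln _ r (lt_trans a0 ar).
    by [].
  + by apply: cvg_at_right_filter; apply: continuous_ln.
  + by apply: cvg_at_left_filter; apply: continuous_ln; exact: lt_trans ab.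
- move=> r /[!in_itv] /= /andP[ar _]; rewrite derive1E.
  by rewrite (@derive_val _ _ _ _ _ _ _ (@is_derive1_ln _ r (lt_trans a0 ar))).
Qed.

(** The primitive of [1 / r] is [ln], so that the logarithm carries the Haar
    measure of the half-line to the Lebesgue measure of R. *)
Lemma pushforward_haar_ln (A : set (measurableTypeR R)) : measurable A ->
  pushforward (haar R) (@ln R : measurableTypeR R -> measurableTypeR R) A = mu A.
Proof.
move=> mA; apply/esym/lebesgue_measure_unique => //=.
move=> _ [[a b]] _ <-; rewrite /pushforward /haar.
have -> : (@ln R) @^-1` `]a, b] `&` rpos = `](expR a), (expR b)]%classic.
  apply/seteqP; split => r /=; rewrite !in_itv /= andbT.
    move=> [/andP[ar rb] r0]; rewrite -[r]lnK ?posrE// ltr_expR ler_expR.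
    by rewrite ar rb.
  move=> /andP[ar rb]; have r0 : 0 < r by apply: lt_trans ar; exact: expR_gt0.
  split => //; move: ar rb; rewrite -{1 2}[r]lnK ?posrE// ltr_expR ler_expR.
  by move=> -> ->.
rewrite [LHS]lebesgue_measure_itv /= lte_fin; case: ltP => ab.
  by rewrite integral_inv ?expR_gt0 ?ltr_expR// !expRK EFinB.
by rewrite set_itv_ge ?integral_set0// bnd_simp -leNgt ler_expR.
Qed.

Lemma integral_haar_exp (D : set (measurableTypeR R)) (g : R -> R) :
  measurable D -> measurable_fun setT (g : measurableTypeR R -> R) -> (forall r, 0 <= g r) ->
  (\int[mu]_(x in D) (g (expR x))%:E =
   \int[haar R]_(r in (@ln R) @^-1` D `&` rpos) (g r)%:E)%E.
Proof.
move=> mD mg g0.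
have mge : measurable_fun setT (fun x : measurableTypeR R => (g (expR x))%:E).
  by apply/measurable_EFinP; apply: (measurableT_comp mg); exact: measurable_expR.
have mlD : measurable ((@ln R : measurableTypeR R -> measurableTypeR R) @^-1` D).
  by rewrite -[X in measurable X]setTI; exact: measurable_ln_fun.
transitivity (\int[pushforward (haar R) (@ln R : measurableTypeR R -> measurableTypeR R)]_(x in D) (g (expR x))%:E)%E.
  by apply: eq_measure_integral => //= A mA _; exact/esym/pushforward_haar_ln.
have mN : measurable (~` rpos) by exact: measurableC.
have N0 : haar R (~` rpos) = 0%E by rewrite -haar_pos setICl measure0.
rewrite (@ge0_integral_pushforward _ _ _ _ _ _ measurable_ln_fun (haar R) D _ mD
  (measurable_funTS mge)); last by move=> x _; rewrite lee_fin.
rewrite (@ge0_negligible_integral _ _ _ (haar R) _ (~` rpos))//; last 2 first.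
- apply: measurable_funTS; apply: (measurableT_comp mge); exact: measurable_ln_fun.
- by move=> r _; rewrite lee_fin.
rewrite setDE setCK; apply: eq_integral => r; rewrite inE /= => -[_].
by rewrite in_itv /= andbT => r0; rewrite lnK.
Qed.

End HaarExp.

Section MellinIsometry.
Context {R : realType}.
Local Notation mu := (@lebesgue_measure R).
Local Notation rpos := (`]0%R, +oo[%classic : set (measurableTypeR R)).
Implicit Types f g : L2 (haar R).

Let cmeasurable_exp (h : measurableTypeR R -> R[i]) : cmeasurable_fun h ->
  cmeasurable_fun (fun x : measurableTypeR R => h (expR x)).
Proof.
by move=> [mr mi]; split; [apply: (measurableT_comp mr)|apply: (measurableT_comp mi)];
  exact: measurable_expR.
Qed.

Lemma sqint_haar_exp (D : set (measurableTypeR R)) (h : measurableTypeR R -> R[i]) :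
  measurable D -> cmeasurable_fun h ->
  sqint mu D (fun x => h (expR x)) = sqint (haar R) ((@ln R) @^-1` D `&` rpos) h.
Proof.
move=> mD mh; apply: (@integral_haar_exp R D (fun r => sqnormc (h r))) => //.
  exact: measurable_sqnormc.
by move=> r; exact: sqnormc_ge0.
Qed.

Lemma sqint_haar_pos (h : measurableTypeR R -> R[i]) : cmeasurable_fun h ->
  sqint (haar R) rpos h = sqint (haar R) setT h.
Proof.
move=> mh; have N0 : haar R (~` rpos) = 0%E by rewrite -haar_pos setICl measure0.
rewrite /sqint [RHS](@ge0_negligible_integral _ _ _ (haar R) setT (~` rpos))//.
- by rewrite setDE setCK setTI.
- exact: measurableC.
- by apply/measurable_EFinP; exact: measurable_sqnormc.
- by move=> r _; rewrite lee_fin sqnormc_ge0.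
Qed.

Lemma sqint_exp (h : measurableTypeR R -> R[i]) : cmeasurable_fun h ->
  sqint mu setT (fun x => h (expR x)) = sqint (haar R) setT h.
Proof.
by move=> mh; rewrite sqint_haar_exp// preimage_setT setTI sqint_haar_pos.
Qed.

Definition log_change f : L2 mu := toL2 mu (fun x => f (expR x)).

Lemma exp_cL2 f : (fun x => f (expR x)) \in cL2 mu.
Proof.
have mf := L2_cmeasurable f; apply: mem_cL2; first exact: cmeasurable_exp.
by rewrite (sqint_exp mf); exact: cL2_sqint_lty (L2_mem f).
Qed.

Let L2norm_eq (d1 d2 : measure_display) (T1 : measurableType d1) (T2 : measurableType d2)
  (m1 : {measure set T1 -> \bar R}) (m2 : {measure set T2 -> \bar R}) (x : L2 m1) (y : L2 m2) :
  sqint m1 setT x = sqint m2 setT y -> L2norm x = L2norm y.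
Proof.
rewrite -!L2norm_sqint => -[] /eqP.
by rewrite eqrXn2 ?L2norm_ge0// => /eqP.
Qed.

Lemma log_change_norm f : L2norm (log_change f) = L2norm f.
Proof.
apply: L2norm_eq; rewrite toL2_sqint//; last exact: exp_cL2.
by apply: sqint_exp; exact: (L2_cmeasurable f).
Qed.

Lemma log_change_dist f g : L2norm (log_change f - log_change g) = L2norm (f - g).
Proof.
apply: L2norm_eq; have mf := L2_cmeasurable f; have mg := L2_cmeasurable g.
rewrite /log_change -(toL2B (exp_cL2 f) (exp_cL2 g)) toL2_sqint//; last first.
  exact: cL2B (exp_cL2 f) (exp_cL2 g).
rewrite L2B_sqint//; exact: (sqint_exp (cmeasurable_funB mf mg)).
Qed.

Lemma mellin_norm f : L2norm (mellin f) = L2norm f.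
Proof. by rewrite -(log_change_norm f); exact: fourierL2_norm. Qed.

Lemma mellin_dist f g : L2norm (mellin f - mellin g) = L2norm (f - g).
Proof. by rewrite -(log_change_dist f g); exact: fourierL2_isometry. Qed.

Lemma ln_preimage_outside (xi : R) : 0 < xi ->
  (@ln R) @^-1` outside (ln xi) `&` rpos = rpos `\` `[xi^-1, xi].
Proof.
move=> xi0; have xiV0 : 0 < xi^-1 by rewrite invr_gt0.
apply/seteqP; split => r /=; rewrite /outside /= !in_itv /= !andbT.
  move=> [lr r0]; split => // /andP[xir rxi]; move: lr; apply/negP; rewrite -leNgt.
  by rewrite ler_norml -lnV ?posrE// !ler_ln ?posrE// xir rxi.
move=> [r0 nr]; split => //; rewrite ltNge; apply/negP.
by rewrite ler_norml -lnV ?posrE// !ler_ln ?posrE.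
Qed.

Lemma haar_tail f (xi : R) : 0 < xi ->
  sqint (haar R) (rpos `\` `[xi^-1, xi]) f = tail (log_change f) (ln xi).
Proof.
move=> xi0; rewrite -ln_preimage_outside//.
rewrite /tail toL2_sqint; [|exact: measurable_outside|exact: exp_cL2].
by rewrite sqint_haar_exp//; [exact: measurable_outside|exact: (L2_cmeasurable f)].
Qed.

End MellinIsometry.

(** * The energy outside a rectangle *)

Section RihaczekEnergy.
Context {R : realType}.
Local Notation mu := (@lebesgue_measure R).
Local Notation rpos := (`]0%R, +oo[%classic : set (measurableTypeR R)).
Variable f : L2 (haar R).

Let F (w : measurableTypeR R) : R := sqnormc (mellin f w).
Let G (r : measurableTypeR R) : R := sqnormc (f r).

Let F0 w : 0 <= F w. Proof. exact: sqnormc_ge0. Qed.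
Let G0 r : 0 <= G r. Proof. exact: sqnormc_ge0. Qed.
Let mF : measurable_fun setT F.
Proof. exact: measurable_sqnormc (L2_cmeasurable (mellin f)). Qed.
Let mG : measurable_fun setT G.
Proof. exact: measurable_sqnormc (L2_cmeasurable f). Qed.

Lemma normc_expi (t : R) : normc (expi t) = 1.
Proof. by rewrite /expi /= cos2Dsin2 sqrtr1. Qed.

Lemma normc_conj (z : R[i]) : normc (z^*)%C = normc z.
Proof. by case: z => a b; rewrite /= sqrrN. Qed.

Lemma sqr_mellin_rihaczek w r : normc (mellin_rihaczek f w r) ^+ 2 = F w * G r.
Proof.
rewrite /mellin_rihaczek !normcM normc_expi mul1r normc_conj exprMn mulrC.
by rewrite !normc_sqr.
Qed.

Let mFG : measurable_fun setT (fun p : measurableTypeR R * measurableTypeR R => (F p.1 * G p.2)%:E).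
Proof.
apply/measurable_EFinP; apply: measurable_funM.
  exact: (measurableT_comp mF measurable_fst).
exact: (measurableT_comp mG measurable_snd).
Qed.

Lemma rihaczek_energyE D : rihaczek_energy f D =
  (\int[(mu \x haar R)%E]_(p in D) (F p.1 * G p.2)%:E)%E.
Proof. by apply: eq_integral => p _; rewrite sqr_mellin_rihaczek. Qed.

(** The factors [expi] have modulus 1, so the squared modulus of the
    distribution is a product of a function of [w] and a function of [r], and
    its integral over a rectangle factorises. *)
Lemma rihaczek_energy_rect (A B : set (measurableTypeR R)) : measurable A -> measurable B ->
  rihaczek_energy f (A `*` B) = (sqint mu A (mellin f) * sqint (haar R) B f)%E.
Proof.
move=> mA mB; rewrite rihaczek_energyE integral_mkcond.
have E : ((fun p : measurableTypeR R * measurableTypeR R => (F p.1 * G p.2)%:E) \_ (A `*` B)) =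
    (fun p => (F p.1 * \1_A p.1)%:E * (G p.2 * \1_B p.2)%:E)%E.
  apply/funext => p; rewrite /patch !indicE in_setX.
  by case: (p.1 \in A); case: (p.2 \in B); rewrite -EFinM ?mulr1 ?mulr0 ?mul0r.
rewrite E.
have mFA : measurable_fun setT (fun w => (F w * \1_A w)%:E).
  by apply/measurable_EFinP; apply: measurable_funM => //; exact: measurable_indic.
have mGB : measurable_fun setT (fun r => (G r * \1_B r)%:E).
  by apply/measurable_EFinP; apply: measurable_funM => //; exact: measurable_indic.
have FA0 w : (0 <= (F w * \1_A w)%:E)%E by rewrite lee_fin mulr_ge0.
have GB0 r : (0 <= (G r * \1_B r)%:E)%E by rewrite lee_fin mulr_ge0.
have sqE (nu : {measure set (measurableTypeR R) -> \bar R}) (h : R -> R[i]) (C : set (measurableTypeR R)) :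
    sqint nu C h = (\int[nu]_t (sqnormc (h t) * \1_C t)%:E)%E.
  rewrite /sqint integral_mkcond; apply: eq_integral => t _; rewrite /patch indicE.
  by case: (_ \in _); rewrite ?mulr1 ?mulr0.
rewrite (@fubini_tonelli1 _ _ _ _ _ mu (haar R)); last 2 first.
- apply: emeasurable_funM.
    exact: (measurableT_comp mFA measurable_fst).
  exact: (measurableT_comp mGB measurable_snd).
- by move=> p; rewrite mule_ge0.
rewrite (sqE mu) (sqE (haar R)) /fubini_F /=.
under eq_integral do rewrite ge0_integralZl//.
by rewrite ge0_integralZr// integral_ge0.
Qed.

Let K (xi : R) : set (R * R) :=
  ([set: R] `*` `]0, +oo[) `\` (`[- xi, xi] `*` `[xi^-1, xi]).

Let outsideE (xi : R) : outside xi = ~` `[- xi, xi].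
Proof.
apply/seteqP; split => x; rewrite /outside /= in_itv /= -ler_norml ltNge => h; exact/negP.
Qed.

Let mout xi : measurable (outside xi : set (measurableTypeR R)).
Proof. exact: measurable_outside. Qed.

Let mrest (xi : R) : measurable (rpos `\` `[xi^-1, xi]).
Proof. by apply: measurableD. Qed.

Let mK xi : measurable (K xi : set (measurableTypeR R * measurableTypeR R)).
Proof. by apply: measurableD; apply: measurableX. Qed.

Let energy_subset (A B : set (measurableTypeR R * measurableTypeR R)) :
  measurable A -> measurable B -> A `<=` B -> (rihaczek_energy f A <= rihaczek_energy f B)%E.
Proof.
move=> mA mB AB; rewrite !rihaczek_energyE; apply: ge0_subset_integral => //.
  exact: measurable_funTS.
by move=> p _; rewrite lee_fin mulr_ge0.
Qed.

Let N := (L2norm f ^+ 2)%:E.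

Let NE1 : sqint mu setT (mellin f) = N.
Proof. by rewrite -L2norm_sqint mellin_norm. Qed.

Let NE2 : sqint (haar R) rpos f = N.
Proof. by rewrite sqint_haar_pos -?L2norm_sqint//; exact: L2_cmeasurable. Qed.

(** The set contains the product of the exterior of [[- xi, xi]] with the
    half-line, over which the energy factorises. *)
Lemma rihaczek_energy_ge_freq xi : (tail (mellin f) xi * N <= rihaczek_energy f (K xi))%E.
Proof.
rewrite -NE2 /tail -rihaczek_energy_rect//.
apply: energy_subset => //; first by apply: measurableX.
move=> [w r] /= [ow r0]; split => // -[] /= wx _.
by move: ow; rewrite outsideE; exact.
Qed.

Lemma rihaczek_energy_ge_time xi : 0 < xi ->
  (N * tail (log_change f) (ln xi) <= rihaczek_energy f (K xi))%E.
Proof.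
move=> xi0; rewrite -NE1 -haar_tail// -rihaczek_energy_rect//.
apply: energy_subset => //; first by apply: measurableX.
by move=> [w r] /= [_ [r0 nr]]; split => // -[].
Qed.

(** The set is covered by two products that have a whole axis as a factor, over
    which the corresponding integral is the squared norm of [f]. *)
Lemma rihaczek_energy_le xi : 0 < xi ->
  (rihaczek_energy f (K xi) <= tail (mellin f) xi * N + N * tail (log_change f) (ln xi))%E.
Proof.
move=> xi0; rewrite -haar_tail//.
pose A1 : set (measurableTypeR R * measurableTypeR R) := outside xi `*` rpos.
pose A2 : set (measurableTypeR R * measurableTypeR R) := setT `*` (rpos `\` `[xi^-1, xi]).
have mA1 : measurable A1 by apply: measurableX.
have mA2 : measurable A2 by apply: measurableX.
have mA21 : measurable (A2 `\` A1) by exact: measurableD.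
have -> : (tail (mellin f) xi * N = rihaczek_energy f A1)%E.
  by rewrite rihaczek_energy_rect// NE2.
rewrite -NE1 -rihaczek_energy_rect//.
apply: (@le_trans _ _ (rihaczek_energy f (A1 `|` (A2 `\` A1)))).
  apply: energy_subset => //; first exact: measurableU.
  rewrite setUDr setDv setD0 => -[w r] /= [[_ r0] nK].
  have [wx|wx] := pselect (`[- xi, xi]%classic w); last by left; split => //=; rewrite outsideE.
  by right; split => //; split => // rx; exact: nK.
rewrite rihaczek_energyE ge0_integral_setU//; first last.
- rewrite disj_set2E; apply/eqP/seteqP; split => // p [A1p [_ nA1p]].
  exact: nA1p.
- by move=> p _; rewrite lee_fin mulr_ge0.
- exact: measurable_funTS.
rewrite -!rihaczek_energyE leeD2l//; apply: energy_subset => //.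
Qed.

End RihaczekEnergy.

(** * Compactness and uniform tails *)

Section UltraLimit.
Context {R : realType} {T : Type}.

Lemma sqr_dist_chain (l a a' b b' s : R) : `|l - a| <= s -> `|l - b| <= s ->
  `|a - a'| <= s -> `|b - b'| <= s -> (a' - b') ^+ 2 <= (4 * s) ^+ 2.
Proof.
move=> la lb aa bb; have s0 : 0 <= s by exact: le_trans la.
rewrite -[leLHS]real_normK ?num_real// lerXn2r ?nnegrE ?mulr_ge0//.
have -> : a' - b' = (- (a - a') - (l - a)) + ((l - b) + (b - b')) by ring.
rewrite (le_trans (ler_normD _ _))//.
rewrite (le_trans (lerD (ler_normB _ _) (ler_normD _ _)))// normrN.
have -> : 4 * s = (s + s) + (s + s) by ring.
by apply: lerD; apply: lerD.
Qed.

Lemma ultra_image_cvg (U : set_system T) (u : T -> R) (B : R) : UltraFilter U ->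
  U [set f | `|u f| <= B] -> exists l : R, u @ U --> l.
Proof.
move=> UU UB; have PU : ProperFilter (u @ U) by apply: fmap_proper_filter.
have FB : (u @ U) `[- B, B]%classic.
  have := UB; apply: (@filterS _ U) => f /= fB.
  by rewrite /= in_itv /= -ler_norml.
(* a bounded ultrafilter clusters in a segment, and an ultrafilter converges to
   each of its cluster points *)
have [l [_ ul]] := @segment_compact R (- B) B (u @ U) PU FB.
exists l => A /= Al; have [//|nA] := in_ultra_setVsetC (u @^-1` A) UU.
have [y [/= nAy Ay]] := ul (~` A) A nA Al.
by [].
Qed.

End UltraLimit.

Section FourierEquicontinuity.
Context {R : realType}.
Local Notation mu := (@lebesgue_measure R).

Lemma integral_norm_supp (a : R -> R) (S A : R) : 0 <= S ->
  measurable_fun setT a -> (forall x, S < `|x| -> a x = 0) ->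
  (\int[mu]_x (a x ^+ 2)%:E <= A%:E)%E -> \int[mu]_x `|a x| <= 2 * S + A.
Proof.
move=> S0 ma a0 aA; have a2 : (\int[mu]_x (a x ^+ 2)%:E < +oo)%E by rewrite (le_lt_trans aA)// ltry.
have ia := integrable_itv_supp ma a0 a2.
have iE : (\int[mu]_x `|a x|%:E)%E \is a fin_num.
  by apply: (integrable_fin_num measurableT); exact: integrable_norm ia.
rewrite -lee_fin /Rintegral fineK//.
have mI : measurable (`[- S, S]%classic : set (measurableTypeR R)) by exact: measurable_itv.
apply: (@le_trans _ _ (1%:E * \int[mu]_x (\1_(`[- S, S] : set R) x)%:E + 1%:E * \int[mu]_x (a x ^+ 2)%:E)%E).
  apply: ge0_integral_le_lincomb => //; try by move=> x; exact: sqr_ge0.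
  - exact: measurableT_comp.
  - exact: measurable_funX.
  move=> x; rewrite !mul1r; case: (leP `|x| S) => [xS|/a0 ->]; last first.
    by rewrite normr0 addr_ge0 ?sqr_ge0.
  rewrite indicE mem_set; last by rewrite /= in_itv /= -ler_norml.
  rewrite /= -[a x ^+ 2]real_normK ?num_real//.
  have := sqr_ge0 (`|a x| - 1); have := sqr_ge0 (`|a x|); rewrite sqrrB mulr1n; lra.
rewrite !mul1e EFinD; apply: leeD => //.
rewrite (_ : integral _ _ _ = mu (`[- S, S]%classic : set (measurableTypeR R))); last first.
  by rewrite integral_indic// setIT.
rewrite lebesgue_measure_itv /= lte_fin; case: ltP => _.
  by rewrite -EFinB lee_fin; lra.
by rewrite lee_fin mulr_ge0.
Qed.

Variables (S A : R).
Hypothesis S0 : 0 <= S.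
Let Bd := 2 * S + A.

(** The constants depend on [S] and [A] only: this is the equicontinuity that is
    used along an ultrafilter. *)
Lemma fourierI_bound_lipschitz (h : R -> R[i]) : sq_supp S h -> (sqint mu setT h <= A%:E)%E ->
  (forall w, `|complex.Re (fourierI h w)| <= 2 * Bd /\ `|complex.Im (fourierI h w)| <= 2 * Bd) /\
  (forall w v, `|complex.Re (fourierI h w) - complex.Re (fourierI h v)| <= 4 * pi * S * Bd * `|w - v| /\
     `|complex.Im (fourierI h w) - complex.Im (fourierI h v)| <= 4 * pi * S * Bd * `|w - v|).
Proof.
move=> hS hA; have ir := sq_supp_integrable_Re hS; have ii := sq_supp_integrable_Im hS.
have [[mr mi] h2 h0] := hS.
have r0 x : S < `|x| -> complex.Re (h x) = 0 by move=> /h0 ->.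
have i0 x : S < `|x| -> complex.Im (h x) = 0 by move=> /h0 ->.
have mh := measurable_sqnormc (proj1 (conj (conj mr mi) I)).
have rB : \int[mu]_x `|complex.Re (h x)| <= Bd.
  apply: (integral_norm_supp S0 mr r0); apply: le_trans hA; apply: ge0_le_integral => //.
  - by move=> x _; rewrite lee_fin sqr_ge0.
  - by apply/measurable_EFinP; exact: measurable_funX.
  - exact/measurable_EFinP.
  - by move=> x _; rewrite lee_fin /sqnormc lerDl sqr_ge0.
have iB : \int[mu]_x `|complex.Im (h x)| <= Bd.
  apply: (integral_norm_supp S0 mi i0); apply: le_trans hA; apply: ge0_le_integral => //.
  - by move=> x _; rewrite lee_fin sqr_ge0.
  - by apply/measurable_EFinP; exact: measurable_funX.
  - exact/measurable_EFinP.
  - by move=> x _; rewrite lee_fin /sqnormc lerDr sqr_ge0.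
have two (a b c : R) : `|a| <= c -> `|b| <= c -> `|a + b| <= 2 * c.
  by move=> ac bc; rewrite (le_trans (ler_normD _ _))// mulr_natl mulr2n lerD.
have lip w v (k j : R) : k <= Bd -> j <= 2 * pi * S * k * `|w - v| -> j <= 2 * pi * S * Bd * `|w - v|.
  move=> kB jk; apply: (le_trans jk); apply: ler_wpM2r => //.
  by apply: ler_wpM2l => //; rewrite !mulr_ge0 ?pi_ge0.
split=> [w|w v].
  rewrite (Re_fourierI w hS) (Im_fourierI w hS); split; apply: two.
  - exact: le_trans (norm_cosT_le w ir) rB.
  - exact: le_trans (norm_sinT_le w ii) iB.
  - exact: le_trans (norm_cosT_le w ii) iB.
  - by rewrite normrN; exact: le_trans (norm_sinT_le w ir) rB.
have -> : 4 * pi * S * Bd * `|w - v| = 2 * (2 * pi * S * Bd * `|w - v|) by rewrite !mulrA -natrM.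
rewrite !(Re_fourierI _ hS) !(Im_fourierI _ hS); split.
  have -> (a b c d : R) : a + b - (c + d) = (a - c) + (b - d) by ring.
  apply: two; [apply: lip rB _; exact: cosT_lipschitz|apply: lip iB _; exact: sinT_lipschitz].
have -> (a b c d : R) : a - b - (c - d) = (a - c) + - (b - d) by ring.
apply: two; first by apply: lip iB _; exact: cosT_lipschitz.
by rewrite normrN; apply: lip rB _; exact: sinT_lipschitz.
Qed.

End FourierEquicontinuity.

Section UniformTails.
Context {R : realType}.
Local Notation mu := (@lebesgue_measure R).
Local Notation H := (L2 (haar R)).

(** [Psi] will be one of the isometries [log_change] and [mellin]. *)
Definition uniform_tails (C : set H) (Psi : H -> L2 mu) :=
  forall e : R, 0 < e -> exists2 t0 : R, 0 <= t0 &
    forall t f, t0 <= t -> C f -> (tail (Psi f) t <= e%:E)%E.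

Section Isometry.
Variable Psi : H -> L2 mu.
Hypothesis isoP : forall f g, L2norm (Psi f - Psi g) = L2norm (f - g).

(** As [Psi] is an isometry, a small tail remains small for the neighbours of
    [g], and this does not depend on [t]. *)
Lemma tail_perturb f g t : (tail (Psi f) t <= 2%:E * tail (Psi g) t + 2%:E * (L2norm (f - g) ^+ 2)%:E)%E.
Proof. by rewrite -isoP; apply: sqint_L2_le2; exact: measurable_outside. Qed.

Let near_tail f g t (e : R) : 0 < e -> L2norm (f - g) <= Num.min 1 (e / 4) ->
  (tail (Psi g) t <= (e / 4)%:E -> tail (Psi f) t <= e%:E)%E.
Proof.
move=> e0; rewrite le_min => /andP[fg1 fge] gt; apply: (le_trans (tail_perturb f g t)).
have h : L2norm (f - g) ^+ 2 <= e / 4.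
  by apply: le_trans fge; rewrite expr2 ler_piMl ?L2norm_ge0.
apply: (@le_trans _ _ (2%:E * (e / 4)%:E + 2%:E * (e / 4)%:E)%E).
  by apply: leeD; apply: lee_wpmul2l; rewrite ?lee_fin.
rewrite -!EFinM -EFinD lee_fin le_eqVlt; apply/orP; left; apply/eqP; by field.
Qed.

Let min_gt0 (e : R) : 0 < e -> 0 < Num.min 1 (e / 4).
Proof. by move=> e0; rewrite lt_min ltr01 divr_gt0. Qed.

(** Each tail tends to 0, and [near_tail] makes the threshold valid on a
    neighbourhood of each point of [C]; finitely many of these neighbourhoods
    cover [C]. *)
Lemma compact_uniform_tails (C : set H) : compact C -> uniform_tails C Psi.
Proof.
move=> /compact_near_coveringP cC e e0.
have cov : \forall t \near +oo%R, C `<=` (fun f => (tail (Psi f) t <= e%:E)%E).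
  apply: cC => f Cf.
  have [t0 _ t0P] := tail_cvg0 (L2_mem (Psi f)) (divr_gt0 e0 (ltr0n R 4)).
  have /L2_cvgP/(_ _ (min_gt0 e0)) nf : nbhs f --> f by exact: cvg_id.
  exists ([set g | L2norm (f - g) <= Num.min 1 (e / 4)], [set t | t0 <= t]) => /=.
    by split => //; exact: (nbhs_pinfty_ge (num_real t0)).
  move=> [g t] /= [fg tt]; apply: (near_tail e0 _ (t0P t tt)).
  by rewrite L2norm_distC.
have [t1 [_ t1P]] := cov; exists (Num.max 0 (t1 + 1)); first by rewrite le_max lexx.
move=> t f; rewrite ge_max => /andP[_ tt] Cf; apply: (t1P t) => //.
by apply: lt_le_trans tt; rewrite ltrDl.
Qed.

Lemma closure_uniform_tails (K : set H) : uniform_tails K Psi -> uniform_tails (closure K) Psi.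
Proof.
move=> tK e e0; have [t0 t00 tP] := tK _ (divr_gt0 e0 (ltr0n R 4)).
exists t0 => // t f tt Kf.
have /L2_cvgP/(_ _ (min_gt0 e0)) nf : nbhs f --> f by exact: cvg_id.
have [g [Kg fg]] := Kf _ nf.
by apply: (near_tail e0 fg); exact: tP.
Qed.

End Isometry.

Lemma closure_bounded (K : set H) (M : R) : (forall f, K f -> L2norm f <= M) ->
  forall f, closure K f -> L2norm f <= M + 1.
Proof.
move=> KM f Kf.
have /L2_cvgP/(_ _ ltr01) nf : nbhs f --> f by exact: cvg_id.
have [g [Kg fg]] := Kf _ nf.
have := L2norm_dist_triangle g f 0; rewrite !subr0 => /le_trans; apply.
by rewrite addrC; apply: lerD => //; exact: KM.
Qed.

Section UltraCauchy.
Variables (C : set H) (M : R) (U : set_system H).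
Hypothesis CM : forall f, C f -> L2norm f <= M.
Hypothesis Ctime : uniform_tails C (@log_change R).
Hypothesis Cfreq : uniform_tails C (@mellin R).
Hypothesis UU : UltraFilter U.
Hypothesis UC : U C.

(** The Fourier integral of the truncation, a function defined at every
    frequency, whereas [mellin f] is a class. *)
Let phi (n : nat) (f : H) : R -> R[i] := fourierI (trunc n (log_change f)).

Let phi_supp n f : sq_supp (n%:R : R) (trunc n (log_change f)).
Proof. by apply: sq_supp_trunc; exact: L2_mem. Qed.

Let trunc_bound n f : C f -> (sqint mu setT (trunc n (log_change f)) <= (M ^+ 2)%:E)%E.
Proof.
move=> Cf; apply: (@le_trans _ _ (sqint mu setT (log_change f))).
  apply: ge0_le_integral => //.
  - by move=> x _; rewrite lee_fin sqnormc_ge0.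
  - apply/measurable_EFinP; apply: measurable_sqnormc.
    exact: (cmeasurable_trunc _ (L2_cmeasurable (log_change f))).
  - apply/measurable_EFinP; exact: (measurable_sqnormc (L2_cmeasurable (log_change f))).
  - by move=> x _; rewrite lee_fin sqnormc_trunc_le.
rewrite -L2norm_sqint log_change_norm lee_fin lerXn2r ?nnegrE ?L2norm_ge0 ?CM//.
by rewrite (le_trans (L2norm_ge0 f))// CM.
Qed.

Let equi n := fun f (Cf : C f) => fourierI_bound_lipschitz (ler0n R n) (phi_supp n f) (trunc_bound n Cf).

(** By boundedness the values at a given frequency converge along the
    ultrafilter; by the common Lipschitz constant they remain close on a
    neighbourhood of that frequency, and finitely many such neighbourhoods
    cover [[- X, X]]. *)
Let pointwise_cauchy n (X d : R) : 0 < d ->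
  \forall fg \near filter_prod U U, `[- X, X]%classic `<=`
    (fun w => sqnormc (phi n fg.1 w - phi n fg.2 w) <= d).
Proof.
move=> d0; pose Bd := 2 * n%:R + M ^+ 2.
have Bd0 : 0 <= Bd by rewrite addr_ge0 ?sqr_ge0.
pose L := 4 * pi * n%:R * Bd; have L0 : 0 <= L by rewrite /L !mulr_ge0 ?pi_ge0.
have [s s0 sd] : exists2 s : R, 0 < s & 2 * (4 * s) ^+ 2 <= d.
  (* 2 * (4 * s) ^+ 2 = 32 * s ^+ 2 <= 32 * s when s <= 1 *)
  exists (Num.min 1 (d / 32)); first by rewrite lt_min ltr01 divr_gt0.
  set m := Num.min _ _; have m1 : m <= 1 by rewrite ge_min lexx.
  have m2 : m <= d / 32 by rewrite ge_min lexx orbT.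
  have m0 : 0 < m by rewrite lt_min ltr01 divr_gt0.
  have : m ^+ 2 <= m by rewrite expr2 ler_piMl// ltW.
  rewrite exprMn; lra.
have := @segment_compact R (- X) X; move=> /compact_near_coveringP; apply => w Xw.
have [lr clr] : exists l : R, (fun f => complex.Re (phi n f w)) @ U --> l.
  apply: (@ultra_image_cvg _ _ U _ (2 * Bd)) => //.
  by have := UC; apply: filterS => f Cf; have [/(_ w)[]] := equi n Cf.
have [li cli] : exists l : R, (fun f => complex.Im (phi n f w)) @ U --> l.
  apply: (@ultra_image_cvg _ _ U _ (2 * Bd)) => //.
  by have := UC; apply: filterS => f Cf; have [/(_ w)[]] := equi n Cf.
move/cvgrPdist_le : clr => /(_ s s0) Ur; move/cvgrPdist_le : cli => /(_ s s0) Ui.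
pose V := [set f | [/\ C f, `|lr - complex.Re (phi n f w)| <= s & `|li - complex.Im (phi n f w)| <= s]].
have UV : U V by apply: filterS3 UC Ur Ui.
pose W := [set v : R | L * `|w - v| <= s].
have nW : nbhs (w : R) W.
  have L1 : 0 < L + 1 by rewrite ltr_pwDr.
  have sL : 0 < s / (L + 1) by rewrite divr_gt0.
  apply/nbhs_ballP; exists (s / (L + 1)) => //= v /ltW.
  rewrite ler_pdivlMr// => h; rewrite /W /=.
  apply: le_trans h; rewrite mulrDr mulr1 mulrC lerDl//.
exists (W, [set fg | V fg.1 /\ V fg.2]) => /=.
  by split => //; exists (V, V).
move=> [v [f g]] /= [Wv [[Cf fr fi] [Cg gr gi]]].
have Wle : 4 * pi * n%:R * (2 * n%:R + M ^+ 2) * `|w - v| <= s by exact: Wv.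
have [_ /(_ w v)[fr1 fi1]] := equi n Cf; have [_ /(_ w v)[gr1 gi1]] := equi n Cg.
rewrite sqnormcB; apply: le_trans sd; rewrite mulr_natl mulr2n; apply: lerD.
  by apply: (sqr_dist_chain fr gr); [exact: le_trans fr1 Wle|exact: le_trans gr1 Wle].
by apply: (sqr_dist_chain fi gi); [exact: le_trans fi1 Wle|exact: le_trans gi1 Wle].
Qed.

Let ftrunc n f : L2 mu := fourier_trunc n (log_change f).

Let phi_cL2 n f : phi n f \in cL2 mu.
Proof. exact: fourierI_cL2 (ler0n R n) (phi_supp n f). Qed.

Let mphi n f : cmeasurable_fun (phi n f).
Proof. exact: cmeasurable_fourierI (phi_supp n f). Qed.

(** [mellin f] has a small tail and is close to [ftrunc n f]. *)
Let tail_phi n f t (e : R) : (tail (mellin f) t <= (e ^+ 2)%:E)%E ->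
  L2norm (mellin f - ftrunc n f) <= e -> 0 <= e ->
  (tail (phi n f) t <= (4 * e ^+ 2)%:E)%E.
Proof.
move=> tf df e0; rewrite /tail.
have <- : sqint mu (outside t) (ftrunc n f) = sqint mu (outside t) (phi n f).
  by apply: toL2_sqint (phi_cL2 n f); exact: measurable_outside.
apply: (le_trans (sqint_L2_le2 _ (mellin f) (measurable_outside t))).
apply: (@le_trans _ _ (2%:E * (e ^+ 2)%:E + 2%:E * (e ^+ 2)%:E)%E).
  apply: leeD; apply: lee_wpmul2l => //.
  by rewrite lee_fin L2norm_distC lerXn2r ?nnegrE ?L2norm_ge0.
rewrite -!EFinM -EFinD lee_fin le_eqVlt; apply/orP; left; apply/eqP; ring.
Qed.

(** Pointwise closeness is used on [[- X, X]], and the two tails outside. *)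
Let ftrunc_close n f g (X d e : R) : 0 <= X -> 0 <= e -> X * d <= e ^+ 2 ->
  (forall w, `[- X, X]%classic w -> sqnormc (phi n f w - phi n g w) <= d) ->
  (tail (phi n f) X <= (4 * e ^+ 2)%:E)%E -> (tail (phi n g) X <= (4 * e ^+ 2)%:E)%E ->
  L2norm (ftrunc n f - ftrunc n g) <= 5 * e.
Proof.
move=> X0 e0 Xd fgd tf tg; have e50 : 0 <= 5 * e by rewrite mulr_ge0.
rewrite -ler_sqr ?nnegrE ?L2norm_ge0// -lee_fin L2norm_sqint.
pose D (t : R) := phi n f t - phi n g t.
have mD : cmeasurable_fun D by exact: cmeasurable_funB (mphi n f) (mphi n g).
rewrite /ftrunc /fourier_trunc -(toL2B (phi_cL2 n f) (phi_cL2 n g)).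
rewrite (toL2_sqint (@measurableT _ _) (cL2B (phi_cL2 n f) (phi_cL2 n g))) -/D.
pose J : set (measurableTypeR R) := `[- X, X]%classic.
have mJ : measurable J by exact: measurable_itv.
have -> : [set: measurableTypeR R] = J `|` outside X.
  apply/seteqP; split => // t _; rewrite /J /outside /= in_itv /= -ler_norml.
  by case: (leP `|t| X); [left|right].
rewrite /sqint ge0_integral_setU//=; first last.
- rewrite disj_set2E; apply/eqP/seteqP; split => // t [].
  by rewrite /J /outside /= in_itv /= -ler_norml leNgt => /negP.
- by move=> t _; rewrite lee_fin sqnormc_ge0.
- by apply/measurable_EFinP; apply: measurable_funTS; exact: measurable_sqnormc.
- exact: measurable_outside.
have c1 : (\int[mu]_(t in J) (sqnormc (D t))%:E <= (2 * e ^+ 2)%:E)%E.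
  apply: (@le_trans _ _ (\int[mu]_(t in J) (cst d%:E t))%E).
    apply: ge0_le_integral => //.
    + by move=> t _; rewrite lee_fin sqnormc_ge0.
    + by apply/measurable_EFinP; apply: measurable_funTS; exact: measurable_sqnormc.
  rewrite integral_cst// [X in (_ * X)%E](lebesgue_measure_itv `[- X, X]) /= lte_fin; case: ltP => _.
    rewrite -EFinB -EFinM lee_fin opprK mulrDr mulrC.
    by rewrite mulr_natl mulr2n lerD.
  by rewrite mule0 lee_fin mulr_ge0 ?sqr_ge0.
have c2 : (\int[mu]_(t in outside X) (sqnormc (D t))%:E <= 2%:E * (4 * e ^+ 2)%:E + 2%:E * (4 * e ^+ 2)%:E)%E.
  apply: (@le_trans _ _ (2%:E * tail (phi n f) X + 2%:E * tail (phi n g) X)%E).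
    apply: ge0_integral_le_lincomb => //.
    - exact: measurable_outside.
    - exact: measurable_sqnormc mD.
    - exact: measurable_sqnormc (mphi n f).
    - exact: measurable_sqnormc (mphi n g).
    - by move=> t; exact: sqnormc_ge0.
    - by move=> t; exact: sqnormc_ge0.
    - by move=> t; exact: sqnormc_ge0.
    - by move=> t; rewrite /D -[X in _ + 2 * X]sqnormcN; exact: sqnormc_le2.
  have n2 : (0 <= 2%:E :> \bar R)%E by rewrite lee_fin.
  exact: (leeD (lee_wpmul2l n2 tf) (lee_wpmul2l n2 tg)).
apply: (le_trans (leeD c1 c2)); rewrite -!EFinM -!EFinD lee_fin exprMn.
have -> (q : R) : 2 * q + (2 * (4 * q) + 2 * (4 * q)) = 18 * q by ring.
by rewrite ler_wpM2r ?sqr_ge0// -natrX ler_nat.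
Qed.

(** The time tails make [mellin f] uniformly close to the transform of a
    truncation of [f], whose values converge uniformly on bounded sets along
    the ultrafilter; the frequency tails control the rest. As [mellin] is an
    isometry, closeness of the transforms is closeness of the functions. *)
Lemma ultra_cauchy (e : R) : 0 < e ->
  exists2 A, U A & forall f g, A f -> A g -> L2norm (f - g) <= e.
Proof.
(* the distance is split into eta + 5 * eta + eta: two truncation errors and
   the distance between the truncated transforms *)
move=> e0; pose eta := e / 7; have eta0 : 0 < eta by rewrite divr_gt0.
have [t0 t00 tP] := Ctime (exprn_gt0 2 eta0).
have [X X0 XP] := Cfreq (exprn_gt0 2 eta0).
pose n := Num.bound t0.
have tn f : C f -> (tail (log_change f) n%:R <= (eta ^+ 2)%:E)%E.
  by move=> Cf; apply: tP => //; apply: ltW; exact: archi_boundP.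
have X1 : 0 < X + 1 by rewrite ltr_wpDl.
pose d := eta ^+ 2 / (X + 1).
have d0 : 0 < d by rewrite divr_gt0// exprn_gt0.
have Xd : X * d <= eta ^+ 2.
  by rewrite /d mulrCA ler_piMr ?sqr_ge0// ler_pdivrMr// mul1r lerDl.
have [[A1 A2] /= [UA1 UA2] AP] := pointwise_cauchy n X d0.
exists (A1 `&` A2 `&` C); first by apply: filterI => //; exact: filterI.
move=> f g [[f1 f2] Cf] [[g1 g2] Cg].
have df h : C h -> L2norm (mellin h - ftrunc n h) <= eta.
  by move=> Ch; apply: fourierL2_dist_trunc; [exact: ltW|exact: tn].
have th h : C h -> (tail (phi n h) X <= (4 * eta ^+ 2)%:E)%E.
  by move=> Ch; apply: tail_phi; [exact: XP|exact: df|exact: ltW].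
have dd := ftrunc_close X0 (ltW eta0) Xd (AP (f, g) (conj f1 g2)) (th f Cf) (th g Cg).
rewrite -mellin_dist.
apply: (le_trans (L2norm_dist_triangle (ftrunc n f) _ _)).
apply: (le_trans (lerD (df f Cf) (L2norm_dist_triangle (ftrunc n g) _ _))).
have dg := df g Cg; rewrite L2norm_distC in dg.
apply: (le_trans (lerD (lexx _) (lerD dd dg))).
by rewrite le_eqVlt; apply/orP; left; apply/eqP; rewrite /eta; field.
Qed.

End UltraCauchy.

(** A set is compact when its ultrafilters converge in it. Those on the
    closure of [K] are Cauchy, since the bound and the uniform tails pass to
    the closure. *)
Lemma uniform_tails_precompact (K : set H) (M : R) : (forall f, K f -> L2norm f <= M) ->
  uniform_tails K (@log_change R) -> uniform_tails K (@mellin R) -> precompact K.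
Proof.
move=> KM Kt Kf; rewrite precompactE compact_ultra => U UU UK.
have CM := closure_bounded KM.
have Ct := closure_uniform_tails (@log_change_dist R) Kt.
have Cf := closure_uniform_tails (@mellin_dist R) Kf.
have PU : ProperFilter U by exact: ultra_proper.
have [z Uz] := L2_complete PU (ultra_cauchy CM Ct Cf UU UK).
exists z; split => //; apply: (@closed_closure _ K z) => B Bz.
exact: (filter_ex (filterI UK (Uz B Bz))).
Qed.

End UniformTails.

(** * From the limit of suprema to uniform bounds *)

Section UniformLimit.
Context {R : realType}.
Local Notation H := (L2 (haar R)).

Lemma bounded_L2norm (K : set H) : bounded_set K ->
  exists2 M : R, 0 <= M & forall f, K f -> L2norm f <= M.
Proof.
move=> [B [Br BP]]; have B1 : B < B + 1 by rewrite ltrDl.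
exists (Num.max 0 (complex.Re (B + 1))); first by rewrite le_max lexx.
move=> f Kf; rewrite le_max; apply/orP; right.
have := BP _ B1 f Kf; rewrite /= L2_normE.
by case: (B + 1) => a b; rewrite lecE /= => /andP[].
Qed.

Lemma nnsup_cvg0P (T : Type) (K : set T) (E : R -> T -> \bar R) :
  (forall xi f, (0 <= E xi f)%E) ->
  nnsup [set E xi f | f in K] @[xi --> +oo] --> 0%E <->
  forall e : R, 0 < e ->
    \forall xi \near +oo, forall f, K f -> (E xi f <= e%:E)%E.
Proof.
move=> E0; have sup0 xi : (0 <= nnsup [set E xi f | f in K])%E.
  by apply: ereal_sup_ubound; left.
split.
  move=> /fine_cvgP[fin cv] e e0; move/cvgrPdist_le: cv => /(_ e e0) cv.
  near=> xi => f Kf.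
  have fx : nnsup [set E xi f | f in K] \is a fin_num by near: xi.
  have cx : `|0 - fine (nnsup [set E xi f | f in K])| <= e by near: xi.
  apply: (@le_trans _ _ (nnsup [set E xi f | f in K])).
    by apply: ereal_sup_ubound; right; exists f.
  rewrite -(fineK fx) lee_fin; move: cx; rewrite sub0r normrN ger0_norm//.
  exact: fine_ge0.
move=> h; apply/fine_cvgP.
have sup_le e xi : 0 < e -> (forall f, K f -> (E xi f <= e%:E)%E) ->
    (nnsup [set E xi f | f in K] <= e%:E)%E.
  move=> e0 he; apply: ge_ereal_sup => _ [->|[f Kf <-]]; last exact: he.
  by rewrite lee_fin ltW.
split.
  have := h 1 ltr01; apply: filterS => xi /(sup_le _ _ ltr01) h1.
  by rewrite ge0_fin_numE// (le_lt_trans h1)// ltry.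
apply/cvgrPdist_le => e e0; have := h e e0; apply: filterS => xi /(sup_le _ _ e0) h1 /=.
have fx : nnsup [set E xi f | f in K] \is a fin_num.
  by rewrite ge0_fin_numE// (le_lt_trans h1)// ltry.
by rewrite sub0r normrN ger0_norm ?fine_ge0// -lee_fin fineK.
Unshelve. all: by end_near.
Qed.

Lemma tail_le_norm (h : L2 (@lebesgue_measure R)) t : (tail h t <= (L2norm h ^+ 2)%:E)%E.
Proof.
rewrite L2norm_sqint; apply: sqint_setT_ge; first exact: measurable_outside.
exact: L2_cmeasurable.
Qed.

(** Used with [a] a tail and [b] a squared norm. That a product with the
    squared norm is small gives no bound on the tail when the norm is itself
    small; the inequality [a <= b] then bounds the tail, through [a * a <= a *
    b]. *)
Lemma le_of_sqr_le (a b : \bar R) (e : R) : (0 <= a)%E -> (a <= b)%E -> 0 <= e ->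
  (a * b <= (e ^+ 2)%:E)%E -> (a <= e%:E)%E.
Proof.
move=> a0 ab e0 abe; rewrite leNgt; apply/negP => ea; move: abe; apply/negP.
rewrite -ltNge expr2 EFinM; apply: (@lt_le_trans _ _ (a * a)%E).
  case: a a0 ab ea => [a||]//= a0 _; rewrite ?lte_fin => ea.
    by rewrite ltr_pM.
  by rewrite mulyy ltry.
exact: lee_wpmul2l.
Qed.

End UniformLimit.

Theorem theorem4p9 (R : realType) (K : set (L2 (haar R))) :
  bounded_set K ->
  (precompact K <->
   nnsup [set rihaczek_energy f
            (([set: R] `*` `]0, +oo[) `\` (`[- xi, xi] `*` `[xi^-1, xi]))
         | f in K] @[xi --> +oo] --> 0%E).
Proof.
move=> /bounded_L2norm[M M0 KM].
pose D (xi : R) : set (R * R) :=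
  ([set: R] `*` `]0, +oo[) `\` (`[- xi, xi] `*` `[xi^-1, xi]).
rewrite (@nnsup_cvg0P R _ K (fun xi f => rihaczek_energy f (D xi))); last first.
  by move=> xi f; apply: integral_ge0 => p _; rewrite lee_fin sqr_ge0.
split.
  rewrite precompactE => cK e e0.
  have Kcl : K `<=` closure K by exact: subset_closure.
  (* the energy is at most 2 * d * M ^+ 2 when both tails are at most d *)
  pose d := e / (2 * (M ^+ 2 + 1)).
  have M1 : 0 < M ^+ 2 + 1 by rewrite ltr_wpDl ?sqr_ge0.
  have d0 : 0 < d by rewrite divr_gt0// mulr_gt0.
  have [s s0 sP] := compact_uniform_tails (@mellin_dist R) cK d0.
  have [t t0 tP] := compact_uniform_tails (@log_change_dist R) cK d0.
  near=> xi => f Kf.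
  have sx : s <= xi by near: xi; apply: nbhs_pinfty_ge; exact: num_real.
  have tx : expR t <= xi by near: xi; apply: nbhs_pinfty_ge; exact: num_real.
  have xi0 : 0 < xi by exact: lt_le_trans (expR_gt0 t) tx.
  apply: (le_trans (rihaczek_energy_le f xi0)).
  have a := sP xi f sx (Kcl _ Kf).
  have b : (tail (log_change f) (ln xi) <= d%:E)%E.
    by apply: tP; [rewrite -(expRK t) ler_ln ?posrE ?expR_gt0|exact: Kcl].
  have N0 : (0 <= (L2norm f ^+ 2)%:E)%E by rewrite lee_fin sqr_ge0.
  apply: (le_trans (leeD (lee_wpmul2r N0 a) (lee_wpmul2l N0 b))).
  rewrite -!EFinM -EFinD lee_fin [_ * d]mulrC -mulr2n -mulr_natl.
  have NM : L2norm f ^+ 2 <= M ^+ 2 + 1.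
    by rewrite ler_wpDr// lerXn2r ?nnegrE ?L2norm_ge0 ?KM.
  have -> : e = 2 * (d * (M ^+ 2 + 1)) by rewrite /d; field; rewrite gt_eqF.
  by rewrite ler_wpM2l// ler_wpM2l// ltW.
move=> h.
(* a squared bound, because the energy bounds the square of a tail *)
have energy_small e : 0 < e -> exists2 X : R, 0 < X & forall xi f, X <= xi -> K f ->
    (rihaczek_energy f (D xi) <= (e ^+ 2)%:E)%E.
  move=> e0; have [X [_ XP]] := h _ (exprn_gt0 2 e0).
  exists (Num.max 1 (X + 1)); first by rewrite lt_max ltr01.
  move=> xi f; rewrite ge_max => /andP[_ Xx] Kf; apply: XP => //.
  by apply: lt_le_trans Xx; rewrite ltrDl.
apply: (uniform_tails_precompact KM) => e e0; have [X X0 XP] := energy_small e e0.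
  (* the interval [-t, t] on the logarithmic scale is [1 / xi, xi] with xi = expR t *)
  exists (Num.max 0 (ln X)) => [|t f]; first by rewrite le_max lexx.
  rewrite ge_max => /andP[t0 Xt] Kf.
  have Xe : X <= expR t by rewrite -(lnK X0) ler_expR.
  have := rihaczek_energy_ge_time f (expR_gt0 t); rewrite expRK muleC => h1.
  apply: (le_of_sqr_le (tail_ge0 _ _) (tail_le_norm _ _) (ltW e0)).
  by rewrite log_change_norm; apply: (le_trans h1); exact: XP.
exists X => [|t f Xt Kf]; first exact: ltW.
apply: (le_of_sqr_le (tail_ge0 _ _) (tail_le_norm _ _) (ltW e0)).
by rewrite mellin_norm; apply: (le_trans (rihaczek_energy_ge_freq f t)); exact: XP.
Unshelve. all: by end_near.
Qed.
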